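(* Let $\Omega$ be a connected open set in $\mathbb C$ and $z_0\in\partial\Omega$. Let $u$ be a nonconstant holomorphic function on $\Omega$ that extends smoothly across $z_0$, with the extension still denoted by $u$, and with $u(z_0)=0$. Then the following statements are equivalent: (1) $u$ vanishes to infinite order at $z_0$. (2) $\frac{|\bar\partial u|}{|u|}\notin L^\infty$ near $z_0$ (i.e. it is not in $L^\infty$ of any neighborhood of $z_0$). (3) $\frac{|\bar\partial u|}{|u|}\notin L^2$ near $z_0$ (i.e. it is not in $L^2$ of any neighborhood of $z_0$).
   Context: ''$u$ extends smoothly across $z_0$'' means that there is an open neighborhood $N$ of $z_0$ and a $C^\infty$ complex-valued function on $\Omega\cup N$ agreeing with $u$ on $\Omega$; neighborhoods of $z_0$ in (2) and (3) are contained in $N$. With $z=x_1+ix_2$, $\bar\partial u=\frac12(\partial_{x_1}u+i\partial_{x_2}u)$. The quotient is taken where $u\neq0$ and set to be $0$ where $u=0$. $u$ vanishes to infinite order at $z_0$ (in the $L^2$ sense) if for all $m\ge0$, $\lim_{r\to0}r^{-m}\int_{|z-z_0|<r}|u|^2dv=0$, $dv$ being Lebesgue measure on $\mathbb C=\mathbb R^2$ (for smooth $u$ this is equivalent to the vanishing of all derivatives at $z_0$). *)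

(* Defs.v *)
From HB Require Import structures.
From mathcomp Require Import all_boot all_order all_algebra.
From mathcomp Require Import complex.
From mathcomp Require Import all_classical all_reals all_analysis.

Set Implicit Arguments.
Unset Strict Implicit.
Unset Printing Implicit Defensive.

Import Order.TTheory GRing.Theory Num.Theory.
Import numFieldNormedType.Exports.

Local Open Scope classical_set_scope.
Local Open Scope ring_scope.
Local Open Scope complex_scope.

(* [R[i]^o] is R[i] as a normed space over itself, so that open sets, closures
   and continuity refer to the topology of the complex modulus and [derivable]
   is complex differentiability. *)
Notation Cplane R := (GRing.regular (complex R)) (only parsing).

(* [measurableTypeR R] is R with its Borel sigma-algebra. *)
Notation plane R := (measurableTypeR R * measurableTypeR R)%type (only parsing).

Section ComplexFunctions.
Variable R : realType.
Local Notation C := (Cplane R).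
Implicit Types (f u : C -> C) (D U N : set C) (z v : C).

Definition cabs z : R := Normc.normc z.

Definition holomorphic_on D f := forall z, D z -> derivable f z 1.

(* Real directional derivatives: the increment [t] is a real number, so that
   [v := 1] gives d/dx_1 and [v := 'i%C] gives d/dx_2, where z = x_1 + i x_2.
   The notation must be taken in %C: [Num]'s ['i] is an abstract square root
   of -1, not definitionally the one with imaginary part 1. *)
Definition real_derivable v f z :=
  derivable (fun t : R => complex.Re (f (z + t%:C * v))) 0 1 /\
  derivable (fun t : R => complex.Im (f (z + t%:C * v))) 0 1.

Definition real_deriv v f z : C :=
  derive1 (fun t : R => complex.Re (f (z + t%:C * v))) 0 +i*
  derive1 (fun t : R => complex.Im (f (z + t%:C * v))) 0.

(* Meant for open [D], on which the derivatives are two-sided. *)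
Fixpoint Ck_on (k : nat) D f : Prop :=
  (forall z, D z -> {for z, continuous f}) /\
  match k with
  | 0 => True
  | k'.+1 =>
      [/\ forall z, D z -> real_derivable 1 f z /\ real_derivable 'i%C f z,
          Ck_on k' D (real_deriv 1 f) & Ck_on k' D (real_deriv 'i%C f)]
  end.

Definition smooth_on D f := forall k, Ck_on k D f.

Definition dbar f z : C :=
  2^-1 * (real_deriv 1 f z + 'i%C * real_deriv 'i%C f z).

Definition plane_point (p : plane R) : C := p.1 +i* p.2.

Definition lebesgue_plane : {measure set (plane R) -> \bar R} :=
  (@lebesgue_measure R \x @lebesgue_measure R)%E.

(* Lp on [U], via extension by 0 outside [U]. *)
Definition in_Lp (p : \bar R) U (g : C -> R) : Prop :=
  (g \o plane_point) \_ (plane_point @^-1` U) \in Lfun lebesgue_plane p.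

Definition notin_Lp_near (p : \bar R) N z (g : C -> R) : Prop :=
  forall U, open_nbhs z U -> U `<=` N -> ~ in_Lp p U g.

Definition vanishes_to_infinite_order f z :=
  forall m : nat,
    (((r ^- m)%:E *
      \int[lebesgue_plane]_(p in [set p | (cabs (plane_point p - z) < r)%R])
        ((cabs (f (plane_point p)) ^+ 2)%R)%:E)%E
      @[r --> (0 : R)^'+]) --> 0%E.

Definition dbar_quotient f z : R :=
  if f z == 0 then 0 else cabs (dbar f z) / cabs (f z).

Definition smooth_extension_across (Omega : set C) u (z0 : C) N ue :=
  [/\ open_nbhs z0 N, smooth_on (Omega `|` N) ue &
      forall z, Omega z -> ue z = u z].

End ComplexFunctions.

(* Main.v *)
(* Let the extension be smooth on D. Then dbar u is zero on Omega, so by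
   continuity all its derivatives vanish at z0, and dbar u = O(|z - z0|^k) for
   every k. If some pure derivative d^k u / dx^k is nonzero at z0, take the
   first: u = c (z - z0)^k + O(|z - z0|^(k+1)) with c <> 0, so the quotient is
   bounded near z0 and u vanishes to finite order only. Otherwise
   u = O(|z - z0|^k) for every k, which is (1), and (3) follows from the unique
   continuation property for |dbar u| <= V |u| with V in L^2: were the quotient
   in L^2 near z0, u would vanish near z0, hence on a nonempty open part of
   Omega, hence on Omega. The same property with V = 0 gives that last step.

   Unique continuation is proved by a Carleman inequality whose weight is
   adapted to V: exp(psi) / |z - z0|^(2m), where psi is a logarithmic potential
   of a multiple of V^2 + M. Its Laplacian absorbs V^2 |u|^2, and Jensen's
   inequality bounds the integral of exp(psi) from below; letting m tend to
   infinity forces u = 0 near z0. *)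
Require Import Defs.
From mathcomp Require Import all_boot all_order all_algebra.
From mathcomp Require Import complex.
From mathcomp Require Import all_classical all_reals all_analysis.
From mathcomp Require Import measurable_realfun ess_sup_inf.
From mathcomp Require Import ring lra.

Set Implicit Arguments.
Unset Strict Implicit.
Unset Printing Implicit Defensive.

Import Order.TTheory GRing.Theory Num.Theory.
Import numFieldNormedType.Exports.

Local Open Scope classical_set_scope.
Local Open Scope ring_scope.

(** The obstacle is that [V^2] is only integrable: its logarithmic potential need be neither bounded
    below nor smooth, while the integration by parts needs a [C^2] weight. So [psi] is a finite sum
    over a grid of logarithms smoothed at the scale of the mesh, and two properties suffice.
    Wherever the density is continuous and positive, the Laplacian eventually dominates it, with no
    convergence claimed; and the mean of [psi] over a rectangle is bounded below independently of
    the grid. The order of limits matters: the grid is refined with [m] fixed, flatness at [z0]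
    dominating the singular weight so that the errors tend to [0], and [m] is chosen beforehand so
    that the limiting inequality fails.

    On the zero set of [u] the quotient is [0] by convention and the weight controls nothing there,
    although [dbar u] may be nonzero. This set is harmless: zeros at which some first partial
    derivative is nonzero form a null set.

    The cutoff is a polynomial vanishing on the boundary of a square. The constant [M] added to the
    density pays for its gradient near the centre. *)

Section PlaneMeasure.
Variable R : realType.
Local Notation plane := (plane R).
Implicit Types (f : R * R -> R) (D O : set (R * R)).

Lemma open_prodP O : open O <->
  forall p, O p -> exists2 e : R, 0 < e &
    forall q, `|q.1 - p.1| < e -> `|q.2 - p.2| < e -> O q.
Proof.
rewrite openE; split => [oO p /oO|oO p /oO[e e0 eO]].
- rewrite /interior/= -nbhs_ballE => -[e /= e0 eO]; exists e => // q q1 q2.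
  by apply: eO; split => /=; rewrite /ball/= distrC.
- rewrite /interior/= -nbhs_ballE; exists e => //= q [/=].
  by rewrite /ball/= distrC => q1; rewrite distrC => q2; exact: eO.
Qed.

(** The sigma-algebra of [plane] is the product one, so this is not immediate from openness. It
    holds because countably many boxes with rational centre and radius [1 / (k + 1)], those
    contained in [O], already cover [O]. *)
Lemma measurable_openX O : open O -> measurable (O : set plane).
Proof.
move/open_prodP => oO.
pose box (i : rat * rat * nat) : set (R * R) :=
  `](ratr i.1.1 - i.2.+1%:R^-1 : R), ratr i.1.1 + i.2.+1%:R^-1[%classic `*`
  `](ratr i.1.2 - i.2.+1%:R^-1 : R), ratr i.1.2 + i.2.+1%:R^-1[%classic.
pose F i : set (R * R) := if `[< box i `<=` O >] then box i else set0.
have mF i : measurable (F i : set plane).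
  rewrite /F; case: ifPn => _; last exact: measurable0.
  by apply: measurableX; exact: measurable_itv.
suff -> : O = \bigcup_i F i.
  by apply: countable_bigcupT_measurable mF; exact: countableP.
rewrite eqEsubset; split => [p Op|p [i _]]; last first.
  by rewrite /F; case: ifPn => // /asboolP + bp; apply.
have [e e0 eO] := oO _ Op.
(* The rational centre lies within [d] of [p] and the box has radius [d], so the box stays within
   [2 d < e] of [p]. *)
have [k [d [dE d0 de]]] :
    exists k (d : R), [/\ k.+1%:R^-1 = d, 0 < d & d < e / 2].
  have /ltr_add_invr[k] : 0 < e / 2 :> R by rewrite divr_gt0.
  rewrite add0r => ke; by exists k, k.+1%:R^-1.
have q1 x : exists q : rat, `|ratr q - x| < d.
  have /rat_in_itvoo[q] : x - d < x + d by lra.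
  rewrite in_itv/= => /andP[q1 q2]; exists q.
  by rewrite ltr_norml; apply/andP; split; lra.
have [q1' h1] := q1 p.1.
have [q2' h2] := q1 p.2.
have bi : box (q1', q2', k) `<=` O.
  move: h1 h2; rewrite !ltr_norml => /andP[a1 a2] /andP[b1 b2].
  move=> [x y] [/=]; rewrite !in_itv/= dE => /andP[x1 x2] /andP[y1 y2].
  apply: eO; rewrite /= ltr_norml; apply/andP; split; lra.
exists (q1', q2', k) => //; rewrite /F asboolT//.
move: h1 h2; rewrite !ltr_norml => /andP[a1 a2] /andP[b1 b2].
by split => /=; rewrite in_itv/= dE; apply/andP; split; lra.
Qed.

Lemma measurable_continuous_openX D f : open D ->
  (forall p, D p -> {for p, continuous f}) -> measurable_fun (D : set plane) f.
Proof.
move=> oD cf; apply: (measurability _ (RGenOInfty.measurableE R)).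
move=> _ [_ [a ->] <-].
apply: measurable_openX; rewrite openE => p [Dp fp].
have /(_ `]a, +oo[%classic) H := cf p Dp.
apply: filterI; first by apply: open_nbhs_nbhs; split.
by apply: H; apply: open_nbhs_nbhs; split => //; exact: interval_open.
Qed.

End PlaneMeasure.

(** * Fubini and the fundamental theorem of calculus on closed rectangles *)

Section Rectangle.
Variable R : realType.
Local Notation plane := (plane R).
Local Notation mu := (lebesgue_plane R).
Local Notation leb := (@lebesgue_measure R).
Implicit Types (f g : R * R -> R) (D O : set (R * R)) (a b c d : R).

Definition rect a b c d : set (R * R) := `[a, b]%classic `*` `[c, d]%classic.

Lemma rectE a b c d p : rect a b c d p <-> (a <= p.1 <= b /\ c <= p.2 <= d).
Proof. by rewrite /rect /setX/= !in_itv/=. Qed.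

Lemma measurable_rect a b c d : measurable (rect a b c d : set plane).
Proof. by apply: measurableX; exact: measurable_itv. Qed.

Lemma lebesgue_plane_rectE a b c d :
  mu (rect a b c d) = (leb `[a, b] * leb `[c, d])%E.
Proof. by apply: product_measure1E; exact: measurable_itv. Qed.

Lemma lebesgue_plane_rect a b c d : a <= b -> c <= d ->
  mu (rect a b c d) = ((b - a) * (d - c))%:E.
Proof.
move=> ab cd; rewrite lebesgue_plane_rectE !lebesgue_measure_itv/= !lte_fin EFinM.
have H x y : x <= y -> (if x < y then (y%:E - x%:E)%E else 0%E) = (y - x)%:E :> \bar R.
  by case: ltgtP => // -> _; rewrite subrr.
by rewrite !H.
Qed.

Lemma lebesgue_plane_rect_fin a b c d : (mu (rect a b c d) < +oo)%E.
Proof.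
rewrite lebesgue_plane_rectE !lebesgue_measure_itv/=.
by case: ifPn => _; case: ifPn => _; rewrite ?mule0 ?mul0e ?ltry// -!EFinB -EFinM ltry.
Qed.

Lemma compact_rect a b c d : compact (rect a b c d).
Proof. by apply: compact_setX; exact: segment_compact. Qed.

Lemma continuous_rect_bounded D a b c d f : rect a b c d `<=` D ->
  (forall p, D p -> {for p, continuous f}) ->
  exists2 M : R, 0 < M & forall p, rect a b c d p -> `|f p| <= M.
Proof.
move=> rD cf.
have : compact (f @` rect a b c d).
  apply: continuous_compact; last exact: compact_rect.
  by apply: continuous_in_subspaceT => p; rewrite inE => /rD /cf.
move/compact_bounded => -[M [_ HM]]; exists (`|M| + 1).
  by rewrite ltr_wpDl.
move=> p rp; apply: (HM (`|M| + 1)); last by exists p.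
by rewrite ltr_pwDr// ler_norm.
Qed.

Lemma continuous_rect_measurable D a b c d f : open D -> rect a b c d `<=` D ->
  (forall p, D p -> {for p, continuous f}) ->
  measurable_fun (rect a b c d : set plane) f.
Proof.
move=> oD rD cf; have mD := measurable_openX oD.
apply: (@measurable_funS _ _ plane R (D : set plane)) => //.
exact: measurable_continuous_openX oD cf.
Qed.

Lemma bounded_rect_integrable a b c d f (M : R) :
  measurable_fun (rect a b c d : set plane) f ->
  (forall p, rect a b c d p -> `|f p| <= M) ->
  mu.-integrable (rect a b c d) (EFin \o f).
Proof.
move=> mf fM; apply: measurable_bounded_integrable => //.
- exact: measurable_rect.
- exact: lebesgue_plane_rect_fin.
- exists M; split; first exact: num_real.
  by move=> x Mx p rp; exact: le_trans (fM p rp) (ltW Mx).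
Qed.

Lemma continuous_rect_integrable D a b c d f : open D -> rect a b c d `<=` D ->
  (forall p, D p -> {for p, continuous f}) ->
  mu.-integrable (rect a b c d) (EFin \o f).
Proof.
move=> oD rD cf; have [M _ fM] := continuous_rect_bounded rD cf.
by apply: (bounded_rect_integrable _ fM); exact: continuous_rect_measurable cf.
Qed.

Lemma integral_rect12 a b c d f :
  mu.-integrable (rect a b c d) (EFin \o f) ->
  (\int[mu]_(p in rect a b c d) (f p)%:E =
   \int[leb]_(x in `[a, b]) \int[leb]_(y in `[c, d]) (f (x, y))%:E)%E.
Proof.
move=> intf; rewrite integral_mkcond/=.
have intf' : mu.-integrable setT ((EFin \o f) \_ (rect a b c d)).
  by apply/(integrable_mkcond _ (measurable_rect a b c d)).
rewrite -[LHS](@integral12_prod_meas1 _ _ _ _ R leb leb _ intf').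
rewrite [RHS]integral_mkcond; apply: eq_integral => x _ /=.
rewrite /fubini_F/= patchE; case: ifPn => [|] xab; last first.
  under eq_integral => y _.
    rewrite patchE /rect in_setX/= (negbTE xab)/=; over.
  by rewrite integral0.
rewrite [RHS]integral_mkcond; apply: eq_integral => y _ /=.
by rewrite !patchE/= /rect in_setX/= xab.
Qed.

Lemma integral_rect21 a b c d f :
  mu.-integrable (rect a b c d) (EFin \o f) ->
  (\int[mu]_(p in rect a b c d) (f p)%:E =
   \int[leb]_(y in `[c, d]) \int[leb]_(x in `[a, b]) (f (x, y))%:E)%E.
Proof.
move=> intf; rewrite integral_mkcond/=.
have intf' : mu.-integrable setT ((EFin \o f) \_ (rect a b c d)).
  by apply/(integrable_mkcond _ (measurable_rect a b c d)).
rewrite -[LHS](@integral21_prod_meas1 _ _ _ _ R leb leb _ intf').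
rewrite [RHS]integral_mkcond; apply: eq_integral => y _ /=.
rewrite /fubini_G/= patchE; case: ifPn => [|] ycd; last first.
  under eq_integral => x _.
    rewrite patchE /rect in_setX/= (negbTE ycd)/= andbF; over.
  by rewrite integral0.
rewrite [RHS]integral_mkcond; apply: eq_integral => x _ /=.
by rewrite !patchE/= /rect in_setX/= ycd andbT.
Qed.

Lemma continuous_slice1 f (x y : R) : {for (x, y), continuous f} ->
  {for x, continuous (fun t => f (t, y))}.
Proof.
move=> cf; apply: (@continuous_comp _ _ _ (fun t => (t, y)) f) => //.
rewrite /continuous_at; apply: (@cvg_pair _ _ _ (nbhs x) (nbhs x) (nbhs y)).
  exact: cvg_id.
exact: cvg_cst.
Qed.

Lemma continuous_slice2 f (x y : R) : {for (x, y), continuous f} ->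
  {for y, continuous (fun t => f (x, t))}.
Proof.
move=> cf; apply: (@continuous_comp _ _ _ (fun t => (x, t)) f) => //.
rewrite /continuous_at; apply: (@cvg_pair _ _ _ (nbhs y) (nbhs x) (nbhs y)).
  exact: cvg_cst.
exact: cvg_id.
Qed.

Lemma integral_is_derive (F f : R -> R) a b : a < b ->
  (forall x, a <= x <= b -> is_derive x 1 F (f x)) ->
  (forall x, a <= x <= b -> {for x, continuous f}) ->
  (\int[leb]_(x in `[a, b]) (f x)%:E = (F b)%:E - (F a)%:E)%E.
Proof.
move=> ab dF cf.
have cF x : a <= x <= b -> {for x, continuous F}.
  move=> /dF dx; apply/differentiable_continuous/derivable1_diffP.
  exact: ex_derive.
apply: continuous_FTC2 => //.
- apply: continuous_in_subspaceT => x; rewrite inE/= in_itv/= => h.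
  exact: cf.
- split.
  + move=> x; rewrite in_itv/= => /andP[ax xb].
    by have /dF h : a <= x <= b by rewrite !ltW//.
  + by apply: cvg_at_right_filter; apply: cF; rewrite lexx ltW.
  + by apply: cvg_at_left_filter; apply: cF; rewrite lexx ltW.
- move=> x; rewrite in_itv/= => /andP[ax xb].
  have /dF h : a <= x <= b by rewrite !ltW//.
  by rewrite derive1E derive_val.
Qed.

Lemma Rintegral_partial1_eq0 D F f a b c d : a < b ->
  open D -> rect a b c d `<=` D ->
  (forall p, D p -> is_derive p.1 1 (fun t => F (t, p.2)) (f p)) ->
  (forall p, D p -> {for p, continuous f}) ->
  (forall y, F (a, y) = 0) -> (forall y, F (b, y) = 0) ->
  \int[mu]_(p in rect a b c d) f p = 0.
Proof.
move=> ab oD rD dF cf Fa Fb.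
rewrite /Rintegral integral_rect21; last exact: continuous_rect_integrable cf.
rewrite (eq_integral (fun=> 0%E)) ?integral0// => y; rewrite inE/= in_itv/= => ycd.
have H x : a <= x <= b -> D (x, y) by move=> h; apply: rD; exact/rectE.
have dFf x (h : a <= x <= b) := dF (x, y) (H _ h).
have := @integral_is_derive (fun x => F (x, y)) _ _ _ ab dFf.
by rewrite Fa Fb subee//; apply=> x /H/cf; exact: continuous_slice1.
Qed.

Lemma Rintegral_partial2_eq0 D F f a b c d : c < d ->
  open D -> rect a b c d `<=` D ->
  (forall p, D p -> is_derive p.2 1 (fun t => F (p.1, t)) (f p)) ->
  (forall p, D p -> {for p, continuous f}) ->
  (forall x, F (x, c) = 0) -> (forall x, F (x, d) = 0) ->
  \int[mu]_(p in rect a b c d) f p = 0.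
Proof.
move=> cd oD rD dF cf Fc Fd.
rewrite /Rintegral integral_rect12; last exact: continuous_rect_integrable cf.
rewrite (eq_integral (fun=> 0%E)) ?integral0// => x; rewrite inE/= in_itv/= => xab.
have H y : c <= y <= d -> D (x, y) by move=> h; apply: rD; exact/rectE.
have dFf y (h : c <= y <= d) := dF (x, y) (H _ h).
have := @integral_is_derive (fun y => F (x, y)) _ _ _ cd dFf.
by rewrite Fc Fd subee//; apply=> y /H/cf; exact: continuous_slice2.
Qed.

End Rectangle.

(** * Calculus rules for derivatives and continuity of functions given by formulas *)

Section PointwiseDerivatives.
Variable R : realType.
Implicit Types (f g : R -> R) (x df dg : R).

Lemma is_deriveD_fct f g x df dg : is_derive x 1 f df -> is_derive x 1 g dg ->
  is_derive x 1 (fun t => f t + g t) (df + dg).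
Proof. by move=> hf hg; exact: is_deriveD. Qed.

Lemma is_deriveB_fct f g x df dg : is_derive x 1 f df -> is_derive x 1 g dg ->
  is_derive x 1 (fun t => f t - g t) (df - dg).
Proof. by move=> hf hg; exact: is_deriveB. Qed.

Lemma is_deriveM_fct f g x df dg : is_derive x 1 f df -> is_derive x 1 g dg ->
  is_derive x 1 (fun t => f t * g t) (df * g x + f x * dg).
Proof.
move=> hf hg; have := is_deriveM hf hg => /is_derive_eq; apply.
by rewrite /GRing.scale/=; ring.
Qed.

Lemma is_deriveZ_fct (k : R) f x df : is_derive x 1 f df ->
  is_derive x 1 (fun t => k * f t) (k * df).
Proof. by move=> hf; have := is_deriveZ k hf. Qed.

Lemma is_derive_expR_fct f x df : is_derive x 1 f df ->
  is_derive x 1 (fun t => expR (f t)) (expR (f x) * df).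
Proof.
move=> hf; have := @is_derive1_comp R expR f x _ _ (is_derive_expR (f x)) hf.
by [].
Qed.

Lemma is_derive_ln_fct f x df : 0 < f x -> is_derive x 1 f df ->
  is_derive x 1 (fun t => ln (f t)) (df / f x).
Proof.
move=> fx0 hf; have := @is_derive1_comp R (@ln R) f x _ _ (is_derive1_ln fx0) hf.
by rewrite mulrC.
Qed.

Lemma is_deriveV_fct f x df : f x != 0 -> is_derive x 1 f df ->
  is_derive x 1 (fun t => (f t)^-1) (- df / f x ^+ 2).
Proof.
move=> fx0 hf; have /is_derive_eq := is_deriveV fx0 hf; apply.
by rewrite /GRing.scale/= -exprVn; ring.
Qed.

End PointwiseDerivatives.

Section ContinuousOn.
Variable R : realType.
Local Notation mu := (lebesgue_plane R).
Implicit Types (f g : R * R -> R) (D : set (R * R)).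

Definition is_partial1 D f g := forall p, D p ->
  is_derive p.1 1 (fun t => f (t, p.2)) (g p).
Definition is_partial2 D f g := forall p, D p ->
  is_derive p.2 1 (fun t => f (p.1, t)) (g p).
Definition continuous_onX D f := forall p, D p -> {for p, continuous f}.

Lemma continuous_onXD D f g : continuous_onX D f -> continuous_onX D g ->
  continuous_onX D (fun p => f p + g p).
Proof. by move=> cf cg p Dp; apply: cvgD; [exact: cf|exact: cg]. Qed.

Lemma continuous_onXB D f g : continuous_onX D f -> continuous_onX D g ->
  continuous_onX D (fun p => f p - g p).
Proof. by move=> cf cg p Dp; apply: cvgB; [exact: cf|exact: cg]. Qed.

Lemma continuous_onXM D f g : continuous_onX D f -> continuous_onX D g ->
  continuous_onX D (fun p => f p * g p).
Proof. by move=> cf cg p Dp; apply: cvgM; [exact: cf|exact: cg]. Qed.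

Lemma continuous_onXc D (k : R) : continuous_onX D (fun=> k).
Proof. by move=> p Dp; exact: cvg_cst. Qed.

Lemma continuous_onXX D f n : continuous_onX D f ->
  continuous_onX D (fun p => f p ^+ n).
Proof.
move=> cf; elim: n => [|n ih]; first exact: continuous_onXc.
rewrite (_ : (fun p => _) = (fun p => f p * f p ^+ n)).
  exact: continuous_onXM.
by apply/funext => p; rewrite exprS.
Qed.

Lemma continuous_onX_expR D f : continuous_onX D f ->
  continuous_onX D (fun p => expR (f p)).
Proof.
move=> cf p Dp; apply: (@continuous_comp _ _ _ f expR); first exact: cf.
exact: continuous_expR.
Qed.

End ContinuousOn.

Ltac prove_continuous_onX := repeat (lazymatch goal with
  | |- continuous_onX _ (fun=> ?k) => exact: continuous_onXc
  | |- continuous_onX _ (fun x => _ - _) => apply: continuous_onXB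
  | |- continuous_onX _ (fun x => _ + _) => apply: continuous_onXD
  | |- continuous_onX _ (fun x => _ * _) => apply: continuous_onXM
  | |- continuous_onX _ (fun x => _ ^+ _) => apply: continuous_onXX
  | |- continuous_onX _ (fun x => expR _) => apply: continuous_onX_expR
  | |- _ => assumption end).

(** * The weighted inequality for [dbar], by integration by parts *)

Section WeightedIdentity.
Variable R : realType.
Local Notation mu := (lebesgue_plane R).
Variables (D : set (R * R)) (l r b t : R).
Hypotheses (lr : l < r) (bt : b < t) (oD : open D) (rD : rect l r b t `<=` D).

Variables u u1 u2 u12 v v1 v2 v12 P P1 P2 P11 P22 X X1 X2 : R * R -> R.
Hypotheses (du1 : is_partial1 D u u1) (du2 : is_partial2 D u u2)
  (du12 : is_partial2 D u1 u12) (du21 : is_partial1 D u2 u12)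
  (dv1 : is_partial1 D v v1) (dv2 : is_partial2 D v v2)
  (dv12 : is_partial2 D v1 v12) (dv21 : is_partial1 D v2 v12)
  (dP1 : is_partial1 D P P1) (dP2 : is_partial2 D P P2)
  (dP11 : is_partial1 D P1 P11) (dP22 : is_partial2 D P2 P22)
  (dX1 : is_partial1 D X X1) (dX2 : is_partial2 D X X2).
Hypotheses (cu : continuous_onX D u) (cu1 : continuous_onX D u1)
  (cu2 : continuous_onX D u2) (cu12 : continuous_onX D u12)
  (cv : continuous_onX D v) (cv1 : continuous_onX D v1)
  (cv2 : continuous_onX D v2) (cv12 : continuous_onX D v12)
  (cP : continuous_onX D P) (cP1 : continuous_onX D P1)
  (cP2 : continuous_onX D P2) (cP11 : continuous_onX D P11)
  (cP22 : continuous_onX D P22) (cX : continuous_onX D X)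
  (cX1 : continuous_onX D X1) (cX2 : continuous_onX D X2).
Hypotheses (Xl : forall y, X (l, y) = 0) (Xr : forall y, X (r, y) = 0)
  (Xb : forall x, X (x, b) = 0) (Xt : forall x, X (x, t) = 0).

Let E p := expR (P p).
(** No derivative of [X] occurs here: in the imaginary part of [conj q dq], with [q = X (u + i v)],
    the derivatives of the real factor [X] cancel and only [X^2] is left in front. *)
Let S1 p := v p * u2 p - u p * v2 p - 2^-1 * (P1 p * (u p * u p + v p * v p)).
Let S2 p := u p * v1 p - v p * u1 p - 2^-1 * (P2 p * (u p * u p + v p * v p)).
Let F1 p := E p * (X p * X p * S1 p).
Let F2 p := E p * (X p * X p * S2 p).
Let dF1 p := E p * P1 p * (X p * X p * S1 p) +
  E p * ((X1 p * X p + X p * X1 p) * S1 p + X p * X p *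
    (v1 p * u2 p + v p * u12 p - (u1 p * v2 p + u p * v12 p) -
     2^-1 * (P11 p * (u p * u p + v p * v p) +
       P1 p * (u1 p * u p + u p * u1 p + (v1 p * v p + v p * v1 p))))).
Let dF2 p := E p * P2 p * (X p * X p * S2 p) +
  E p * ((X2 p * X p + X p * X2 p) * S2 p + X p * X p *
    (u2 p * v1 p + u p * v12 p - (v2 p * u1 p + v p * u12 p) -
     2^-1 * (P22 p * (u p * u p + v p * v p) +
       P2 p * (u2 p * u p + u p * u2 p + (v2 p * v p + v p * v2 p))))).

Let is_partial_F1 : is_partial1 D F1 dF1.
Proof.
move=> [x y] Dp; have [h1 h2 h3 h4] := And4 (du1 Dp) (dv1 Dp) (du21 Dp) (dv21 Dp).
have [g1 g2 g3] := And3 (dP1 Dp) (dP11 Dp) (dX1 Dp).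
apply: is_deriveM_fct; first exact: is_derive_expR_fct.
apply: is_deriveM_fct; first exact: is_deriveM_fct.
apply: is_deriveB_fct.
  by apply: is_deriveB_fct; exact: is_deriveM_fct.
apply: is_deriveZ_fct; apply: is_deriveM_fct => //.
by apply: is_deriveD_fct; exact: is_deriveM_fct.
Qed.

Let is_partial_F2 : is_partial2 D F2 dF2.
Proof.
move=> [x y] Dp; have [h1 h2 h3 h4] := And4 (du2 Dp) (dv2 Dp) (du12 Dp) (dv12 Dp).
have [g1 g2 g3] := And3 (dP2 Dp) (dP22 Dp) (dX2 Dp).
apply: is_deriveM_fct; first exact: is_derive_expR_fct.
apply: is_deriveM_fct; first exact: is_deriveM_fct.
apply: is_deriveB_fct.
  by apply: is_deriveB_fct; exact: is_deriveM_fct.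
apply: is_deriveZ_fct; apply: is_deriveM_fct => //.
by apply: is_deriveD_fct; exact: is_deriveM_fct.
Qed.

(* With [q = X (u + i v)], the vector field [(F1, F2) / 2] is the real form of
   [conj q e^P dbar q] and [conj q e^P (d q + P_z q)], whose divergence is
   [e^P (|dbar q|^2 - |d q + P_z q|^2 - Laplace P / 4 |q|^2)]. *)
Lemma weighted_dbar_inequality :
  \int[mu]_(p in rect l r b t)
     (expR (P p) * ((P11 p + P22 p) * (X p ^+ 2 * (u p ^+ 2 + v p ^+ 2)))) <=
  \int[mu]_(p in rect l r b t)
     (expR (P p) * ((X1 p * u p + X p * u1 p - (X2 p * v p + X p * v2 p)) ^+ 2 +
                    (X2 p * u p + X p * u2 p + (X1 p * v p + X p * v1 p)) ^+ 2)).
Proof.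
have cE : continuous_onX D E by exact: continuous_onX_expR.
have cF1 : continuous_onX D dF1 by rewrite /dF1 /S1; prove_continuous_onX.
have cF2 : continuous_onX D dF2 by rewrite /dF2 /S2; prove_continuous_onX.
have intF1 : \int[mu]_(p in rect l r b t) dF1 p = 0.
  apply: (@Rintegral_partial1_eq0 R D F1) => // y; rewrite /F1.
    by rewrite Xl !(mul0r, mulr0).
  by rewrite Xr !(mul0r, mulr0).
have intF2 : \int[mu]_(p in rect l r b t) dF2 p = 0.
  apply: (@Rintegral_partial2_eq0 R D F2) => // x; rewrite /F2.
    by rewrite Xb !(mul0r, mulr0).
  by rewrite Xt !(mul0r, mulr0).
have mr := measurable_rect l r b t.
pose A p := expR (P p) * ((P11 p + P22 p) * (X p ^+ 2 * (u p ^+ 2 + v p ^+ 2))).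
have cA : continuous_onX D A.
  by rewrite /A; prove_continuous_onX.
have int f : continuous_onX D f ->
    mu.-integrable (rect l r b t) (EFin \o f).
  by move=> cf; exact: continuous_rect_integrable cf.
(* The divergence integrates to [0], so adding twice its two terms is free and reduces the claim to
   a pointwise inequality. *)
have -> : \int[mu]_(p in rect l r b t) A p =
    \int[mu]_(p in rect l r b t) (A p + (2 * dF1 p + 2 * dF2 p)).
  rewrite RintegralD//; [|exact: int|by apply: int; prove_continuous_onX].
  rewrite RintegralD//; [|by apply: int; prove_continuous_onX|by apply: int; prove_continuous_onX].
  by rewrite !RintegralZl ?int// intF1 intF2 !mulr0 !addr0.
apply: le_Rintegral => //; [by apply: int; prove_continuous_onX|by apply: int; prove_continuous_onX|].
move=> p _; rewrite -subr_ge0.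
(* The difference of the integrands is [e^P |2 (d q + P_z q)|^2], written out in real and imaginary
   parts. *)
rewrite [leRHS](_ : _ = E p *
  ((X1 p * u p + X p * u1 p + (X2 p * v p + X p * v2 p) +
      X p * (P1 p * u p + P2 p * v p)) ^+ 2 +
   (X1 p * v p + X p * v1 p - (X2 p * u p + X p * u2 p) +
      X p * (P1 p * v p - P2 p * u p)) ^+ 2)).
  by rewrite mulr_ge0 ?expR_ge0// addr_ge0// sqr_ge0.
by rewrite /A /dF1 /dF2 /S1 /S2 /E; field.
Qed.

End WeightedIdentity.

(** * Smoothed logarithmic potentials of finitely many point masses *)

Section LogPotential.
Variable R : realType.
Implicit Types (p z : R * R) (d : R).

(** With [d > 0] the function [ln den] is [ln |p - z|^2] made smooth at [z]; with [d = 0] the same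
    expression serves as the squared distance in flatness bounds. *)
Definition den z d p : R := (p.1 - z.1) ^+ 2 + (p.2 - z.2) ^+ 2 + d.

Lemma den_gt0 z d p : 0 < d -> 0 < den z d p.
Proof. by move=> d0; rewrite ltr_wpDl// addr_ge0// sqr_ge0. Qed.

Lemma is_derive_sqrB (k e x : R) :
  is_derive x 1 (fun t => (t - k) ^+ 2 + e) (2 * (x - k)).
Proof.
have h : is_derive x 1 (fun t => t - k) (1 - 0) by exact: is_deriveB_fct.
have := is_deriveD_fct (is_deriveM_fct h h) (is_derive_cst e x 1).
by move/is_derive_eq; apply; ring.
Qed.

Lemma is_derive_den1 z d p :
  is_derive p.1 1 (fun t => den z d (t, p.2)) (2 * (p.1 - z.1)).
Proof.
rewrite /den/=; under eq_fun do rewrite -addrA.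
exact: is_derive_sqrB.
Qed.

Lemma is_derive_den2 z d p :
  is_derive p.2 1 (fun t => den z d (p.1, t)) (2 * (p.2 - z.2)).
Proof.
rewrite /den/=; under eq_fun do rewrite [X in X + _]addrC -addrA.
exact: is_derive_sqrB.
Qed.

Lemma is_derive_sum_fct (I : Type) (s : seq I) (f : I -> R -> R) (df : I -> R) (x : R) :
  (forall i, is_derive x 1 (f i) (df i)) ->
  is_derive x 1 (fun t => \sum_(i <- s) f i t) (\sum_(i <- s) df i).
Proof.
move=> hf; elim: s => [|i s ih].
  rewrite big_nil (_ : (fun=> _) = cst 0); first exact: is_derive_cst.
  by apply/funext => t; rewrite big_nil.
rewrite big_cons (_ : (fun=> _) = fun t => f i t + \sum_(j <- s) f j t).
  exact: is_deriveD_fct.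
by apply/funext => t; rewrite big_cons.
Qed.

Lemma continuous_onX_sum (I : Type) (s : seq I) (f : I -> R * R -> R) D :
  (forall i, continuous_onX D (f i)) ->
  continuous_onX D (fun p => \sum_(i <- s) f i p).
Proof.
move=> hf; elim: s => [|i s ih].
  rewrite (_ : (fun=> _) = fun=> 0); first exact: continuous_onXc.
  by apply/funext => t; rewrite big_nil.
rewrite (_ : (fun=> _) = fun t => f i t + \sum_(j <- s) f j t).
  exact: continuous_onXD.
by apply/funext => t; rewrite big_cons.
Qed.

Lemma continuous_onX_fst D : continuous_onX D (@fst R R).
Proof. by move=> p _; exact: cvg_fst. Qed.

Lemma continuous_onX_snd D : continuous_onX D (@snd R R).
Proof. by move=> p _; exact: cvg_snd. Qed.

Lemma continuous_den z d D : continuous_onX D (den z d).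
Proof.
apply: continuous_onXD; last exact: continuous_onXc.
apply: continuous_onXD; apply: continuous_onXX; apply: continuous_onXB.
- exact: continuous_onX_fst.
- exact: continuous_onXc.
- exact: continuous_onX_snd.
- exact: continuous_onXc.
Qed.

Lemma continuous_denV z d D : 0 < d -> continuous_onX D (fun p => (den z d p)^-1).
Proof.
move=> d0 p Dp; apply: cvgV; first by rewrite gt_eqF// den_gt0.
exact: continuous_den Dp.
Qed.

Lemma continuous_ln_den z d D : 0 < d -> continuous_onX D (fun p => ln (den z d p)).
Proof.
move=> d0 p Dp; apply: (@continuous_comp _ _ _ (den z d) (@ln R)).
  exact: continuous_den Dp.
by apply: continuous_ln; rewrite den_gt0.
Qed.

Variables (I : finType) (c : I -> R) (z : I -> R * R) (d : R).
Hypothesis d0 : 0 < d.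

Definition pot p := \sum_i c i * ln (den (z i) d p).
Definition pot1 p := \sum_i c i * (2 * (p.1 - (z i).1) * (den (z i) d p)^-1).
Definition pot2 p := \sum_i c i * (2 * (p.2 - (z i).2) * (den (z i) d p)^-1).
Definition pot11 p := \sum_i c i * (2 * (den (z i) d p)^-1 -
  (2 * (p.1 - (z i).1) * (den (z i) d p)^-1) ^+ 2).
Definition pot22 p := \sum_i c i * (2 * (den (z i) d p)^-1 -
  (2 * (p.2 - (z i).2) * (den (z i) d p)^-1) ^+ 2).

Lemma is_partial1_pot D : is_partial1 D pot pot1.
Proof.
move=> [x y] _; apply: is_derive_sum_fct => i; apply: is_deriveZ_fct.
by apply: is_derive_ln_fct; [rewrite den_gt0|exact: (is_derive_den1 _ _ (x, y))].
Qed.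

Lemma is_partial2_pot D : is_partial2 D pot pot2.
Proof.
move=> [x y] _; apply: is_derive_sum_fct => i; apply: is_deriveZ_fct.
by apply: is_derive_ln_fct; [rewrite den_gt0|exact: (is_derive_den2 _ _ (x, y))].
Qed.

Lemma is_partial1_pot1 D : is_partial1 D pot1 pot11.
Proof.
move=> [x y] _; apply: is_derive_sum_fct => i; apply: is_deriveZ_fct => /=.
have dn0 : den (z i) d (x, y) != 0 by rewrite gt_eqF// den_gt0.
have := @is_deriveV_fct R (fun t => den (z i) d (t, y)) x _ dn0
  (is_derive_den1 (z i) d (x, y)).
have h2 : is_derive x 1 (fun t => 2 * (t - (z i).1)) (2 * (1 - 0)).
  by apply: is_deriveZ_fct; exact: is_deriveB_fct.
move=> /(is_deriveM_fct h2)/= /is_derive_eq; apply.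
by move: dn0; move: (den _ _ _) => e /= e0; field.
Qed.

Lemma is_partial2_pot2 D : is_partial2 D pot2 pot22.
Proof.
move=> [x y] _; apply: is_derive_sum_fct => i; apply: is_deriveZ_fct => /=.
have dn0 : den (z i) d (x, y) != 0 by rewrite gt_eqF// den_gt0.
have := @is_deriveV_fct R (fun t => den (z i) d (x, t)) y _ dn0
  (is_derive_den2 (z i) d (x, y)).
have h2 : is_derive y 1 (fun t => 2 * (t - (z i).2)) (2 * (1 - 0)).
  by apply: is_deriveZ_fct; exact: is_deriveB_fct.
move=> /(is_deriveM_fct h2)/= /is_derive_eq; apply.
by move: dn0; move: (den _ _ _) => e /= e0; field.
Qed.

(** Each [4 d / den^2] is a smoothed point mass: a positive bump of width [sqrt d] whose integral
    over the plane is [4 pi] for every [d]. *)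
Lemma laplace_pot p : pot11 p + pot22 p = \sum_i c i * (4 * d / den (z i) d p ^+ 2).
Proof.
rewrite -big_split/=; apply: eq_bigr => i _; rewrite -mulrDr; congr *%R.
have : den (z i) d p != 0 by rewrite gt_eqF// den_gt0.
by rewrite /den => e0; field.
Qed.

Lemma continuous_pot D : continuous_onX D pot.
Proof.
apply: continuous_onX_sum => i; apply: continuous_onXM.
  exact: continuous_onXc.
exact: continuous_ln_den.
Qed.

Let continuous_den1 D i :
  continuous_onX D (fun p => 2 * (p.1 - (z i).1) * (den (z i) d p)^-1).
Proof.
apply: continuous_onXM; last exact: continuous_denV.
apply: continuous_onXM; first exact: continuous_onXc.
by apply: continuous_onXB; [exact: continuous_onX_fst|exact: continuous_onXc].
Qed.

Let continuous_den2 D i :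
  continuous_onX D (fun p => 2 * (p.2 - (z i).2) * (den (z i) d p)^-1).
Proof.
apply: continuous_onXM; last exact: continuous_denV.
apply: continuous_onXM; first exact: continuous_onXc.
by apply: continuous_onXB; [exact: continuous_onX_snd|exact: continuous_onXc].
Qed.

Lemma continuous_pot1 D : continuous_onX D pot1.
Proof.
apply: continuous_onX_sum => i; apply: continuous_onXM => //.
exact: continuous_onXc.
Qed.

Lemma continuous_pot2 D : continuous_onX D pot2.
Proof.
apply: continuous_onX_sum => i; apply: continuous_onXM => //.
exact: continuous_onXc.
Qed.

Lemma continuous_pot11 D : continuous_onX D pot11.
Proof.
apply: continuous_onX_sum => i; apply: continuous_onXM.
  exact: continuous_onXc.
apply: continuous_onXB; last exact: continuous_onXX.
by apply: continuous_onXM; [exact: continuous_onXc|exact: continuous_denV].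
Qed.

Lemma continuous_pot22 D : continuous_onX D pot22.
Proof.
apply: continuous_onX_sum => i; apply: continuous_onXM.
  exact: continuous_onXc.
apply: continuous_onXB; last exact: continuous_onXX.
by apply: continuous_onXM; [exact: continuous_onXc|exact: continuous_denV].
Qed.

End LogPotential.

(** * Lower bounds for integrals of the smoothed logarithm, uniform in the smoothing *)

Section LogIntegral.
Variable R : realType.
Local Notation mu := (lebesgue_plane R).
Local Notation leb := (@lebesgue_measure R).
Implicit Types (p z : R * R) (d : R).

(** From [ln t >= 1 - 1/t] at [t = |X|] comes [- ln (X^2 + d) <= 2 (1/|X| - 1)], and the factor
    [|X|] removes the singularity whatever [d] is. *)
Lemma normrM_ln_le (X d : R) : 0 < d -> X ^+ 2 + d <= 1 ->
  `|X * ln (X ^+ 2 + d)| <= 2.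
Proof.
move=> d0 h; have X2 := sqr_ge0 X.
have [->|X0] := eqVneq X 0; first by rewrite mul0r normr0.
have aX : 0 < `|X| by rewrite normr_gt0.
rewrite normrM [`|ln _|]ler0_norm; last exact: ln_le0.
have := @le_ln1Dx R (`|X|^-1 - 1); rewrite [1 + _]addrC subrK => H.
have l1 : ln `|X| >= 1 - `|X|^-1.
  rewrite -[`|X| in leRHS]invrK lnV ?posrE ?invr_gt0//.
  have : -1 < `|X|^-1 - 1 by rewrite ltrBrDr addNr invr_gt0.
  by move=> /H; lra.
have l2 : 2 * ln `|X| <= ln (X ^+ 2 + d).
  rewrite -real_normK ?num_real// mulr_natl -lnXn// ler_ln ?posrE ?exprn_gt0//.
    by rewrite lerDl ltW.
  by rewrite ltr_wpDl// sqr_ge0.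
have : `|X| * (- ln (X ^+ 2 + d)) <= `|X| * (2 * (`|X|^-1 - 1)).
  by rewrite ler_pM2l//; lra.
move/le_trans; apply.
rewrite mulrCA mulrBr divff ?gt_eqF//; lra.
Qed.

Lemma integral_ln_ge (a b xi d : R) : a < b -> 0 < d ->
  (forall x, a <= x <= b -> (x - xi) ^+ 2 + d <= 1) ->
  ((- 8%:R)%:E <= \int[leb]_(x in `[a, b]) (ln ((x - xi) ^+ 2 + d))%:E)%E.
Proof.
move=> ab d0 h1.
pose g x := (x - xi) ^+ 2 + d.
have g0 x : 0 < g x by rewrite ltr_wpDl// sqr_ge0.
(* [F] is an antiderivative of [ln g - 2 d / g], which lies below [ln g]. An exact antiderivative of
   [ln g] would involve an arctangent. *)
pose F x := (x - xi) * ln (g x) - 2 * (x - xi).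
pose f x := ln (g x) - 2 * d / g x.
have dg (x : R) : is_derive x 1 g (2 * (x - xi)) by exact: is_derive_sqrB.
have dF (x : R) : is_derive x 1 F (f x).
  have h : is_derive x 1 (fun t => t - xi) (1 - 0) by exact: is_deriveB_fct.
  have h2 := is_derive_ln_fct (g0 x) (dg x).
  have := is_deriveB_fct (is_deriveM_fct h h2) (is_deriveZ_fct 2 h).
  move=> /is_derive_eq; apply.
  have : g x != 0 by rewrite gt_eqF.
  by rewrite /f /g => e0; field.
have cg (x : R) : {for x, continuous g}.
  apply/differentiable_continuous/derivable1_diffP.
  by have := dg x => hx; exact: ex_derive.
have cl (x : R) : {for x, continuous (fun x => ln (g x))}.
  by apply: (@continuous_comp _ _ _ g (@ln R)) => //; exact: continuous_ln.
have cf (x : R) : {for x, continuous f}.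
  apply: cvgB; first exact: cl.
  apply: cvgM; first exact: cvg_cst.
  by apply: cvgV; [rewrite gt_eqF|exact: cg].
have Ff : (\int[leb]_(x in `[a, b]) (f x)%:E = (F b)%:E - (F a)%:E)%E.
  by apply: integral_is_derive.
(* Each of the two terms of [F] is at most [2] in absolute value; the two endpoints together then
   give [8]. *)
have FF x : a <= x <= b -> `|F x| <= 4.
  move=> /h1 gx; have := normrM_ln_le d0 gx => hx.
  have : `|x - xi| <= 1.
    by rewrite -(@ler_pXn2r _ 2) ?nnegrE// expr1n real_normK ?num_real//; lra.
  move: hx; rewrite /F -/(g x) !ler_norml.
  by move: (_ * ln _) => w; lra.
have : (\int[leb]_(x in `[a, b]) (f x)%:E <=
        \int[leb]_(x in `[a, b]) (ln (g x))%:E)%E.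
  have int h : (forall x, {for x, continuous h}) ->
      leb.-integrable `[a, b] (EFin \o h).
    move=> ch; apply: continuous_compact_integrable.
      exact: segment_compact.
    by apply: continuous_in_subspaceT => x _; exact: ch.
  apply: le_integral; [by []|exact: int|exact: int|].
  move=> x _; rewrite lee_fin /f gerBl// divr_ge0// ?mulr_ge0//; exact: ltW.
apply: le_trans; rewrite Ff -EFinB lee_fin.
have /FF : a <= b <= b by rewrite lexx ltW.
have /FF : a <= a <= b by rewrite lexx ltW.
by rewrite !ler_norml; lra.
Qed.

(** Dropping [(p.2 - z.2)^2] only decreases the logarithm and leaves a function of one variable; the
    other side has length at most [1], so the bound [-8] survives. *)
Lemma Rintegral_ln_den_ge (a b c e : R) z d : a < b -> c <= e -> e <= c + 1 -> 0 < d ->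
  (forall p, rect a b c e p -> den z d p <= 1) ->
  - 8 <= \int[mu]_(p in rect a b c e) ln (den z d p).
Proof.
move=> ab ce e1 d0 dle.
pose l (p : R * R) := ln ((p.1 - z.1) ^+ 2 + d).
have pos (p : R * R) : 0 < (p.1 - z.1) ^+ 2 + d by rewrite ltr_wpDl// sqr_ge0.
have led p : (p.1 - z.1) ^+ 2 + d <= den z d p.
  by rewrite /den; have := sqr_ge0 (p.2 - z.2); lra.
have cl : continuous_onX setT l.
  move=> p _; apply: (@continuous_comp _ _ _ (fun p => (p.1 - z.1) ^+ 2 + d) (@ln R)).
    apply: (@continuous_onXD R setT) => //; last exact: continuous_onXc.
    apply: continuous_onXX; apply: continuous_onXB; last exact: continuous_onXc.
    exact: continuous_onX_fst.
  exact: continuous_ln.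
have intl := continuous_rect_integrable openT (@subsetT _ (rect a b c e)) cl.
have int := continuous_rect_integrable openT (@subsetT _ (rect a b c e))
  (@continuous_ln_den _ z d setT d0).
apply: (@le_trans _ _ (\int[mu]_(p in rect a b c e) l p)); last first.
  apply: le_Rintegral => //; first exact: measurable_rect.
  by move=> p _; rewrite ler_ln ?posrE ?den_gt0.
rewrite -lee_fin /Rintegral fineK; last first.
  by apply: integrable_fin_num => //; exact: measurable_rect.
rewrite integral_rect12//.
have := @integral_ln_ge a b z.1 d ab d0.
set J := (\int[leb]_(x in `[a, b]) _)%E => J8.
have -> : (\int[leb]_(x in `[a, b]) \int[leb]_(y in `[c, e]) (l (x, y))%:E =
    (e - c)%:E * J)%E.
  rewrite /J -integralZl//; last first.
    apply: continuous_compact_integrable; first exact: segment_compact.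
    apply: continuous_in_subspaceT => x _.
    exact: (continuous_slice1 (cl (x, c) I)).
  apply: eq_integral => x _.
  rewrite (eq_integral (cst (ln ((x - z.1) ^+ 2 + d))%:E))//.
  rewrite integral_cst//= lebesgue_measure_itv/=.
  rewrite lte_fin; case: ltgtP ce => // [_|->] _; first by rewrite muleC.
  by rewrite mule0 subrr mul0e.
have /J8 {}J8 : forall x, a <= x <= b -> (x - z.1) ^+ 2 + d <= 1.
  by move=> x xab; apply: le_trans (led (x, c)) (dle _ _); apply/rectE; rewrite /= lexx.
apply: le_trans (lee_wpmul2l _ J8); last by rewrite lee_fin subr_ge0.
by rewrite -EFinM lee_fin; lra.
Qed.

End LogIntegral.

(** * Zeros with a nonzero partial derivative form a null set *)

Section RegularZeros.
Variable R : realType.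
Local Notation mu := (lebesgue_plane R).
Local Notation plane := (plane R).
Local Notation leb := (@lebesgue_measure R).
Implicit Types (D : set (R * R)) (f g : R * R -> R).

(** The difference quotient of [g] at [x] is [0] at every other point of [S], but near [x] it is
    close to [dg] and hence nonzero. *)
Lemma regular_zero_isolated (g : R -> R) (x dg : R) (S : set R) :
  is_derive x 1 g dg -> dg != 0 -> S x -> (forall y, S y -> g y = 0) ->
  isolated S x.
Proof.
move=> hg dg0 Sx S0; split; first exact/mem_set.
have gx : (fun h => h^-1 *: ((g \o shift x) (h *: 1) - g x)) @ 0^' --> dg.
  have -> : dg = 'D_1 g x by rewrite derive_val.
  by have : derivable g x 1 by exact: ex_derive.
have [e /= e0 he] := cvgr_neq0 _ gx dg0.
exists (ball x e); first exact: nbhsx_ballx.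
rewrite eqEsubset; split => [y [xy Sy]|y ->]; last by split => //; exact: ballxx.
apply/eqP; apply: contraT => yx; exfalso.
have := he (y - x); rewrite /= sub0r normrN (S0 x Sx) !subr0.
rewrite [_%:A]mulr1 subrK (S0 y Sy) scaler0 eqxx => H.
by apply/notF/H => //; [move: xy; rewrite /ball/= distrC|rewrite subr_eq0].
Qed.

Lemma open_neq0 D f : open D -> continuous_onX D f ->
  open (D `&` [set p | f p != 0]).
Proof.
move=> oD cf; rewrite openE => p [Dp fp].
apply: filterI; first by apply: open_nbhs_nbhs.
exact: (cvgr_neq0 _ (cf p Dp) fp).
Qed.

Lemma measurable_regular_zeros D f f1 : open D ->
  continuous_onX D f -> continuous_onX D f1 ->
  measurable ([set p | [/\ D p, f p = 0 & f1 p != 0]] : set plane).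
Proof.
move=> oD cf cf1.
rewrite (_ : [set p | _] = (D `&` [set p | f1 p != 0]) `\` (D `&` [set p | f p != 0])).
  by apply: measurableD; apply: measurable_openX; exact: open_neq0.
rewrite eqEsubset; split => p /=.
  by move=> [Dp fp f1p]; split => //; rewrite fp eqxx => -[].
move=> [[Dp f1p] h]; split => //; apply/eqP; apply: contraT => fp.
by exfalso; apply: h.
Qed.

Lemma lebesgue_plane_ysection (A : set plane) : measurable A ->
  (forall y, countable (ysection A y)) -> mu A = 0%E.
Proof.
move=> mA cA; have -> : mu A = (\int[mu]_p (\1_A p)%:E)%E by rewrite integral_indic// setIT.
rewrite [LHS](@fubini_tonelli2 _ _ _ _ R leb leb (EFin \o \1_A)); last 2 first.
- by apply/measurable_EFinP; exact: measurable_indic.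
- by move=> p; rewrite lee_fin.
rewrite indic_fubini_tonelli_GE//; under eq_integral => y _.
  by rewrite /= countable_lebesgue_measure0//; over.
by rewrite integral0.
Qed.

Lemma lebesgue_plane_xsection (A : set plane) : measurable A ->
  (forall x, countable (xsection A x)) -> mu A = 0%E.
Proof.
move=> mA cA; have -> : mu A = (\int[mu]_p (\1_A p)%:E)%E by rewrite integral_indic// setIT.
rewrite [LHS](@fubini_tonelli1 _ _ _ _ R leb leb (EFin \o \1_A)); last 2 first.
- by apply/measurable_EFinP; exact: measurable_indic.
- by move=> p; rewrite lee_fin.
rewrite indic_fubini_tonelli_FE//; under eq_integral => y _.
  by rewrite /= countable_lebesgue_measure0//; over.
by rewrite integral0.
Qed.

(** On each horizontal line these zeros are isolated, hence countable, and Tonelli concludes. This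
    is what disposes of the points where the quotient is [0] only by convention. *)
Lemma regular_zeros_null1 D f f1 : open D -> is_partial1 D f f1 ->
  continuous_onX D f -> continuous_onX D f1 ->
  mu [set p | [/\ D p, f p = 0 & f1 p != 0]] = 0%E.
Proof.
move=> oD df cf cf1; apply: lebesgue_plane_ysection.
  exact: measurable_regular_zeros.
move=> y; set S := ysection _ _; apply: sub_countable (countable_isolated S).
apply: subset_card_le => x Sx.
have := Sx; rewrite /S /ysection/= inE/= => -[Dxy fxy f1xy].
apply: (regular_zero_isolated (df (x, y) Dxy)) => // t.
by rewrite /S /ysection/= inE/= => -[].
Qed.

Lemma regular_zeros_null2 D f f2 : open D -> is_partial2 D f f2 ->
  continuous_onX D f -> continuous_onX D f2 ->
  mu [set p | [/\ D p, f p = 0 & f2 p != 0]] = 0%E.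
Proof.
move=> oD df cf cf1; apply: lebesgue_plane_xsection.
  exact: measurable_regular_zeros.
move=> x; set S := xsection _ _; apply: sub_countable (countable_isolated S).
apply: subset_card_le => y Sy.
have := Sy; rewrite /S /xsection/= inE/= => -[Dxy fxy f1xy].
apply: (regular_zero_isolated (df (x, y) Dxy)) => // t.
by rewrite /S /xsection/= inE/= => -[].
Qed.

End RegularZeros.

Lemma sqr_le_norm (R : realDomainType) (x y : R) : `|x| <= y -> x ^+ 2 <= y ^+ 2.
Proof.
move=> xy; rewrite -[x ^+ 2]real_normK ?num_real//.
by rewrite ler_pXn2r ?nnegrE// (le_trans _ xy).
Qed.

(** * The discrete potential on a grid of cells *)

Section Grid.
Variable R : realType.
Local Notation mu := (lebesgue_plane R).
Local Notation plane := (plane R).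
Local Notation leb := (@lebesgue_measure R).
Variables (z0 : R * R) (rho : R) (W : R * R -> R).

Definition square (r : R) := rect (z0.1 - r) (z0.1 + r) (z0.2 - r) (z0.2 + r).

Lemma squareE r p : square r p <-> `|p.1 - z0.1| <= r /\ `|p.2 - z0.2| <= r.
Proof.
rewrite /square rectE !ler_norml; split.
  by move=> [/andP[? ?] /andP[? ?]]; split; apply/andP; split; lra.
by move=> [/andP[? ?] /andP[? ?]]; split; apply/andP; split; lra.
Qed.

Local Notation K := (square rho).
Hypotheses (rho0 : 0 < rho) (rho1 : 12 * rho ^+ 2 <= 1).
Hypotheses (W0 : forall p, K p -> 0 <= W p) (intW : mu.-integrable K (EFin \o W)).

Definition grid_step (n : nat) : R := 2 * rho / n.+1%:R.

Lemma grid_step_gt0 n : 0 < grid_step n.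
Proof. by rewrite divr_gt0 ?mulr_gt0. Qed.

Lemma grid_stepE n : n.+1%:R * grid_step n = 2 * rho.
Proof. by rewrite mulrC divfK ?pnatr_eq0. Qed.

Lemma grid_step_le n : grid_step n <= 2 * rho.
Proof.
by rewrite -(grid_stepE n) ler_peMl ?(ltW (grid_step_gt0 n))// ler1n.
Qed.

Lemma grid_step_lt e : 0 < e -> exists n0, forall n, (n0 <= n)%N -> grid_step n < e.
Proof.
move=> e0; exists (Num.truncn (2 * rho / e)) => n n0n.
rewrite /grid_step ltr_pdivrMr// [e * _]mulrC -ltr_pdivrMr//.
by apply: lt_le_trans (truncnS_gt _) _; rewrite ler_nat ltnS.
Qed.

Definition corner n (ij : 'I_n.+1 * 'I_n.+1) : R * R :=
  (z0.1 - rho + ij.1%:R * grid_step n, z0.2 - rho + ij.2%:R * grid_step n).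

(** Half-open, so that the cells are disjoint. They miss the right and top edges of the square,
    where the cutoff vanishes anyway. *)
Definition cell n (ij : 'I_n.+1 * 'I_n.+1) : set plane :=
  `[(corner ij).1, (corner ij).1 + grid_step n[%classic `*`
  `[(corner ij).2, (corner ij).2 + grid_step n[%classic.

Lemma cellE n (ij : 'I_n.+1 * 'I_n.+1) (p : R * R) : cell ij p <->
  (corner ij).1 <= p.1 < (corner ij).1 + grid_step n /\
  (corner ij).2 <= p.2 < (corner ij).2 + grid_step n.
Proof. by rewrite /cell /setX/= !in_itv/=. Qed.

Lemma measurable_cell n (ij : 'I_n.+1 * 'I_n.+1) : measurable (cell ij).
Proof. by apply: measurableX; exact: measurable_itv. Qed.

Lemma lebesgue_plane_cell n (ij : 'I_n.+1 * 'I_n.+1) :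
  mu (cell ij) = (grid_step n ^+ 2)%:E.
Proof.
have h x : leb `[x, x + grid_step n[ = (grid_step n)%:E.
  rewrite lebesgue_measure_itv/= lte_fin ltrDl grid_step_gt0.
  by rewrite -EFinB addrAC subrr add0r.
have -> : mu (cell ij) = (leb `[(corner ij).1, ((corner ij).1 + grid_step n)%R[ *
    leb `[(corner ij).2, ((corner ij).2 + grid_step n)%R[)%E.
  by apply: product_measure1E; exact: measurable_itv.
by rewrite [in LHS]h [in X in (_ * X)%E]h -EFinM expr2.
Qed.

Let ord_step n (i : 'I_n.+1) :
  0 <= i%:R * grid_step n /\ i%:R * grid_step n + grid_step n <= 2 * rho.
Proof.
split; first by rewrite mulr_ge0// ltW// grid_step_gt0.
have -> : i%:R * grid_step n + grid_step n = i.+1%:R * grid_step n.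
  by rewrite -natr1 mulrDl mul1r.
by rewrite -(grid_stepE n) ler_pM2r ?grid_step_gt0// ler_nat ltn_ord.
Qed.

Lemma cell_sub n (ij : 'I_n.+1 * 'I_n.+1) : cell ij `<=` K.
Proof.
move=> p /cellE[/= /andP[a1 a2] /andP[b1 b2]]; apply/rectE.
have [i1 i2] := ord_step ij.1; have [j1 j2] := ord_step ij.2.
by split; apply/andP; split; lra.
Qed.

Lemma corner_in n (ij : 'I_n.+1 * 'I_n.+1) : K (corner ij).
Proof.
have s0 := grid_step_gt0 n.
by apply: (@cell_sub n ij); apply/cellE; rewrite !lexx !ltrDl s0.
Qed.

Let ord_inj n (x : R) (i j : 'I_n.+1) :
  i%:R * grid_step n <= x < i%:R * grid_step n + grid_step n ->
  j%:R * grid_step n <= x < j%:R * grid_step n + grid_step n -> i = j.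
Proof.
have s0 := grid_step_gt0 n.
have h (k l : 'I_n.+1) : k%:R * grid_step n <= x ->
    x < l%:R * grid_step n + grid_step n -> (k <= l)%N.
  move=> h1 h2; have := le_lt_trans h1 h2.
  rewrite (_ : _ + _ = l.+1%:R * grid_step n); last first.
    by rewrite -natr1 mulrDl mul1r.
  by rewrite ltr_pM2r// ltr_nat ltnS.
move=> /andP[i1 i2] /andP[j1 j2]; apply/val_inj/anti_leq.
by rewrite (h i j)// (h j i).
Qed.

Lemma trivIset_cell n (D : set ('I_n.+1 * 'I_n.+1)) : trivIset D (@cell n).
Proof.
move=> [i j] [k l] _ _ [p [/cellE[/= a b] /cellE[/= c d]]].
congr (_, _); [apply: (@ord_inj n (p.1 - (z0.1 - rho)))|
  apply: (@ord_inj n (p.2 - (z0.2 - rho)))].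
- by move/andP: a => [? ?]; apply/andP; split; lra.
- by move/andP: c => [? ?]; apply/andP; split; lra.
- by move/andP: b => [? ?]; apply/andP; split; lra.
- by move/andP: d => [? ?]; apply/andP; split; lra.
Qed.

Let ord_exists n (x : R) : 0 <= x < 2 * rho ->
  exists i : 'I_n.+1, i%:R * grid_step n <= x < i%:R * grid_step n + grid_step n.
Proof.
move=> /andP[x0 x1]; have s0 := grid_step_gt0 n.
have xs0 : 0 <= x / grid_step n by rewrite divr_ge0// ltW.
have /andP[t1 t2] := truncn_itv xs0.
have tn : (Num.truncn (x / grid_step n) < n.+1)%N.
  by rewrite truncn_lt_nat// ltr_pdivrMr// grid_stepE.
exists (Ordinal tn) => /=; rewrite -ler_pdivlMr// t1/=.
have -> : (Num.truncn (x / grid_step n))%:R * grid_step n + grid_step n =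
    (Num.truncn (x / grid_step n)).+1%:R * grid_step n.
  by rewrite -natr1 mulrDl mul1r.
by rewrite -ltr_pdivrMr.
Qed.

Lemma cell_cover n p : K p -> p.1 < z0.1 + rho -> p.2 < z0.2 + rho ->
  exists ij : 'I_n.+1 * 'I_n.+1, cell ij p.
Proof.
move=> /rectE[/andP[a1 _] /andP[b1 _]] a2 b2.
have /(@ord_exists n)[i /andP[i1 i2]] : 0 <= p.1 - (z0.1 - rho) < 2 * rho.
  by apply/andP; split; lra.
have /(@ord_exists n)[j /andP[j1 j2]] : 0 <= p.2 - (z0.2 - rho) < 2 * rho.
  by apply/andP; split; lra.
by exists (i, j); apply/cellE; split; apply/andP; split => /=; lra.
Qed.

Definition mass n (ij : 'I_n.+1 * 'I_n.+1) : R := \int[mu]_(p in cell ij) W p.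

Lemma mass_ge0 n (ij : 'I_n.+1 * 'I_n.+1) : 0 <= mass ij.
Proof. by apply: Rintegral_ge0 => p /cell_sub; exact: W0. Qed.

Let int_cell n (ij : 'I_n.+1 * 'I_n.+1) : mu.-integrable (cell ij) (EFin \o W).
Proof.
apply: (integrableS _ _ (@cell_sub n ij)) => //.
- exact: measurable_rect.
- exact: measurable_cell.
Qed.

Lemma sum_mass n : \sum_ij (@mass n ij) <= \int[mu]_(p in K) W p.
Proof.
have mK : measurable (K : set plane) by exact: measurable_rect.
have mW : measurable_fun (K : set plane) (EFin \o W) by have /integrableP[] := intW.
set s := index_enum _.
have sK : \big[setU/set0]_(ij <- s) cell ij `<=` K.
  by rewrite big_seq; elim/big_ind: _ => //;
    [move=> A B AK BK p [/AK|/BK]|move=> ij _; exact: cell_sub].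
have mU : measurable (\big[setU/set0]_(ij <- s) @cell n ij).
  by apply: bigsetU_measurable => ij _; exact: measurable_cell.
rewrite -lee_fin /Rintegral fineK ?integrable_fin_num//.
rewrite -sumEFin (eq_bigr (fun ij => \int[mu]_(p in @cell n ij) (W p)%:E)%E).
  rewrite -ge0_integral_bigsetU//=.
  - by apply: ge0_subset_integral => //= p /W0; rewrite lee_fin.
  - by move=> ij; exact: measurable_cell.
  - exact: index_enum_uniq.
  - exact: trivIset_cell.
  - exact: measurable_funS mW.
  - by move=> p /sK /W0; rewrite lee_fin.
by move=> ij _; rewrite /mass /Rintegral fineK// integrable_fin_num//; exact: measurable_cell.
Qed.

(* A discrete logarithmic potential: the mass of [9 W] in each cell sits at the
   corner of the cell, and [ln |z|^2] is regularized at the scale of the grid so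
   that [lapW], the Laplacian of [psi], dominates [2 W] in the limit. *)
Definition psi n p := \sum_(ij : 'I_n.+1 * 'I_n.+1)
  9 * mass ij * ln (den (corner ij) (grid_step n ^+ 2) p).

Definition lapW n p := \sum_(ij : 'I_n.+1 * 'I_n.+1)
  9 * mass ij * (4 * grid_step n ^+ 2 / den (corner ij) (grid_step n ^+ 2) p ^+ 2).

Let sqr_step_gt0 n : 0 < grid_step n ^+ 2.
Proof. by rewrite exprn_gt0// grid_step_gt0. Qed.

(** Each of the three terms of [den] is at most [(2 rho)^2], which explains the condition
    [12 rho^2 <= 1]. It makes every logarithm in [psi] nonpositive, so that [expR psi <= 1]. *)
Lemma den_corner_le1 n (ij : 'I_n.+1 * 'I_n.+1) p : K p ->
  den (corner ij) (grid_step n ^+ 2) p <= 1.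
Proof.
move=> /squareE[p1 p2]; have /squareE[c1 c2] := @corner_in n ij.
have h (x y z r : R) : 0 < r -> `|x - z| <= r -> `|y - z| <= r -> (x - y) ^+ 2 <= 4 * r ^+ 2.
  move=> r0; rewrite !ler_norml => /andP[? ?] /andP[? ?].
  rewrite (_ : 4 * r ^+ 2 = (2 * r) ^+ 2); last by ring.
  by apply: sqr_le_norm; rewrite ler_norml; apply/andP; split; lra.
have h1 := h _ _ _ _ rho0 p1 c1; have h2 := h _ _ _ _ rho0 p2 c2.
have h3 : grid_step n ^+ 2 <= 4 * rho ^+ 2.
  rewrite (_ : 4 * _ = (2 * rho) ^+ 2); last by ring.
  by rewrite ler_pXn2r ?nnegrE ?grid_step_le// ?ltW ?grid_step_gt0// mulr_gt0.
rewrite /den; move: h1 h2 h3 rho1.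
by set a := (_ - _) ^+ 2; set b := (_ - _) ^+ 2; set c := rho ^+ 2; set d := _ ^+ 2; lra.
Qed.

Lemma psi_le0 n p : K p -> psi n p <= 0.
Proof.
move=> Kp; apply: sumr_le0 => ij _; apply: mulr_ge0_le0.
  by rewrite mulr_ge0// mass_ge0.
by apply: ln_le0; exact: den_corner_le1.
Qed.

Lemma lapW_ge0 n p : 0 <= lapW n p.
Proof.
apply: sumr_ge0 => ij _; apply: mulr_ge0; first by rewrite mulr_ge0// mass_ge0.
by apply: divr_ge0; [rewrite mulr_ge0// sqr_ge0|exact: sqr_ge0].
Qed.

(** Both coordinates of [p] are within one step of the corner, so [den] is at most three times the
    squared step; the factor [9] in [psi] compensates the square of this [3]. The other cells
    contribute nonnegative terms. *)
Lemma lapW_ge n (ij : 'I_n.+1 * 'I_n.+1) p : cell ij p ->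
  4 * mass ij / grid_step n ^+ 2 <= lapW n p.
Proof.
move=> /cellE[/andP[a1 a2] /andP[b1 b2]]; rewrite /lapW (bigD1 ij)//=.
set d := grid_step n ^+ 2; set e := den _ _ p; have d0 : 0 < d by exact: sqr_step_gt0.
have s0 := grid_step_gt0 n.
have e0 : 0 < e by exact: den_gt0.
have ed : e <= 3 * d.
  rewrite /e /den -/d.
  have h x y : y <= x < y + grid_step n -> (x - y) ^+ 2 <= d.
    move=> /andP[? ?]; apply: sqr_le_norm; rewrite ler_norml; apply/andP; split; lra.
  have := h p.1 (corner ij).1; have := h p.2 (corner ij).2.
  by rewrite a1 a2 b1 b2 => /(_ isT) h1 /(_ isT) h2; lra.
apply: (@le_trans _ _ (9 * mass ij * (4 * d / e ^+ 2))); last first.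
  rewrite lerDl; apply: sumr_ge0 => kl _; apply: mulr_ge0.
    by rewrite mulr_ge0// mass_ge0.
  by apply: divr_ge0; [rewrite mulr_ge0// sqr_ge0|exact: sqr_ge0].
have -> : 4 * mass ij / d = 9 * mass ij * (4 * d / (3 * d) ^+ 2).
  have : d != 0 by rewrite gt_eqF.
  by move=> dn0; field.
apply: ler_wpM2l; first by rewrite mulr_ge0// mass_ge0.
apply: ler_wpM2l; first by rewrite mulr_ge0// ltW.
by rewrite lef_pV2 ?posrE ?exprn_gt0 ?mulr_gt0// ler_pXn2r ?nnegrE// ltW ?mulr_gt0.
Qed.

(** Once the mesh is small, [W > W p / 2] on the whole cell of [p], so its mass is at least
    [W p / 2] times its area, and the factor [4] of [lapW_ge] leaves [2 W p]. *)
Lemma lapW_eventually p : K p -> p.1 < z0.1 + rho -> p.2 < z0.2 + rho ->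
  0 < W p -> {for p, continuous W} ->
  exists n0, forall n, (n0 <= n)%N -> 2 * W p <= lapW n p.
Proof.
move=> Kp p1 p2 Wp cW.
have : \forall q \near p, W p / 2 < W q.
  by apply: (cvgr_gt _ cW); lra.
move=> /nbhs_ballP[e /= e0 he].
have [n0 hn0] := grid_step_lt e0; exists n0 => n /hn0 sn.
have [ij pij] := cell_cover n Kp p1 p2.
apply: le_trans (lapW_ge pij).
rewrite ler_pdivlMr//.
have : W p / 2 * grid_step n ^+ 2 <= mass ij.
  have -> : W p / 2 * grid_step n ^+ 2 = \int[mu]_(q in cell ij) (W p / 2).
    rewrite Rintegral_cst ?measurable_cell//; last exact: measurable_cell.
    by rewrite lebesgue_plane_cell.
  have mc := measurable_cell ij.
  apply: le_Rintegral => //.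
    apply: (@integrableS _ _ _ mu K) => //; first exact: measurable_rect.
      exact: cell_sub.
    exact: continuous_rect_integrable openT (@subsetT _ _) (@continuous_onXc R setT _).
  move=> q /cellE[/andP[a1 a2] /andP[b1 b2]]; apply/ltW/he.
  move/cellE : pij => [/andP[c1 c2] /andP[d1 d2]].
  by split; rewrite /ball/= ltr_norml; apply/andP; split; lra.
lra.
Qed.

End Grid.

(** * Integrals of bounded measurable functions on a rectangle *)

Section RectIntegral.
Variable R : realType.
Local Notation mu := (lebesgue_plane R).
Local Notation plane := (plane R).
Implicit Types (f g : R * R -> R).
Variables (a b c d : R).
Local Notation K := (rect a b c d).

(** Integrability of the sum is proved together with the formula because the inductive step of
    additivity needs it. *)
Lemma Rintegral_sum_fct (I : Type) (s : seq I) (f : I -> R * R -> R) :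
  (forall i, mu.-integrable K (EFin \o f i)) ->
  \int[mu]_(p in K) (\sum_(i <- s) f i p) = \sum_(i <- s) \int[mu]_(p in K) f i p
  /\ mu.-integrable K (EFin \o (fun p => \sum_(i <- s) f i p)).
Proof.
move=> intf; have mK := measurable_rect a b c d.
elim: s => [|i s [ih1 ih2]].
  rewrite big_nil; split.
    under eq_Rintegral => p _ do rewrite big_nil.
    by rewrite Rintegral_cst// mul0r.
  rewrite (_ : _ \o _ = cst 0%E); first exact: integrable0.
  by apply/funext => p /=; rewrite big_nil.
have E : (fun p => \sum_(j <- i :: s) f j p) = (fun p => f i p + \sum_(j <- s) f j p).
  by apply/funext => p; rewrite big_cons.
rewrite E big_cons -ih1 RintegralD//; split => //.
exact: (integrableD mK (intf i) ih2).
Qed.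

Lemma Rintegral_rect_subset f (S : set plane) : measurable S -> S `<=` K ->
  mu.-integrable K (EFin \o f) -> (forall p, K p -> 0 <= f p) ->
  \int[mu]_(p in S) f p <= \int[mu]_(p in K) f p.
Proof.
move=> mS SK intf f0; have mK := measurable_rect a b c d.
have intS : mu.-integrable S (EFin \o f) by exact: (integrableS mK mS SK intf).
rewrite /Rintegral fine_le ?integrable_fin_num//.
apply: ge0_subset_integral => //.
by have /integrableP[] := intf.
Qed.

(** A class closed under sums and products, for integrands containing the quotient [h / N], which
    may be discontinuous where [N] vanishes. *)
Definition bounded_measurable f := measurable_fun (K : set plane) f /\
  exists M, forall p, K p -> `|f p| <= M.

Lemma bounded_measurable_integrable f : bounded_measurable f ->
  mu.-integrable K (EFin \o f).
Proof. by move=> [mf [M fM]]; exact: bounded_rect_integrable fM. Qed.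

Lemma bounded_measurableD f g : bounded_measurable f -> bounded_measurable g ->
  bounded_measurable (fun p => f p + g p).
Proof.
move=> [mf [M fM]] [mg [L gL]]; split; first exact: measurable_funD.
exists (M + L) => p Kp; apply: le_trans (ler_normD _ _) _.
by apply: lerD; [exact: fM|exact: gL].
Qed.

Lemma bounded_measurableM f g : bounded_measurable f -> bounded_measurable g ->
  bounded_measurable (fun p => f p * g p).
Proof.
move=> [mf [M fM]] [mg [L gL]]; split; first exact: measurable_funM.
exists (M * L) => p Kp; rewrite normrM.
by apply: ler_pM => //; [exact: fM|exact: gL].
Qed.

Lemma bounded_measurable_max0 f : bounded_measurable f ->
  bounded_measurable (fun p => Num.max 0 (f p)).
Proof.
move=> [mf [M fM]]; split; first by apply: measurable_maxr.
exists M => p Kp; have fp := fM _ Kp; have M0 : 0 <= M by exact: le_trans fp.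
rewrite maxEle; case: ifPn => // f0; by rewrite ?normr0.
Qed.

Lemma continuous_bounded_measurable D f : open D -> K `<=` D ->
  continuous_onX D f -> bounded_measurable f.
Proof.
move=> oD KD cf; split; first exact: continuous_rect_measurable oD KD cf.
by have [M _ fM] := continuous_rect_bounded KD cf; exists M.
Qed.

(** Dominated convergence with a constant bound. The pointwise hypothesis, equality with [0] from
    some stage on, is the form in which the Laplacian comes to dominate. *)
Lemma Rintegral_eventually0 (f : nat -> R * R -> R) B :
  (forall n, measurable_fun (K : set plane) (f n)) ->
  (forall n p, K p -> `|f n p| <= B) ->
  (forall p, K p -> exists n0, forall n, (n0 <= n)%N -> f n p = 0) ->
  forall e, 0 < e -> exists n0, forall n, (n0 <= n)%N -> `|\int[mu]_(p in K) f n p| < e.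
Proof.
move=> mf fB f0 e e0; have mK := measurable_rect a b c d.
have mf' n : measurable_fun (K : set plane) (EFin \o f n) by exact/measurable_EFinP.
have cv : {ae mu, forall p, K p -> (fun n => (f n p)%:E) @ \oo --> (cst 0%E p : \bar R)}.
  apply: aeW => p Kp; have [n0 hn] := f0 p Kp; apply: cvg_near_cst.
  by exists n0 => // n /= /hn ->.
have dom : {ae mu, forall p n, K p -> (`|(f n p)%:E| <= (B%:E : \bar R))%E}.
  by apply: aeW => p n Kp; rewrite lee_fin; exact: fB.
have intB : mu.-integrable K (EFin \o cst B).
  by apply: (@bounded_rect_integrable _ _ _ _ _ _ `|B|) => //; exact: measurable_cst.
have [_ _] := @dominated_convergence _ _ _ mu K mK (fun n => EFin \o f n)
  (cst 0%E) (cst B%:E) mf' (@measurable_cst _ _ _ _ _ _) cv intB dom.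
rewrite integral0 => /fine_cvgP[_ /cvgr0Pnorm_lt/(_ _ e0)[n0 _ hn]].
by exists n0 => n /hn.
Qed.

End RectIntegral.

(** * A lower bound for the integral of [expR psi], uniform in the grid *)

Section PsiLowerBound.
Variable R : realType.
Local Notation mu := (lebesgue_plane R).
Variables (z0 : R * R) (rho : R) (W : R * R -> R).
Local Notation K := (square z0 rho).
Hypotheses (rho0 : 0 < rho) (rho1 : 12 * rho ^+ 2 <= 1).
Hypotheses (W0 : forall p, K p -> 0 <= W p) (intW : mu.-integrable K (EFin \o W)).

Lemma continuous_psi n D : continuous_onX D (psi z0 rho W n).
Proof.
apply: continuous_onX_sum => ij; apply: continuous_onXM.
  exact: continuous_onXc.
by apply: continuous_ln_den; rewrite exprn_gt0// grid_step_gt0.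
Qed.

(** Jensen's inequality in tangent-line form: [expR y >= expR (- L) (1 + L + y)], where [- L] bounds
    the mean of [psi] over the rectangle from below. Only the total mass of [W] and the area of the
    rectangle enter [k]. *)
Lemma expR_psi_ge (a b c e : R) : a < b -> c < e -> rect a b c e `<=` K ->
  exists2 k : R, 0 < k &
    forall n, k <= \int[mu]_(p in rect a b c e) expR (psi z0 rho W n p).
Proof.
move=> ab ce SK; set S := rect a b c e.
have mS := measurable_rect a b c e.
set A := (b - a) * (e - c); have A0 : 0 < A by rewrite mulr_gt0// subr_gt0.
(* [72] is the factor [9] of [psi] times the bound [8] for one logarithm. *)
pose B := 72 * \int[mu]_(p in K) W p.
have cc (k : R) : mu.-integrable S (EFin \o cst k).
  exact: (continuous_rect_integrable openT (@subsetT _ _) (@continuous_onXc R setT k)).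
have intS f : continuous_onX setT f -> mu.-integrable S (EFin \o f).
  by move=> cf; exact: (continuous_rect_integrable openT (@subsetT _ _) cf).
have Scst k : \int[mu]_(p in S) k = k * A.
  by rewrite Rintegral_cst// lebesgue_plane_rect ?ltW.
(* [12 rho^2 <= 1] forces [rho <= 1/2], so the square has side at most [1]. *)
have ec1 : e <= c + 1.
  have /rectE[_] : K (a, c) by apply/SK/rectE; rewrite /= !lexx !ltW.
  have /rectE[_] : K (a, e) by apply/SK/rectE; rewrite /= !lexx !ltW.
  move=> /= /andP[_ e1] /andP[c1 _].
  have : rho <= 2^-1.
    rewrite leNgt; apply/negP => r2.
    by have := rho1; nra.
  lra.
have psiB n : - B <= \int[mu]_(p in S) psi z0 rho W n p.
  have s0 : 0 < grid_step rho n ^+ 2 by rewrite exprn_gt0// grid_step_gt0.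
  pose f (ij : 'I_n.+1 * 'I_n.+1) p := 9 * mass z0 rho W ij *
    ln (den (corner z0 rho ij) (grid_step rho n ^+ 2) p).
  have cl ij : continuous_onX setT
      (fun p => ln (den (@corner R z0 rho n ij) (grid_step rho n ^+ 2) p)).
    exact: continuous_ln_den.
  have intf ij : mu.-integrable S (EFin \o f ij).
    by apply: intS; apply: continuous_onXM; [exact: continuous_onXc|exact: cl].
  have [-> _] := Rintegral_sum_fct (index_enum ('I_n.+1 * 'I_n.+1)%type) intf.
  apply: (@le_trans _ _ (\sum_(ij : 'I_n.+1 * 'I_n.+1) (- 72 * mass z0 rho W ij))).
    by rewrite -mulr_sumr /B; have := @sum_mass R z0 rho W rho0 W0 intW n; lra.
  apply: ler_sum => ij _; rewrite /f RintegralZl//; last exact: intS.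
  have := mass_ge0 rho0 W0 ij.
  have : -8 <= \int[mu]_(p in S) ln (den (corner z0 rho ij) (grid_step rho n ^+ 2) p).
    apply: Rintegral_ln_den_ge => //; first exact: ltW.
    by move=> p /SK Kp; exact: den_corner_le1.
  by move: (Rintegral _ _ _) (mass _ _ _ _) => x y h1 h2; nra.
pose L := B / A.
exists (expR (- L) * A); first by rewrite mulr_gt0// expR_gt0.
move=> n; have cpsi := @continuous_psi n setT.
apply: (@le_trans _ _ (\int[mu]_(p in S) (expR (- L) * (1 + L + psi z0 rho W n p)))).
  rewrite RintegralZl//; last first.
    by apply: intS; apply: continuous_onXD => //; exact: continuous_onXc.
  rewrite ler_pM2l ?expR_gt0// RintegralD//; [|exact: cc|exact: intS].
  rewrite Scst; have := psiB n; rewrite /L => h.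
  rewrite mulrDl mul1r divfK ?gt_eqF//; lra.
apply: le_Rintegral => //.
- apply: intS; apply: continuous_onXM; first exact: continuous_onXc.
  by apply: continuous_onXD => //; exact: continuous_onXc.
- by apply: intS; exact: continuous_onX_expR.
- move=> p _; have := expR_ge1Dx (L + psi z0 rho W n p).
  have -> : expR (psi z0 rho W n p) = expR (- L) * expR (L + psi z0 rho W n p).
    by rewrite -expRD addKr.
  by rewrite ler_pM2l ?expR_gt0// addrA.
Qed.

End PsiLowerBound.

(** * The Carleman estimate and unique continuation on a square *)

Section Carleman.
Variable R : realType.
Local Notation mu := (lebesgue_plane R).
Local Notation plane := (plane R).
Variables (D : set (R * R)) (z0 : R * R) (rho : R).
Local Notation K := (square z0 rho).
Hypotheses (rho0 : 0 < rho) (rho1 : 12 * rho ^+ 2 <= 1).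
Hypotheses (oD : open D) (KD : K `<=` D).

Variables u u1 u2 u12 v v1 v2 v12 : R * R -> R.
Hypotheses (du1 : is_partial1 D u u1) (du2 : is_partial2 D u u2)
  (du12 : is_partial2 D u1 u12) (du21 : is_partial1 D u2 u12)
  (dv1 : is_partial1 D v v1) (dv2 : is_partial2 D v v2)
  (dv12 : is_partial2 D v1 v12) (dv21 : is_partial1 D v2 v12).
Hypotheses (cu : continuous_onX D u) (cu1 : continuous_onX D u1)
  (cu2 : continuous_onX D u2) (cu12 : continuous_onX D u12)
  (cv : continuous_onX D v) (cv1 : continuous_onX D v1)
  (cv2 : continuous_onX D v2) (cv12 : continuous_onX D v12).

Let N p := u p ^+ 2 + v p ^+ 2.
Let h p := (u1 p - v2 p) ^+ 2 + (u2 p + v1 p) ^+ 2.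
(** [M] is the extra density absorbing the gradient of the cutoff on the concentric square of half
    the size; [T] bounds [1 / |z - z0|^2] outside that square. *)
Let M : R := 8 / rho ^+ 2.
Let T : R := 4 / rho ^+ 2.
(* [h / N] is [0] where [N] vanishes. *)
Let W p := h p / N p + M.
Let hN p := h p / N p * N p.

Hypothesis intW : mu.-integrable K (EFin \o W).
Hypothesis flatN : forall m, exists C, forall p, K p -> N p <= C * den z0 0 p ^+ m.
Hypothesis flath : forall m, exists C, forall p, K p -> h p <= C * den z0 0 p ^+ m.

(** Vanishing on the boundary of the square is all that the integration by parts asks of the cutoff.
    Unlike that of a bump function, its gradient does not vanish near the centre, whence the summand
    [M] of [W]. *)
Let X p := (rho ^+ 2 - (p.1 - z0.1) ^+ 2) * (rho ^+ 2 - (p.2 - z0.2) ^+ 2).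
Let X1 p := - (2 * (p.1 - z0.1)) * (rho ^+ 2 - (p.2 - z0.2) ^+ 2).
Let X2 p := (rho ^+ 2 - (p.1 - z0.1) ^+ 2) * - (2 * (p.2 - z0.2)).

(* The weight [E n m] is [e^(psi n)] over a regularization of [|z - z0|^(2 m)]. *)
Let index n := (unit + 'I_n.+1 * 'I_n.+1)%type.
Let coef (n m : nat) (i : index n) : R :=
  match i with inl _ => - m%:R | inr ij => 9 * mass z0 rho W ij end.
Let center (n : nat) (i : index n) : R * R :=
  match i with inl _ => z0 | inr ij => corner z0 rho ij end.
Let delta n := grid_step rho n ^+ 2.
Let E n m p := expR (psi z0 rho W n p) / den z0 (delta n) p ^+ m.
Let P n m p := pot (coef m) (@center n) (delta n) p.

Let delta_gt0 n : 0 < delta n.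
Proof. by rewrite exprn_gt0// grid_step_gt0. Qed.

Let den_delta_gt0 n p : 0 < den z0 (delta n) p.
Proof. exact: den_gt0. Qed.

Let N0 p : 0 <= N p. Proof. by rewrite addr_ge0// sqr_ge0. Qed.
Let h0 p : 0 <= h p. Proof. by rewrite addr_ge0// sqr_ge0. Qed.
Let M0 : 0 < M. Proof. by rewrite divr_gt0// exprn_gt0. Qed.
Let T0 : 0 < T. Proof. by rewrite divr_gt0// exprn_gt0. Qed.

Let hN0 p : 0 <= hN p.
Proof. by rewrite mulr_ge0// divr_ge0. Qed.

Let hN_le p : hN p <= h p.
Proof.
by rewrite /hN; have [->|n0] := eqVneq (N p) 0; rewrite ?mulr0 ?divfK.
Qed.

Let W0 p : K p -> 0 <= W p.
Proof. by move=> _; apply: addr_ge0; [exact: divr_ge0|exact: ltW M0]. Qed.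

Let E0 n m p : 0 < E n m p.
Proof. by rewrite divr_gt0 ?expR_gt0// exprn_gt0. Qed.

Let expP n m p : expR (P n m p) = E n m p.
Proof.
rewrite /P /pot big_sumType/= big_const_seq/= /index_enum/=.
rewrite (_ : count _ _ = 1)%N; last first.
  by rewrite -enumT count_predT -cardE card_unit.
rewrite /= addr0 expRD mulrC; congr *%R.
by rewrite mulNr expRN mulrC mulr_natr -lnXn// lnK// posrE exprn_gt0.
Qed.

Let lapP n m p : pot11 (coef m) (@center n) (delta n) p +
    pot22 (coef m) (@center n) (delta n) p =
  lapW z0 rho W n p - m%:R * (4 * delta n / den z0 (delta n) p ^+ 2).
Proof.
rewrite laplace_pot// big_sumType/= big_const_seq/= /index_enum/=.
rewrite (_ : count _ _ = 1)%N; last first.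
  by rewrite -enumT count_predT -cardE card_unit.
by rewrite /= addr0 addrC mulNr.
Qed.

Let coord p : K p -> (p.1 - z0.1) ^+ 2 <= rho ^+ 2 /\ (p.2 - z0.2) ^+ 2 <= rho ^+ 2.
Proof. by move=> /squareE[a b]; split; exact: sqr_le_norm. Qed.

Let rho12 : rho ^+ 2 <= 12^-1.
Proof. by have := rho1; lra. Qed.

Let X0 p : K p -> 0 <= X p <= 1.
Proof.
move=> /coord[a b]; have := rho12; have := sqr_ge0 (p.1 - z0.1).
have := sqr_ge0 (p.2 - z0.2).
rewrite /X; move: a b; move: ((p.1 - _) ^+ 2) ((p.2 - _) ^+ 2) (rho ^+ 2) => x y r.
move=> *; apply/andP; split; nra.
Qed.

Let gradX_le1 p : K p -> X1 p ^+ 2 + X2 p ^+ 2 <= 1.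
Proof.
move=> /coord[a b]; have := rho12; have := sqr_ge0 (p.1 - z0.1).
have := sqr_ge0 (p.2 - z0.2).
have -> : X1 p ^+ 2 = 4 * (p.1 - z0.1) ^+ 2 * (rho ^+ 2 - (p.2 - z0.2) ^+ 2) ^+ 2.
  by rewrite /X1; ring.
have -> : X2 p ^+ 2 = 4 * (p.2 - z0.2) ^+ 2 * (rho ^+ 2 - (p.1 - z0.1) ^+ 2) ^+ 2.
  by rewrite /X2; ring.
move: a b; move: ((p.1 - _) ^+ 2) ((p.2 - _) ^+ 2) (rho ^+ 2) => x y r xr yr y0 x0 r1.
have H s t : 0 <= s <= r -> 0 <= t <= r -> 4 * s * (r - t) ^+ 2 <= 2^-1.
  move=> /andP[s0 sr] /andP[t0 tr].
  have : (r - t) ^+ 2 <= 1 by nra.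
  by have := sqr_ge0 (r - t); nra.
by have := H x y; have := H y x; rewrite x0 y0 xr yr => /(_ isT isT) + /(_ isT isT); lra.
Qed.

(** With [r = rho^2] and [s] either squared coordinate, this comes down to [2 r s <= (r - s)^2] for
    [s <= r / 4]; the two coordinates together use up exactly the [8] of [M]. *)
Let gradX_le p : K p -> (p.1 - z0.1) ^+ 2 <= rho ^+ 2 / 4 ->
  (p.2 - z0.2) ^+ 2 <= rho ^+ 2 / 4 -> 2 * (X1 p ^+ 2 + X2 p ^+ 2) <= M * X p ^+ 2.
Proof.
have -> : X1 p ^+ 2 = 4 * (p.1 - z0.1) ^+ 2 * (rho ^+ 2 - (p.2 - z0.2) ^+ 2) ^+ 2.
  by rewrite /X1; ring.
have -> : X2 p ^+ 2 = 4 * (p.2 - z0.2) ^+ 2 * (rho ^+ 2 - (p.1 - z0.1) ^+ 2) ^+ 2.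
  by rewrite /X2; ring.
rewrite /X /M exprMn => _; have := sqr_ge0 (p.1 - z0.1).
have := sqr_ge0 (p.2 - z0.2); have : 0 < rho ^+ 2 by rewrite exprn_gt0.
move: ((p.1 - _) ^+ 2) ((p.2 - _) ^+ 2) (rho ^+ 2) => x y r r0 y0 x0 xr yr.
have H s : 0 <= s -> s <= r / 4 -> r * s * 2 <= (r - s) ^+ 2 by nra.
rewrite [leRHS]mulrAC ler_pdivlMr//.
have h1 := H x x0 xr; have h2 := H y y0 yr.
have := sqr_ge0 (r - x); have := sqr_ge0 (r - y).
move: h1 h2; move: ((r - x) ^+ 2) ((r - y) ^+ 2) => a b h1 h2 b0 a0.
by nra.
Qed.

Let E_le n m p : K p -> E n m p <= (den z0 (delta n) p ^+ m)^-1.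
Proof.
move=> Kp; apply: ler_piMl; first by rewrite invr_ge0 exprn_ge0// ltW.
by rewrite -[leRHS]expR0 ler_expR psi_le0.
Qed.

Let den_le n p : den z0 0 p <= den z0 (delta n) p.
Proof. by rewrite lerD2l ltW. Qed.

Let den00 p : 0 <= den z0 0 p.
Proof. by rewrite /den addr0 addr_ge0// sqr_ge0. Qed.

(** Flatness of order [m] beats the singular weight: [psi <= 0] gives [E <= 1 / den^m], and
    smoothing only increases [den]. The bound is therefore uniform in [n]. *)
Let E_flat (f : R * R -> R) C n m p : (forall p, 0 <= f p) -> K p ->
  f p <= C * den z0 0 p ^+ m -> E n m p * f p <= `|C|.
Proof.
move=> f0 Kp fC.
apply: (@le_trans _ _ ((den z0 (delta n) p ^+ m)^-1 * (`|C| * den z0 (delta n) p ^+ m))).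
  apply: ler_pM => //; [exact: ltW|exact: E_le|].
  apply: le_trans fC _; apply: (@le_trans _ _ (`|C| * den z0 0 p ^+ m)).
    by rewrite ler_wpM2r ?exprn_ge0// ler_norm.
  apply: ler_wpM2l => //; apply: lerXn2r; rewrite ?nnegrE.
  - exact: den00.
  - exact/ltW/den_delta_gt0.
  - exact: den_le.
by rewrite mulrCA mulVf ?mulr1// gt_eqF// exprn_gt0.
Qed.

Let bm := @bounded_measurable R (z0.1 - rho) (z0.1 + rho) (z0.2 - rho) (z0.2 + rho).

Let bm_cont f : continuous_onX D f -> bm f.
Proof. exact: continuous_bounded_measurable oD KD. Qed.

Let cN : continuous_onX D N.
Proof. by apply: continuous_onXD; exact: continuous_onXX. Qed.

Let ch : continuous_onX D h.
Proof.
by apply: continuous_onXD; apply: continuous_onXX;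
  [exact: continuous_onXB|exact: continuous_onXD].
Qed.

(** On the square, [hN] is [h] times the indicator of the open set where [N] is nonzero. *)
Let bm_hN : bm hN.
Proof.
have [mh [B hB]] := bm_cont ch; split; last first.
  exists B => p Kp; apply: le_trans (hB p Kp).
  by rewrite !ger0_norm// hN_le.
pose O := D `&` [set p | N p != 0].
have mO : measurable (O : set plane) by apply: measurable_openX; exact: open_neq0.
have : measurable_fun (K : set plane) (fun p => h p * \1_O p).
  by apply: measurable_funM => //; exact: measurable_indic.
apply: eq_measurable_fun => p; rewrite inE => Kp.
rewrite /hN indicE; have [Np|Np] := eqVneq (N p) 0.
  rewrite memNset; first by rewrite Np !mulr0.
  by move=> [_ /=]; rewrite Np eqxx.
by rewrite mem_set ?mulr1 ?divfK//; split => //; exact: KD.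
Qed.

Let cden n S : continuous_onX S (fun p => (den z0 (delta n) p)^-1).
Proof. exact: continuous_denV. Qed.

Let cE n m S : continuous_onX S (E n m).
Proof.
apply: continuous_onXM; first by apply: continuous_onX_expR; exact: continuous_psi.
rewrite (_ : (fun p => _) = (fun p => (den z0 (delta n) p)^-1 ^+ m)).
  exact: continuous_onXX.
by apply/funext => p; rewrite exprVn.
Qed.

Let cX S : continuous_onX S X.
Proof.
have c f k : continuous_onX S f -> continuous_onX S (fun p => rho ^+ 2 - (f p - k) ^+ 2).
  move=> cf; apply: continuous_onXB; first exact: continuous_onXc.
  by apply: continuous_onXX; apply: continuous_onXB => //; exact: continuous_onXc.
apply: continuous_onXM; apply: c; [exact: continuous_onX_fst|exact: continuous_onX_snd].
Qed.

Let cX1 S : continuous_onX S X1.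
Proof.
rewrite (_ : X1 = fun p => - 2 * (p.1 - z0.1) * (rho ^+ 2 - (p.2 - z0.2) ^+ 2)).
  apply: continuous_onXM.
    apply: continuous_onXM; first exact: continuous_onXc.
    by apply: continuous_onXB; [exact: continuous_onX_fst|exact: continuous_onXc].
  apply: continuous_onXB; first exact: continuous_onXc.
  apply: continuous_onXX.
  by apply: continuous_onXB; [exact: continuous_onX_snd|exact: continuous_onXc].
by apply/funext => p; rewrite /X1; ring.
Qed.

Let cX2 S : continuous_onX S X2.
Proof.
rewrite (_ : X2 = fun p => - 2 * (p.2 - z0.2) * (rho ^+ 2 - (p.1 - z0.1) ^+ 2)).
  apply: continuous_onXM.
    apply: continuous_onXM; first exact: continuous_onXc.
    by apply: continuous_onXB; [exact: continuous_onX_snd|exact: continuous_onXc].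
  apply: continuous_onXB; first exact: continuous_onXc.
  apply: continuous_onXX.
  by apply: continuous_onXB; [exact: continuous_onX_fst|exact: continuous_onXc].
by apply/funext => p; rewrite /X2; ring.
Qed.

Let dX1 : is_partial1 D X X1.
Proof.
move=> [x y] _; rewrite /X/=.
have H := is_deriveB_fct (is_derive_cst (rho ^+ 2) x (1 : R)) (is_derive_sqrB z0.1 0 x).
have := is_deriveM_fct H (is_derive_cst (rho ^+ 2 - (y - z0.2) ^+ 2) x (1 : R)).
rewrite /cst /=; under eq_fun do rewrite addr0.
by move=> /is_derive_eq; apply; rewrite /X1/= /cst; ring.
Qed.

Let dX2 : is_partial2 D X X2.
Proof.
move=> [x y] _; rewrite /X/=.
have H := is_deriveB_fct (is_derive_cst (rho ^+ 2) y (1 : R)) (is_derive_sqrB z0.2 0 y).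
have := is_deriveM_fct (is_derive_cst (rho ^+ 2 - (x - z0.1) ^+ 2) y (1 : R)) H.
rewrite /cst /=; under eq_fun do rewrite addr0.
by move=> /is_derive_eq; apply; rewrite /X2/= /cst; ring.
Qed.

Let J (f : R * R -> R) := \int[mu]_(p in K) f p.

Let intK f : bm f -> mu.-integrable K (EFin \o f).
Proof. exact: bounded_measurable_integrable. Qed.

Let JD f g : bm f -> bm g -> J (fun p => f p + g p) = J f + J g.
Proof.
move=> bf bg; apply: RintegralD; [exact: measurable_rect|exact: intK|exact: intK].
Qed.

Let JZ k f : bm f -> J (fun p => k * f p) = k * J f.
Proof. by move=> bf; apply: RintegralZl; [exact: measurable_rect|exact: intK]. Qed.

Let Jle f g : bm f -> bm g -> (forall p, K p -> f p <= g p) -> J f <= J g.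
Proof.
move=> bf bg fg; apply: le_Rintegral => //; [exact: measurable_rect|exact: intK|exact: intK].
Qed.

Let bm_c k : bm (fun=> k).
Proof. by apply: bm_cont; exact: continuous_onXc. Qed.

Let bmZ k f : bm f -> bm (fun p => k * f p).
Proof. by move=> bf; exact: bounded_measurableM (bm_c k) bf. Qed.

Let Jc k : 0 <= k -> J (fun=> k) <= k.
Proof.
move=> k0; rewrite /J Rintegral_cst; last exact: measurable_rect.
rewrite lebesgue_plane_rect/=; [|by have := rho0; lra|by have := rho0; lra].
rewrite ler_piMr//; have := rho12; nra.
Qed.

(** At a common zero of [u] and [v] that is a regular zero of neither, all four first partial
    derivatives vanish, hence [h] does. Regular zeros are null, so the convention on the quotient is
    invisible to integrals. *)
Let J_hN f : bm f -> J (fun p => f p * h p) = J (fun p => f p * hN p).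
Proof.
move=> bf; rewrite /J /Rintegral; congr fine.
have mK : measurable (K : set plane) by exact: measurable_rect.
have mf g : bm g -> measurable_fun (K : set plane) (EFin \o g).
  by move=> [mg _]; exact/measurable_EFinP.
apply: ae_eq_integral => //.
- by apply: mf; apply: bounded_measurableM => //; exact: bm_cont.
- by apply: mf; exact: bounded_measurableM.
pose Z (g g' : R * R -> R) := [set p | [/\ D p, g p = 0 & g' p != 0]].
have mZ g g' : continuous_onX D g -> continuous_onX D g' ->
    measurable (Z g g' : set plane).
  by move=> ? ?; exact: measurable_regular_zeros.
exists (((Z u u1 `|` Z u u2) `|` Z v v1) `|` Z v v2); split.
- by apply: measurableU; [apply: measurableU; [apply: measurableU|]|]; exact: mZ.
- rewrite measureU0//; [|by apply: measurableU; [apply: measurableU|]; exact: mZ|exact: mZ|exact: regular_zeros_null2].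
  rewrite measureU0//; [|by apply: measurableU; exact: mZ|exact: mZ|exact: regular_zeros_null1].
  rewrite measureU0//; [exact: regular_zeros_null1|exact: mZ|exact: mZ|exact: regular_zeros_null2].
move=> p /=; apply: contra_notP => nZ Kp; congr (_%:E); congr (_ * _).
rewrite /hN; have [Np|Np] := eqVneq (N p) 0; last by rewrite divfK.
have [up vp] : u p = 0 /\ v p = 0.
  move/eqP : (Np); rewrite /N paddr_eq0 ?sqr_ge0// !sqrf_eq0.
  by move=> /andP[/eqP ? /eqP ?].
have Dp := KD Kp.
have z g g' : g p = 0 -> ~ Z g g' p -> g' p = 0.
  by move=> gp ng; apply/eqP; apply: contraT => g'p; exfalso; apply: ng.
rewrite Np mulr0 /h (z u u1)// ?(z u u2)// ?(z v v1)// ?(z v v2)//.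
- by rewrite !subr0 addr0 expr0n/= addr0.
- by move=> H; apply: nZ; right.
- by move=> H; apply: nZ; left; right.
- by move=> H; apply: nZ; left; left; right.
- by move=> H; apply: nZ; left; left; left.
Qed.

Let Y p := X p ^+ 2 * N p.
(** The deficit [E X^2 N max(0, 2 W - lapW)]: what is lost where the grid is still too coarse for
    [lapW] to dominate [2 W]. *)
Let g n m p := E n m p * X p ^+ 2 *
  Num.max 0 (2 * hN p + 2 * M * N p - lapW z0 rho W n p * N p).

Let Y0 p : 0 <= Y p. Proof. by rewrite mulr_ge0 ?sqr_ge0. Qed.

Let c_lapW n S : continuous_onX S (lapW z0 rho W n).
Proof.
apply: continuous_onX_sum => ij; apply: continuous_onXM.
  exact: continuous_onXc.
rewrite (_ : (fun p => _) = (fun p => 4 * grid_step rho n ^+ 2 *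
    (den (corner z0 rho ij) (grid_step rho n ^+ 2) p)^-1 ^+ 2)).
  apply: continuous_onXM; first exact: continuous_onXc.
  by apply: continuous_onXX; exact: continuous_denV (delta_gt0 n).
by apply/funext => p; rewrite exprVn.
Qed.

Let bm_X2 : bm (fun p => X p ^+ 2).
Proof. by apply: bm_cont; apply: continuous_onXX. Qed.

Let bm_Y : bm Y.
Proof. by apply: bounded_measurableM => //; exact: bm_cont. Qed.

Let bm_g n m : bm (g n m).
Proof.
apply: bounded_measurableM; first by apply: bounded_measurableM => //; exact: bm_cont.
apply: bounded_measurable_max0.
rewrite (_ : (fun p => _) = fun p => 2 * hN p + (2 * M * N p + -1 * (lapW z0 rho W n p * N p))).
  apply: bounded_measurableD; first exact: bmZ.
  by have := @c_lapW n D => cl; apply: bm_cont; prove_continuous_onX.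
by apply/funext => p; rewrite mulN1r addrA.
Qed.

(** This is [|a + b|^2 <= 2 |a|^2 + 2 |b|^2] for the two terms of [2 dbar (X f) = X (2 dbar f) + (2
    dbar X) f]; the difference of the sides is [|a - b|^2]. *)
Let square_sum_le p :
  (X1 p * u p + X p * u1 p - (X2 p * v p + X p * v2 p)) ^+ 2 +
  (X2 p * u p + X p * u2 p + (X1 p * v p + X p * v1 p)) ^+ 2 <=
  2 * (X p ^+ 2 * h p) + 2 * (X1 p ^+ 2 + X2 p ^+ 2) * N p.
Proof.
rewrite -subr_ge0.
rewrite [leRHS](_ : _ = (X p * (u1 p - v2 p) - (X1 p * u p - X2 p * v p)) ^+ 2 +
  (X p * (u2 p + v1 p) - (X2 p * u p + X1 p * v p)) ^+ 2).
  by rewrite addr_ge0// sqr_ge0.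
rewrite /h /N; ring.
Qed.

Let T_E n m p : K p -> rho ^+ 2 / 4 <= den z0 (delta n) p -> E n m p <= T ^+ m.
Proof.
move=> Kp hp; apply: le_trans (E_le n m Kp) _.
have r4 : 0 < rho ^+ 2 / 4 by rewrite divr_gt0// exprn_gt0.
have -> : T = (rho ^+ 2 / 4)^-1 by rewrite invf_div.
rewrite -exprVn; apply: lerXn2r; rewrite ?nnegrE ?invr_ge0; [exact: ltW|exact: ltW|].
by rewrite lef_pV2 ?posrE.
Qed.

(** On the half-size square the gradient is absorbed by [M X^2]; outside it [den >= rho^2 / 4], so
    the weight is at most [T^m]. *)
Let boundary_term n m p C0 : 2 * N p <= C0 -> K p ->
  E n m p * (2 * (X1 p ^+ 2 + X2 p ^+ 2) * N p) <= M * (E n m p * Y p) + C0 * T ^+ m.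
Proof.
move=> NC Kp; have C00 : 0 <= C0 by apply: le_trans NC; rewrite mulr_ge0.
have Tm : 0 < T ^+ m by rewrite exprn_gt0.
have En := ltW (E0 n m p).
have [hp|/negP hp] := boolP (((p.1 - z0.1) ^+ 2 <= rho ^+ 2 / 4) &&
    ((p.2 - z0.2) ^+ 2 <= rho ^+ 2 / 4)).
  move/andP : hp => [p1 p2]; have H := gradX_le Kp p1 p2.
  apply: (@le_trans _ _ (M * (E n m p * Y p))); last first.
    by rewrite lerDl mulr_ge0// ltW.
  rewrite (_ : M * (E n m p * Y p) = E n m p * (M * X p ^+ 2 * N p)); last first.
    by rewrite /Y; ring.
  by apply: ler_wpM2l => //; exact: ler_wpM2r.
have dp : rho ^+ 2 / 4 <= den z0 (delta n) p.
  rewrite /den; have := sqr_ge0 (p.1 - z0.1); have := sqr_ge0 (p.2 - z0.2).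
  have := ltW (delta_gt0 n).
  move/negP : hp; rewrite negb_and -!ltNge.
  move: ((p.1 - _) ^+ 2) ((p.2 - _) ^+ 2) (rho ^+ 2) (delta n) => x y r d.
  by move=> /orP[]; lra.
have TE := T_E m Kp dp.
apply: (@le_trans _ _ (T ^+ m * C0)); last first.
  rewrite [T ^+ m * C0]mulrC lerDr; apply: mulr_ge0; first exact: ltW M0.
  exact: mulr_ge0 (Y0 p).
apply: ler_pM => //; first by rewrite !mulr_ge0// addr_ge0 ?sqr_ge0.
apply: le_trans NC; rewrite -mulrA; apply: ler_wpM2l => //.
by apply: ler_piMl => //; exact: gradX_le1.
Qed.

(** Smoothing makes the Laplacian of [- m ln |z - z0|^2] negative instead of zero off [z0]. Flatness
    to order [m + 2] pays for the two extra powers of [den], and the loss is [O(delta)]. *)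
Let laplace_term n m p C1 : N p <= C1 * den z0 0 p ^+ m.+2 -> K p ->
  E n m p * (m%:R * (4 * delta n / den z0 (delta n) p ^+ 2)) * Y p <=
  4 * m%:R * `|C1| * delta n.
Proof.
move=> NC Kp; have := @E_flat N C1 n m.+2 p N0 Kp NC.
have -> : E n m.+2 p = E n m p / den z0 (delta n) p ^+ 2.
  rewrite /E -mulrA; congr *%R; rewrite -invfM; congr (_^-1).
  by rewrite -exprD addn2.
move=> H.
rewrite (_ : _ * Y p = 4 * m%:R * delta n * (E n m p / den z0 (delta n) p ^+ 2 * N p) * X p ^+ 2); last first.
  by rewrite /Y; ring.
have /andP[Xp0 Xp1] := X0 Kp.
rewrite [leRHS]mulrAC; have d0 := ltW (delta_gt0 n).
apply: (@le_trans _ _ (4 * m%:R * delta n * (E n m p / den z0 (delta n) p ^+ 2 * N p))).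
  apply: ler_piMr; last exact: (exprn_ile1 2 Xp0 Xp1).
  apply: mulr_ge0; first by apply: mulr_ge0 d0; rewrite mulr_ge0.
  by apply: mulr_ge0 => //; apply: divr_ge0; [exact/ltW/E0|exact: sqr_ge0].
by apply: ler_wpM2l => //; apply: mulr_ge0 d0; rewrite mulr_ge0.
Qed.

(** Up to the deficit, [lapW] supplies [2 h / N + 2 M]. The first part cancels the [2 X^2 h] coming
    from [dbar (X f)], which is why no pointwise bound on [h / N] is required. Of [2 M], one half
    absorbs the gradient of the cutoff and the other half is the left-hand side. *)
Lemma carleman_step n m C0 C1 : (forall p, K p -> 2 * N p <= C0) ->
  (forall p, K p -> N p <= C1 * den z0 0 p ^+ m.+2) ->
  M * J (fun p => E n m p * Y p) <= C0 * T ^+ m + J (g n m) + 4 * m%:R * `|C1| * delta n.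
Proof.
move=> NC0 NC1.
have c1 : 0 <= 4 * m%:R * `|C1| * delta n.
  by apply: mulr_ge0 (ltW (delta_gt0 n)); rewrite !mulr_ge0.
have C00 : 0 <= C0 * T ^+ m.
  apply: mulr_ge0; last exact/ltW/exprn_gt0.
  have Kz : K z0 by apply/squareE; rewrite !subrr !normr0 ltW.
  by apply: le_trans (NC0 _ Kz); rewrite mulr_ge0.
have cE' : continuous_onX D (E n m) by [].
have cX' : continuous_onX D X by [].
have cX1' : continuous_onX D X1 by [].
have cX2' : continuous_onX D X2 by [].
have cl : continuous_onX D (lapW z0 rho W n) by [].
have cd2 : continuous_onX D (fun p => m%:R * (4 * delta n / den z0 (delta n) p ^+ 2)).
  rewrite (_ : (fun p => _) = fun p => m%:R * (4 * delta n) * (den z0 (delta n) p)^-1 ^+ 2).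
    by apply: continuous_onXM; [exact: continuous_onXc|exact: continuous_onXX].
  by apply/funext => p; rewrite exprVn mulrA.
pose fL p := E n m p * ((lapW z0 rho W n p -
  m%:R * (4 * delta n / den z0 (delta n) p ^+ 2)) * Y p).
pose fR p := E n m p *
 ((X1 p * u p + X p * u1 p - (X2 p * v p + X p * v2 p)) ^+ 2 +
  (X2 p * u p + X p * u2 p + (X1 p * v p + X p * v1 p)) ^+ 2).
have LR : J fL <= J fR.
  have := @weighted_dbar_inequality R D (z0.1 - rho) (z0.1 + rho) (z0.2 - rho) (z0.2 + rho)
    _ _ oD KD u u1 u2 u12 v v1 v2 v12 (P n m) (pot1 (coef m) (@center n) (delta n))
    (pot2 (coef m) (@center n) (delta n)) (pot11 (coef m) (@center n) (delta n))
    (pot22 (coef m) (@center n) (delta n)) X X1 X2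
    du1 du2 du12 du21 dv1 dv2 dv12 dv21.
  rewrite -/(square z0 rho) -/(J _) -/(J _).
  under eq_fun do rewrite expP lapP.
  under [X in _ <= J X]eq_fun do rewrite expP.
  apply => //.
  - by have := rho0; lra.
  - by have := rho0; lra.
  - exact: is_partial1_pot.
  - exact: is_partial2_pot.
  - exact: is_partial1_pot1.
  - exact: is_partial2_pot2.
  - exact: continuous_pot.
  - exact: continuous_pot1.
  - exact: continuous_pot2.
  - exact: continuous_pot11.
  - exact: continuous_pot22.
  - by move=> y; rewrite /X/=; ring.
  - by move=> y; rewrite /X/=; ring.
  - by move=> y; rewrite /X/=; ring.
  - by move=> y; rewrite /X/=; ring.
have bfL : bm fL.
  apply: bm_cont; apply: continuous_onXM => //; apply: continuous_onXM.
    exact: continuous_onXB.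
  by rewrite /Y; prove_continuous_onX.
have bfR : bm fR by apply: bm_cont; rewrite /fR; prove_continuous_onX.
have bEX : bm (fun p => E n m p * X p ^+ 2).
  by apply: bm_cont; prove_continuous_onX.
have bEY : bm (fun p => E n m p * Y p).
  by apply: bm_cont; rewrite /Y; prove_continuous_onX.
pose I1 := J (fun p => E n m p * X p ^+ 2 * hN p).
pose I2 := J (fun p => E n m p * Y p).
have bI1 : bm (fun p => E n m p * X p ^+ 2 * hN p) by exact: bounded_measurableM.
have h1 : 2 * I1 + 2 * M * I2 <= J fL + (J (g n m) + 4 * m%:R * `|C1| * delta n).
  rewrite /I1 /I2 -!JZ//.
  rewrite -JD; [|exact: bmZ|exact: bmZ].
  apply: (@le_trans _ _ (J (fun p => fL p + (g n m p + 4 * m%:R * `|C1| * delta n)))); last first.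
    rewrite (JD bfL (bounded_measurableD (bm_g n m) (bm_c _))) (JD (bm_g n m) (bm_c _)).
    by rewrite !lerD2l; exact: Jc.
  apply: Jle.
  - exact: (bounded_measurableD (bmZ 2 bI1) (bmZ (2 * M) bEY)).
  - exact: (bounded_measurableD bfL (bounded_measurableD (bm_g n m) (bm_c _))).
  move=> p Kp.
  have H := @laplace_term n m p C1 (NC1 _ Kp) Kp.
  have Hg : E n m p * X p ^+ 2 * (2 * hN p + 2 * M * N p - lapW z0 rho W n p * N p) <= g n m p.
    apply: ler_wpM2l; last by rewrite le_max lexx orbT.
    by rewrite mulr_ge0 ?sqr_ge0// ltW.
  have -> : 4 * m%:R * `|C1| * delta n = (4 * m%:R * `|C1| * delta n -
    E n m p * (m%:R * (4 * delta n / den z0 (delta n) p ^+ 2)) * Y p) +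
    E n m p * (m%:R * (4 * delta n / den z0 (delta n) p ^+ 2)) * Y p by rewrite subrK.
  move: H Hg; rewrite -subr_ge0; move: (_ - _) => c c0.
  rewrite /fL /Y; set w := m%:R * (4 * _ / _).
  move: w (E n m p) (X p) (hN p) (N p) (lapW _ _ _ n p) (g n m p) (M).
  move=> w e x k l t G M'.
  rewrite -subr_ge0 => H2; rewrite -subr_ge0.
  by apply: le_trans (addr_ge0 c0 H2) _; rewrite le_eqVlt; apply/orP; left; apply/eqP; ring.
have h2 : J fR <= 2 * I1 + (M * I2 + C0 * T ^+ m).
  have bIh : bm (fun p => E n m p * X p ^+ 2 * h p).
    by apply: bounded_measurableM => //; exact: bm_cont.
  rewrite /I1 -J_hN// -!JZ//.
  apply: (@le_trans _ _ (J (fun p => 2 * (E n m p * X p ^+ 2 * h p) +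
      (M * (E n m p * Y p) + C0 * T ^+ m)))); last first.
    rewrite (JD (bmZ 2 bIh) (bounded_measurableD (bmZ M bEY) (bm_c _))).
    by rewrite (JD (bmZ M bEY) (bm_c _)) !lerD2l; exact: Jc.
  apply: Jle => //.
    exact: (bounded_measurableD (bmZ 2 bIh) (bounded_measurableD (bmZ M bEY) (bm_c _))).
  move=> p Kp; have H := @boundary_term n m p C0 (NC0 _ Kp) Kp.
  apply: le_trans (_ : _ <= E n m p * (2 * (X p ^+ 2 * h p)) +
    E n m p * (2 * (X1 p ^+ 2 + X2 p ^+ 2) * N p)) _.
    by rewrite -mulrDr ler_pM2l//; exact: square_sum_le.
  rewrite (_ : E n m p * (2 * _) = 2 * (E n m p * X p ^+ 2 * h p)); last by ring.
  by rewrite lerD2l.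
by move: h1 h2 LR; rewrite -/I2; lra.
Qed.

Let g_ge0 n m p : 0 <= g n m p.
Proof.
apply: mulr_ge0; last by rewrite le_max lexx.
by apply: mulr_ge0; [exact/ltW/E0|exact: sqr_ge0].
Qed.

(** On the edges not covered by cells [X] vanishes, and at zeros of [N] the deficit is [0] outright.
    At the remaining points [W] is continuous, and positive thanks to [M], so [lapW_eventually]
    applies. *)
Let g_eventually0 m p : K p -> exists n0, forall n, (n0 <= n)%N -> g n m p = 0.
Proof.
move=> Kp.
have gX : X p = 0 -> exists n0, forall n, (n0 <= n)%N -> g n m p = 0.
  by move=> Xp; exists 0%N => n _; rewrite /g Xp expr0n/= mulr0 mul0r.
have [Np|Np] := eqVneq (N p) 0.
  exists 0%N => n _; rewrite /g /hN Np !mulr0 subr0 addr0.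
  by rewrite maxxx mulr0.
have sq t : t <= rho -> (t < rho) || (t == rho).
  by rewrite le_eqVlt orbC.
have /squareE[] := Kp; rewrite !ler_norml => /andP[_ p1] /andP[_ p2].
have [/eqP e1|e1] := boolP (p.1 - z0.1 == rho).
  by apply: gX; rewrite /X e1 subrr mul0r.
have [/eqP e2|e2] := boolP (p.2 - z0.2 == rho).
  by apply: gX; rewrite /X e2 subrr mulr0.
have lt1 : p.1 < z0.1 + rho by rewrite -ltrBlDl lt_neqAle e1.
have lt2 : p.2 < z0.2 + rho by rewrite -ltrBlDl lt_neqAle e2.
have N1 : 0 < N p by rewrite lt_neqAle eq_sym Np N0.
have Wp : 0 < W p by apply: ltr_wpDl => //; exact: divr_ge0.
have cW : {for p, continuous W}.
  apply: cvgD; last exact: cvg_cst.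
  apply: cvgM; first exact: ch (KD Kp).
  by apply: cvgV => //; exact: cN (KD Kp).
have [n0 hn0] := lapW_eventually rho0 W0 intW Kp lt1 lt2 Wp cW.
exists n0 => n /hn0 lW.
rewrite /g; have -> : Num.max 0 (2 * hN p + 2 * M * N p - lapW z0 rho W n p * N p) = 0.
  apply/max_idPl.
  have -> : 2 * hN p + 2 * M * N p = 2 * W p * N p by rewrite /hN /W; ring.
  by rewrite -mulrBl; apply: mulr_le0_ge0 => //; rewrite subr_le0.
by rewrite mulr0.
Qed.

(** The dominating constant needs both flatness hypotheses; [lapW], being nonnegative, can be
    discarded. *)
Let g_bounded m : exists B, forall n p, K p -> `|g n m p| <= B.
Proof.
have [C1 hC1] := flath m; have [C2 hC2] := flatN m.
exists (2 * `|C1| + 2 * M * `|C2|) => n p Kp.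
rewrite ger0_norm//.
have e1 := E_flat n h0 Kp (hC1 _ Kp); have e2 := E_flat n N0 Kp (hC2 _ Kp).
have /andP[X1' X2'] := X0 Kp.
have XX : X p ^+ 2 <= 1 by exact: exprn_ile1.
have En := E0 n m p.
apply: (@le_trans _ _ (E n m p * (2 * h p + 2 * M * N p))); last first.
  rewrite (_ : _ * (_ + _) = 2 * (E n m p * h p) + 2 * M * (E n m p * N p)); last by ring.
  by apply: lerD; apply: ler_wpM2l => //; apply: mulr_ge0 => //; exact: ltW.
have pos : 0 <= 2 * h p + 2 * M * N p.
  by apply: addr_ge0; apply: mulr_ge0 => //; apply: mulr_ge0 => //; exact: ltW.
apply: ler_pM.
- by rewrite mulr_ge0 ?sqr_ge0//; exact: ltW.
- by rewrite le_max lexx.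
- by apply: ler_piMr => //; exact: ltW.
rewrite ge_max pos/=.
have l0 := lapW_ge0 rho0 W0 n p; have := mulr_ge0 l0 (N0 p).
by have := hN_le p; lra.
Qed.

Let J_g_cvg0 m e : 0 < e -> exists n0, forall n, (n0 <= n)%N -> J (g n m) < e.
Proof.
move=> e0; have [B gB] := g_bounded m.
have [] := @Rintegral_eventually0 _ _ _ _ _ (fun n => g n m) B _ gB (g_eventually0 m) _ e0.
  by move=> n; have [] := bm_g n m.
by move=> n0 hn; exists n0 => n /hn; apply: le_lt_trans; exact: ler_norm.
Qed.

(** If [N p > 0], the weighted integral over a small rectangle around [p] violates [carleman_step].
    The constant [k] is fixed before [m], because [psi] does not involve [m]; then [m] is fixed
    before [n], because the error terms become small only for [n] large depending on [m]. *)
Lemma unique_continuation_square p : `|p.1 - z0.1| < rho / 4 -> `|p.2 - z0.2| < rho / 4 ->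
  u p = 0 /\ v p = 0.
Proof.
move=> p1 p2; suff /eqP : N p = 0.
  by rewrite /N paddr_eq0 ?sqr_ge0// !sqrf_eq0 => /andP[/eqP ? /eqP ?].
apply: contrapT => /eqP Np; have {Np}N1 : 0 < N p by rewrite lt_neqAle eq_sym Np N0.
have KP q : `|q.1 - z0.1| <= rho / 4 -> `|q.2 - z0.2| <= rho / 4 -> K q.
  by move=> q1 q2; apply/squareE; split; [apply: le_trans q1 _|apply: le_trans q2 _]; have := rho0; lra.
have Dp : D p by apply/KD/KP; exact: ltW.
have : \forall q \near p, N p / 2 < N q by apply: (cvgr_gt _ (cN Dp)); lra.
move=> /nbhs_ballP[e /= e0 he].
pose d := Num.min (e / 2) (Num.min (rho / 4 - `|p.1 - z0.1|) (rho / 4 - `|p.2 - z0.2|)).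
have d0 : 0 < d by rewrite !lt_min !subr_gt0 p1 p2 divr_gt0.
have de : d < e by apply: (@le_lt_trans _ _ (e / 2)); [rewrite ge_min lexx|lra].
have d1 : d <= rho / 4 - `|p.1 - z0.1| by rewrite !ge_min lexx orbT.
have d2 : d <= rho / 4 - `|p.2 - z0.2| by rewrite !ge_min lexx !orbT.
pose S := rect (p.1 - d) (p.1 + d) (p.2 - d) (p.2 + d).
have Sq q : S q -> [/\ `|q.1 - p.1| <= d, `|q.2 - p.2| <= d,
    `|q.1 - z0.1| <= rho / 4 & `|q.2 - z0.2| <= rho / 4].
  move=> /rectE[/andP[? ?] /andP[? ?]].
  have a1 : `|q.1 - p.1| <= d by rewrite ler_norml; apply/andP; split; lra.
  have a2 : `|q.2 - p.2| <= d by rewrite ler_norml; apply/andP; split; lra.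
  split => //.
    by apply: le_trans (ler_distD p.1 _ _) _; lra.
  by apply: le_trans (ler_distD p.2 _ _) _; lra.
have SK : S `<=` K by move=> q /Sq[_ _ ? ?]; exact: KP.
have [] := @expR_psi_ge R z0 rho W rho0 rho1 W0 intW (p.1 - d) (p.1 + d) (p.2 - d) (p.2 + d) _ _ SK.
- lra.
- lra.
move=> k k0 hk; rewrite -/S in hk.
have sqle (x : R) : `|x| <= rho / 4 -> x ^+ 2 <= rho ^+ 2 / 16.
  by move=> /sqr_le_norm; rewrite expr_div_n (_ : 4 ^+ 2 = 16 :> R)//; ring.
have SX q : S q -> rho ^+ 2 / 2 <= rho ^+ 2 - (q.1 - z0.1) ^+ 2 /\
    rho ^+ 2 / 2 <= rho ^+ 2 - (q.2 - z0.2) ^+ 2.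
  move=> /Sq[_ _ /sqle q1 /sqle q2]; have := sqr_ge0 rho; split; lra.
have r20 : 0 < rho ^+ 2 by rewrite exprn_gt0.
have SY q : S q -> (rho ^+ 2 / 2) ^+ 4 * (N p / 2) <= Y q.
  move=> Sq'; have [x1 x2] := SX _ Sq'.
  have [q1 q2 _ _] := Sq _ Sq'.
  have Nq : N p / 2 < N q.
    by apply: he; split; rewrite /ball/= distrC; apply: le_lt_trans de.
  rewrite /Y; apply: ler_pM; [|by rewrite divr_ge0// ltW| |exact: ltW].
    by rewrite exprn_ge0// divr_ge0// ltW.
  have -> : (rho ^+ 2 / 2) ^+ 4 = (rho ^+ 2 / 2 * (rho ^+ 2 / 2)) ^+ 2 by ring.
  have h2 : 0 <= rho ^+ 2 / 2 by rewrite divr_ge0// ltW.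
  rewrite /X; apply: lerXn2r; rewrite ?nnegrE.
  - exact: mulr_ge0.
  - by apply: mulr_ge0; [exact: le_trans x1|exact: le_trans x2].
  - exact: ler_pM.
pose y0 := (rho ^+ 2 / 2) ^+ 4 * (N p / 2).
have y00 : 0 < y0 by rewrite mulr_gt0 ?exprn_gt0 ?divr_gt0.
(* An upper bound for [den] on [S]: each coordinate contributes at most [rho^2 / 16], and so does
   [delta n] for [n] large. *)
pose r := 3 * rho ^+ 2 / 16.
have r0 : 0 < r by rewrite divr_gt0// mulr_gt0.
have bmEY n m : bm (fun q => E n m q * Y q).
  by apply: bounded_measurableM => //; apply: bm_cont.
have lowerJ n m : delta n <= rho ^+ 2 / 16 ->
    k * y0 / r ^+ m <= J (fun q => E n m q * Y q).
  move=> dn; have mS := measurable_rect (p.1 - d) (p.1 + d) (p.2 - d) (p.2 + d).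
  apply: (@le_trans _ _ (\int[mu]_(q in S) (E n m q * Y q))); last first.
    apply: Rintegral_rect_subset => //; first exact: intK.
    by move=> q Kq; rewrite mulr_ge0// ltW.
  have cexp : continuous_onX setT (fun q => expR (psi z0 rho W n q)).
    by apply: continuous_onX_expR; exact: continuous_psi.
  apply: (@le_trans _ _ (\int[mu]_(q in S) (y0 / r ^+ m * expR (psi z0 rho W n q)))).
    rewrite RintegralZl//; last first.
      exact: (continuous_rect_integrable openT (@subsetT _ _) cexp).
    rewrite (_ : k * y0 / _ = y0 / r ^+ m * k); last by rewrite -mulrA mulrC.
    by apply: ler_wpM2l => //; rewrite divr_ge0 ?ltW// exprn_gt0.
  apply: le_Rintegral => //.
  - apply: (continuous_rect_integrable openT (@subsetT _ _)).
    by apply: continuous_onXM => //; exact: continuous_onXc.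
  - by apply: (integrableS _ mS SK) (intK (bmEY n m)); exact: measurable_rect.
  move=> q Sq'; have [_ _ /sqle q1 /sqle q2] := Sq _ Sq'.
  have dr : den z0 (delta n) q <= r by rewrite /den /r; lra.
  rewrite (_ : y0 / _ * _ = expR (psi z0 rho W n q) / r ^+ m * y0); last first.
    by rewrite mulrC mulrA mulrAC.
  apply: ler_pM; [by apply: divr_ge0; [exact: expR_ge0|exact/exprn_ge0/ltW]|exact: ltW| |exact: SY].
  rewrite /E ler_pM2l ?expR_gt0// lef_pV2 ?posrE ?exprn_gt0//.
  by apply: lerXn2r => //; rewrite nnegrE ltW.
have [C0 hC0] : exists C0, forall q, K q -> 2 * N q <= C0.
  have [_ [B hB]] := bm_cont cN; exists (2 * B) => q /hB; rewrite ger0_norm//; lra.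
(* The lower bound grows like [(16 / (3 rho^2))^m], as [p] is within [rho / 4] of
   [z0] in both coordinates, the upper one only like [(4 / rho^2)^m]. *)
have [m hm] : exists m, C0 + 2 < M * (k * y0) * (4 / 3) ^+ m.
  pose A := M * (k * y0); have A0 : 0 < A by exact: mulr_gt0 M0 (mulr_gt0 k0 y00).
  pose m := (Num.truncn (3 * `|C0 + 2| / A)).+1; exists m.
  have hm : 3 * `|C0 + 2| / A < m%:R by exact: truncnS_gt.
  have bern (j : nat) : 1 + j%:R / 3 <= (4 / 3) ^+ j :> R.
    elim: j => [|j ih]; first by rewrite mul0r addr0 expr0.
    rewrite exprS -natr1; have : 0 <= j%:R :> R by []; move: ih.
    by move: (_ ^+ j) (j%:R) => x y; lra.
  move: hm; rewrite ltr_pdivrMr// => hm.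
  apply: (@lt_le_trans _ _ (A * (m%:R / 3))); last first.
    by rewrite ler_pM2l//; have := bern m; lra.
  by have := ler_norm (C0 + 2); move: hm; rewrite mulrC; lra.
have [C1 hC1] := flatN m.+2.
have Tm : 0 < T ^+ m by rewrite exprn_gt0.
have [n1 hn1] := J_g_cvg0 m Tm.
have small e' : 0 < e' -> exists n0, forall n, (n0 <= n)%N -> delta n < e'.
  move=> e'0; have s0 : 0 < Num.min 1 e' by rewrite lt_min ltr01.
  have [n0 hn] := @grid_step_lt R rho _ s0; exists n0 => n /hn.
  rewrite lt_min => /andP[g1 g2]; apply: le_lt_trans g2.
  by rewrite /delta expr2 ler_piMl// ltW// grid_step_gt0.
have [n2 hn2] : exists n0, forall n, (n0 <= n)%N -> 4 * m%:R * `|C1| * delta n < T ^+ m.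
  have c0 : 0 <= 4 * m%:R * `|C1| by rewrite !mulr_ge0.
  have [n0 hn] := small (T ^+ m / (4 * m%:R * `|C1| + 1)) (divr_gt0 Tm (ltr_wpDl c0 ltr01)).
  exists n0 => n /hn; rewrite ltr_pdivlMr; last exact: ltr_wpDl.
  apply: le_lt_trans; rewrite mulrC ler_wpM2l ?lerDl//.
  exact: ltW (delta_gt0 n).
have r16 : 0 < rho ^+ 2 / 16 by rewrite divr_gt0.
have [n3 hn3] := small _ r16.
pose n := maxn n1 (maxn n2 n3).
have g1 : J (g n m) < T ^+ m by apply: hn1; rewrite leq_maxl.
have g2 : 4 * m%:R * `|C1| * delta n < T ^+ m.
  by apply: hn2; rewrite (leq_trans (leq_maxl n2 n3))// leq_maxr.
have g3 : delta n <= rho ^+ 2 / 16.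
  by apply/ltW/hn3; rewrite (leq_trans (leq_maxr n2 n3))// leq_maxr.
have := carleman_step n hC0 hC1; have := lowerJ n m g3.
(* [1 / r] is [4 / 3] times [T], the source of the exponential gain. The upper bound is
   [(C0 + 2) T^m], the [2] counting the two error terms. *)
have -> : k * y0 / r ^+ m = k * y0 * (4 / 3) ^+ m * T ^+ m.
  rewrite -[RHS]mulrA; congr (_ * _).
  rewrite -exprMn -exprVn; congr (_ ^+ _); rewrite /r /T.
  have : rho != 0 by rewrite gt_eqF.
  by move=> rn0; field.
move=> lo up.
have : M * (k * y0 * (4 / 3) ^+ m * T ^+ m) <= M * J (fun q => E n m q * Y q).
  by rewrite ler_pM2l.
move: hm; rewrite -(ltr_pM2r Tm) => hm.
move=> lo2.
suff : (C0 + 2) * T ^+ m < (C0 + 2) * T ^+ m by rewrite ltxx.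
apply: lt_le_trans hm _.
rewrite (_ : M * (k * y0) * (4 / 3) ^+ m * T ^+ m = M * (k * y0 * (4 / 3) ^+ m * T ^+ m)).
  by move: lo2 up g1 g2; rewrite mulrDl; lra.
by rewrite !mulrA.
Qed.

End Carleman.

(** * From the complex plane to pairs of real coordinates *)

Section ComplexModulus.
Variable R : realType.
Local Notation C := (Cplane R).
Implicit Types (z w : C).

Lemma sqr_cabs z : cabs z ^+ 2 = complex.Re z ^+ 2 + complex.Im z ^+ 2.
Proof. by case: z => a b; rewrite /cabs/= sqr_sqrtr// addr_ge0 ?sqr_ge0. Qed.

Lemma cabs_ge0 z : 0 <= cabs z.
Proof. by case: z => a b; rewrite /cabs/= sqrtr_ge0. Qed.

Lemma normr_Re_le z : `|complex.Re z| <= cabs z.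
Proof.
rewrite -(@ler_pXn2r _ 2) ?nnegrE ?cabs_ge0// real_normK ?num_real// sqr_cabs.
by rewrite lerDl sqr_ge0.
Qed.

Lemma normr_Im_le z : `|complex.Im z| <= cabs z.
Proof.
rewrite -(@ler_pXn2r _ 2) ?nnegrE ?cabs_ge0// real_normK ?num_real// sqr_cabs.
by rewrite lerDr sqr_ge0.
Qed.

Lemma cabs_le z : cabs z <= `|complex.Re z| + `|complex.Im z|.
Proof.
rewrite -(@ler_pXn2r _ 2) ?nnegrE ?cabs_ge0 ?addr_ge0// sqr_cabs sqrrD.
by rewrite !real_normK ?num_real// lerD2r lerDl mulrn_wge0// mulr_ge0.
Qed.

Lemma cabsM z w : cabs (z * w) = cabs z * cabs w.
Proof. exact: Normc.normcM. Qed.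

Lemma cabs_gt0 z : z != 0 -> 0 < cabs z.
Proof.
move=> z0; rewrite lt_neqAle cabs_ge0 andbT eq_sym; apply: contra z0 => /eqP.
by move=> /Normc.eq0_normc ->.
Qed.

Lemma cabsD z w : cabs (z + w) <= cabs z + cabs w.
Proof. exact: le_normcD. Qed.

Lemma cabsX z n : cabs (z ^+ n) = cabs z ^+ n.
Proof.
elim: n => [|n ih]; first by rewrite !expr0 /cabs Normc.normc1.
by rewrite !exprS cabsM ih.
Qed.

(** The radius of a ball in [C] is itself a complex number; being positive it is real, which lets
    real boxes replace balls. *)
Lemma nbhs_planeP z (A : set C) : nbhs z A <-> exists2 e : R, 0 < e &
  forall w, `|complex.Re w - complex.Re z| < e ->
            `|complex.Im w - complex.Im z| < e -> A w.
Proof.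
have ballE (e : R) w : ball z (e%:C)%C w = (cabs (w - z) < e).
  by rewrite /ball/= distrC -ltcR.
have ReB w : complex.Re (w - z) = complex.Re w - complex.Re z by case: w; case: (z).
have ImB w : complex.Im (w - z) = complex.Im w - complex.Im z by case: w; case: (z).
split=> [/nbhs_ballP[e /= e0 eA]|[e e0 eA]].
  have er : e = ((complex.Re e)%:C)%C by rewrite RRe_real// gtr0_real.
  have r0 : 0 < complex.Re e by move: e0; rewrite {1}er (ltcR 0).
  exists (complex.Re e / 2); first by rewrite divr_gt0.
  move=> w w1 w2; apply: eA; rewrite er ballE; apply: le_lt_trans (cabs_le _) _.
  by rewrite ReB ImB; lra.
apply/nbhs_ballP; exists (e%:C)%C; first by rewrite /= (ltcR 0).
move=> w; rewrite ballE => we; apply: eA.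
  by rewrite -ReB; apply: le_lt_trans (normr_Re_le _) we.
by rewrite -ImB; apply: le_lt_trans (normr_Im_le _) we.
Qed.

End ComplexModulus.

Section PlaneFunctions.
Variable R : realType.
Local Notation C := (Cplane R).
Implicit Types (f : C -> C) (D : set C) (p : R * R).

Local Notation point p := (p.1 +i* p.2 : C)%C.

Definition re f p : R := complex.Re (f (point p)).
Definition im f p : R := complex.Im (f (point p)).
Definition plane_set D : set (R * R) := [set p | D (point p)].

Lemma nbhs_point p (A : set C) : nbhs (point p : C) A -> nbhs p [set q | A (point q)].
Proof.
move=> /nbhs_planeP[e e0 eA]; apply/nbhs_ballP; exists e => // q [q1 q2].
by apply: eA; rewrite /= distrC.
Qed.

Lemma open_plane_set D : open D -> open (plane_set D).
Proof.
rewrite !openE => oD p Dp; exact: (nbhs_point (oD _ Dp)).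
Qed.

(** Bridges two conventions: [real_deriv] differentiates in an increment at [0], partial derivatives
    in the coordinate itself. *)
Let is_derive_shift (F G : R -> R) (x : R) : derivable G 0 1 ->
  (forall t, F t = G (t - x)) -> is_derive x 1 F (derive1 G 0).
Proof.
move=> dG FG; have -> : F = fun t => G (t - x) by exact/funext.
have h : is_derive x 1 (fun t : R => t - x) (1 - 0) by exact: is_deriveB_fct.
have hG : is_derive (x - x) 1 G (derive1 G 0).
  by rewrite subrr derive1E; exact: derivableP.
have /= := @is_derive1_comp R G (fun t => t - x) x _ _ hG h.
by move/is_derive_eq; apply; rewrite subr0 mulr1.
Qed.

Lemma is_partial1_re D f : (forall z, D z -> real_derivable 1 f z) ->
  is_partial1 (plane_set D) (re f) (re (real_deriv 1 f)).
Proof.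
move=> df [x y] Dp; have [d1 _] := df _ Dp.
apply: is_derive_shift d1 _ => t; rewrite /re/=; congr (complex.Re (f _)).
by apply/eqP; rewrite eq_complex/=; apply/andP; split; apply/eqP; ring.
Qed.

Lemma is_partial1_im D f : (forall z, D z -> real_derivable 1 f z) ->
  is_partial1 (plane_set D) (im f) (im (real_deriv 1 f)).
Proof.
move=> df [x y] Dp; have [_ d1] := df _ Dp.
apply: is_derive_shift d1 _ => t; rewrite /im/=; congr (complex.Im (f _)).
by apply/eqP; rewrite eq_complex/=; apply/andP; split; apply/eqP; ring.
Qed.

Lemma is_partial2_re D f : (forall z, D z -> real_derivable 'i%C f z) ->
  is_partial2 (plane_set D) (re f) (re (real_deriv 'i%C f)).
Proof.
move=> df [x y] Dp; have [d1 _] := df _ Dp.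
apply: is_derive_shift d1 _ => t; rewrite /re/=; congr (complex.Re (f _)).
by apply/eqP; rewrite eq_complex/=; apply/andP; split; apply/eqP; ring.
Qed.

Lemma is_partial2_im D f : (forall z, D z -> real_derivable 'i%C f z) ->
  is_partial2 (plane_set D) (im f) (im (real_deriv 'i%C f)).
Proof.
move=> df [x y] Dp; have [_ d1] := df _ Dp.
apply: is_derive_shift d1 _ => t; rewrite /im/=; congr (complex.Im (f _)).
by apply/eqP; rewrite eq_complex/=; apply/andP; split; apply/eqP; ring.
Qed.

Lemma continuous_onX_re D f : (forall z, D z -> {for z, continuous f}) ->
  continuous_onX (plane_set D) (re f).
Proof.
move=> cf p Dp; apply/cvgrPdist_lt => e e0.
have : nbhs (f (point p)) [set w | `|complex.Re (f (point p)) - complex.Re w| < e].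
  by apply/nbhs_planeP; exists e => // w h _ /=; rewrite distrC.
by move=> /(cf _ Dp)/nbhs_point.
Qed.

Lemma continuous_onX_im D f : (forall z, D z -> {for z, continuous f}) ->
  continuous_onX (plane_set D) (im f).
Proof.
move=> cf p Dp; apply/cvgrPdist_lt => e e0.
have : nbhs (f (point p)) [set w | `|complex.Im (f (point p)) - complex.Im w| < e].
  by apply/nbhs_planeP; exists e => // w _ h /=; rewrite distrC.
by move=> /(cf _ Dp)/nbhs_point.
Qed.

Lemma smooth_on1 D f : smooth_on D f -> smooth_on D (real_deriv 1 f).
Proof. by move=> sf k; have [_ []] := sf k.+1. Qed.

Lemma smooth_oni D f : smooth_on D f -> smooth_on D (real_deriv 'i%C f).
Proof. by move=> sf k; have [_ []] := sf k.+1. Qed.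

Lemma smooth_on_continuous D f : smooth_on D f -> forall z, D z -> {for z, continuous f}.
Proof. by move=> sf; have [] := sf 0%N. Qed.

Lemma smooth_on_derivable1 D f : smooth_on D f -> forall z, D z -> real_derivable 1 f z.
Proof. by move=> sf z Dz; have [_ [/(_ z Dz)[]]] := sf 1%N. Qed.

Lemma smooth_on_derivablei D f : smooth_on D f -> forall z, D z -> real_derivable 'i%C f z.
Proof. by move=> sf z Dz; have [_ [/(_ z Dz)[]]] := sf 1%N. Qed.

End PlaneFunctions.

(** * Symmetry of mixed partial derivatives *)

Section MixedPartials.
Variable R : realType.
Implicit Types (S : set (R * R)) (F : R * R -> R).

Lemma mean_value (f df : R -> R) (a b : R) : a <= b ->
  (forall x, a <= x <= b -> is_derive x 1 f (df x)) ->
  exists2 c, a <= c <= b & f b - f a = df c * (b - a).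
Proof.
move=> ab dfx; have [||c] := @MVT_segment R f df a b ab.
- by move=> x; rewrite in_itv/= => /andP[x1 x2]; apply: dfx; rewrite !ltW.
- apply: continuous_in_subspaceT => x; rewrite inE/= in_itv/= => h.
  apply/differentiable_continuous/derivable1_diffP.
  by have := dfx _ h => ?; exact: ex_derive.
- by rewrite in_itv/= => h e; exists c.
Qed.

(** The mean value theorem is applied twice: in [x] to a vertical difference of [F], then in [y] to
    [F1]. *)
Let difference12 S F F1 F12 (x y h : R) : 0 < h -> rect x (x + h) y (y + h) `<=` S ->
  is_partial1 S F F1 -> is_partial2 S F1 F12 ->
  exists2 q, rect x (x + h) y (y + h) q &
    F (x + h, y + h) - F (x + h, y) - (F (x, y + h) - F (x, y)) = F12 q * h * h.
Proof.
move=> h0 hS dF1 dF12.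
have Sr a b : x <= a <= x + h -> y <= b <= y + h -> S (a, b).
  by move=> ha hb; apply: hS; exact/rectE.
have yy : y <= y <= y + h by rewrite lexx lerDl ltW.
have yh : y <= y + h <= y + h by rewrite lexx lerDl ltW.
have xh : x <= x + h by rewrite lerDl ltW.
have [c hc] := @mean_value (fun t => F (t, y + h) - F (t, y))
  (fun t => F1 (t, y + h) - F1 (t, y)) x (x + h) xh
  (fun t ht => is_deriveB_fct (dF1 (t, y + h) (Sr _ _ ht yh)) (dF1 (t, y) (Sr _ _ ht yy))).
have [d hd] := @mean_value (fun s => F1 (c, s)) (fun s => F12 (c, s)) y (y + h)
  ltac:(by rewrite lerDl ltW) (fun s hs => dF12 (c, s) (Sr _ _ hc hs)).
rewrite !(addrAC _ h) !subrr !add0r => e1 ->; rewrite e1.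
by exists (c, d) => //; exact/rectE.
Qed.

(** The second difference is unchanged when the coordinates are exchanged, which reduces this to
    [difference12]. *)
Let difference21 S F F2 F21 (x y h : R) : 0 < h -> rect x (x + h) y (y + h) `<=` S ->
  is_partial2 S F F2 -> is_partial1 S F2 F21 ->
  exists2 q, rect x (x + h) y (y + h) q &
    F (x + h, y + h) - F (x + h, y) - (F (x, y + h) - F (x, y)) = F21 q * h * h.
Proof.
move=> h0 hS dF2 dF21; pose tr (G : R * R -> R) q := G (q.2, q.1).
have [|||q /rectE[q1 q2]] := @difference12 [set q | S (q.2, q.1)] (tr F) (tr F2) (tr F21) y x h h0.
- by move=> q /rectE[q1 q2]; apply: hS; exact/rectE.
- by move=> q Sq; exact: (dF2 (q.2, q.1) Sq).
- by move=> q Sq; exact: (dF21 (q.2, q.1) Sq).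
by rewrite /tr/= => H; exists (q.2, q.1); [exact/rectE|rewrite -H; ring].
Qed.

(** [smooth_on] provides both orders of differentiation without identifying them, while the weighted
    inequality and the commutation of [dbar] with derivatives need one common value. Both are
    attained as the same second quotient on arbitrarily small squares. *)
Lemma mixed_partials S F F1 F2 F12 F21 : open S ->
  is_partial1 S F F1 -> is_partial2 S F F2 ->
  is_partial2 S F1 F12 -> is_partial1 S F2 F21 ->
  continuous_onX S F12 -> continuous_onX S F21 ->
  forall p, S p -> F12 p = F21 p.
Proof.
move=> oS dF1 dF2 dF12 dF21 c12 c21 [x y] Sp.
apply/eqP; rewrite -subr_eq0 -normr_le0; apply/ler_addgt0Pl => e e0; rewrite addr0.
have e2 : 0 < e / 2 by rewrite divr_gt0.
have := c12 _ Sp; have := c21 _ Sp.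
move=> /cvgrPdist_lt/(_ _ e2) n1 /cvgrPdist_lt/(_ _ e2) n2.
have n3 : nbhs (x, y) S by apply: open_nbhs_nbhs.
have : nbhs (x, y) ((fun t => `|F21 (x, y) - F21 t| < e / 2) `&`
    (fun t => `|F12 (x, y) - F12 t| < e / 2) `&` S).
  by apply: filterI => //; exact: filterI.
rewrite -nbhs_ballE => -[d /= d0 hd].
have h0 : 0 < d / 2 by rewrite divr_gt0.
have inb q : rect x (x + d / 2) y (y + d / 2) q -> ball (x, y) d q.
  move=> /rectE[/andP[? ?] /andP[? ?]].
  by split; rewrite /ball/= ltr_norml; apply/andP; split; lra.
have hS : rect x (x + d / 2) y (y + d / 2) `<=` S by move=> q /inb/hd[].
have [q /inb/hd[[_ /= H1] _]] := difference12 h0 hS dF1 dF12.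
have [q' /inb/hd[[/= H2 _] _] ->] := difference21 h0 hS dF2 dF21.
have hn : d / 2 != 0 by rewrite gt_eqF.
move=> /(mulIf hn)/(mulIf hn) E; move: H1 H2; rewrite E !ltr_norml ler_norml.
by move=> /andP[? ?] /andP[? ?]; apply/andP; split; lra.
Qed.

End MixedPartials.

(** * Orders of vanishing and their behaviour under integration *)

Section Growth.
Variable R : realType.
Implicit Types (S : set (R * R)) (F G : R * R -> R) (z : R * R).

(* [r] bounds the sup-norm distance to [z0], as L-shaped paths require. *)
Definition bigO_at z0 k F := exists C e : R, 0 < e /\ forall r p, 0 <= r < e ->
  `|p.1 - z0.1| <= r -> `|p.2 - z0.2| <= r -> `|F p| <= C * r ^+ k.

Lemma bigO_atD z0 k F G : bigO_at z0 k F -> bigO_at z0 k G ->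
  bigO_at z0 k (fun p => F p + G p).
Proof.
move=> [C [e [e0 eF]]] [C' [e' [e'0 eG]]].
exists (C + C'), (Num.min e e'); rewrite lt_min e0 e'0; split => // r p.
rewrite lt_min => /andP[r0 /andP[r1 r2]] p1 p2.
apply: le_trans (ler_normD _ _) _; rewrite mulrDl.
by apply: lerD; [apply: eF|apply: eG]; rewrite // r0.
Qed.

Lemma bigO_atN z0 k F : bigO_at z0 k F -> bigO_at z0 k (fun p => - F p).
Proof.
by move=> [C [e [e0 eF]]]; exists C, e; split => // r p; rewrite normrN; exact: eF.
Qed.

Lemma bigO_atB z0 k F G : bigO_at z0 k F -> bigO_at z0 k G ->
  bigO_at z0 k (fun p => F p - G p).
Proof. by move=> hF hG; exact: bigO_atD hF (bigO_atN hG). Qed.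

Lemma bigO_at0 z0 F : {for z0, continuous F} -> bigO_at z0 0 F.
Proof.
move=> /cvgrPdist_lt/(_ 1 ltr01); rewrite -nbhs_ballE => -[e /= e0 he].
exists (`|F z0| + 1), e; split => // r p /andP[r0 re] p1 p2.
rewrite expr0 mulr1 -[F p](subrK (F z0)) addrC.
apply: le_trans (ler_normD _ _) _; rewrite lerD2l distrC; apply/ltW/he.
by split; rewrite /ball/= distrC; [apply: le_lt_trans p1 _|apply: le_lt_trans p2 _].
Qed.

(** Mean value theorem on the vertical leg from [z0] and then on the horizontal leg to the point;
    both stay within sup-distance [r], and their length at most [r] gives the gained order. *)
Lemma bigO_at_primitive z0 k S F F1 F2 : open S -> S z0 ->
  is_partial1 S F F1 -> is_partial2 S F F2 -> F z0 = 0 ->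
  bigO_at z0 k F1 -> bigO_at z0 k F2 -> bigO_at z0 k.+1 F.
Proof.
case: z0 => x0 y0 /open_prodP oS /oS[e0 e00 eS] dF1 dF2 Fz [C1 [e1 [e10 H1]]] [C2 [e2 [e20 H2]]].
exists (C1 + C2), (Num.min e0 (Num.min e1 e2)); rewrite !lt_min e00 e10 e20; split => // r.
move=> [x y]/=.
rewrite !lt_min => /andP[r0 /and3P[re0 re1 re2]] xr yr.
have Sp a b : `|a - x0| <= r -> `|b - y0| <= r -> S (a, b).
  by move=> ha hb; apply: eS; [apply: le_lt_trans ha _|apply: le_lt_trans hb _].
have z0r (t : R) : `|t - t| <= r by rewrite subrr normr0.
have mv (f df : R -> R) (a b : R) (B : R) : `|b - a| <= r -> 
    (forall t, `|t - a| <= r -> is_derive t 1 f (df t)) ->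
    (forall t, `|t - a| <= r -> `|df t| <= B) -> `|f b - f a| <= B * r.
  move=> bar dfx dfB; have B0 : 0 <= B by apply: le_trans (dfB a _).
  move: bar; case: (leP a b) => ab bar.
    have [t|c hc ->] := @mean_value R f df a b ab.
      by move=> hx; apply: dfx; move: bar; rewrite !ler_norml; lra.
    rewrite normrM; apply: ler_pM => //; apply: dfB.
    by move: bar; rewrite !ler_norml; lra.
  have [t|c hc H] := @mean_value R f df b a (ltW ab).
    by move=> hx; apply: dfx; move: bar; rewrite !ler_norml; lra.
  rewrite distrC H normrM; apply: ler_pM => //; last by rewrite distrC.
  by apply: dfB; move: bar; rewrite !ler_norml; lra.
rewrite exprSr mulrA mulrDl mulrDl.
rewrite (_ : F (x, y) = (F (x, y) - F (x0, y)) + (F (x0, y) - F (x0, y0))); last first.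
  by rewrite Fz; ring.
apply: le_trans (ler_normD _ _) _; apply: lerD.
  apply: (mv (fun t => F (t, y)) (fun t => F1 (t, y))) => // t ht.
    exact: (dF1 (t, y) (Sp _ _ ht yr)).
  by apply: H1 => //; rewrite r0.
apply: (mv (fun t => F (x0, t)) (fun t => F2 (x0, t))) => // t ht.
  exact: (dF2 (x0, t) (Sp _ _ (z0r _) ht)).
by apply: H2 => //; rewrite r0.
Qed.

End Growth.

(** * Taylor expansion at a point where [dbar f] is flat *)

Section TaylorExpansion.
Variable R : realType.
Local Notation C := (Cplane R).
Implicit Types (f : C -> C) (p : R * R).

Local Notation d1 f := (real_deriv 1 f).
Local Notation di f := (real_deriv 'i%C f).

Variables (D : set C) (z0 : R * R).
Hypotheses (oD : open D) (Dz0 : D (z0.1 +i* z0.2)%C).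
Local Notation S := (plane_set D).

Let oS : open S. Proof. exact: open_plane_set. Qed.

(* [re_dbar2 f + i im_dbar2 f] is [2 dbar f]. *)
Definition re_dbar2 f p : R := re (d1 f) p - im (di f) p.
Definition im_dbar2 f p : R := im (d1 f) p + re (di f) p.

Definition dbar2_eq0 f p := re_dbar2 f p = 0 /\ im_dbar2 f p = 0.

(** The head of the word is the derivative applied first, so flatness of [f] passes to its two first
    derivatives by merely lengthening the word. *)
Fixpoint iter_deriv (w : seq bool) f : C -> C :=
  if w is b :: w' then iter_deriv w' (if b then d1 f else di f) else f.

Definition dbar2_flat f p := forall w, dbar2_eq0 (iter_deriv w f) p.

Lemma smooth_mixed_re f p : smooth_on D f -> S p -> re (di (d1 f)) p = re (d1 (di f)) p.
Proof.
move=> sf; apply: (@mixed_partials R S (re f) (re (d1 f)) (re (di f))).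
- exact: oS.
- by apply: is_partial1_re; exact: smooth_on_derivable1.
- by apply: is_partial2_re; exact: smooth_on_derivablei.
- by apply: is_partial2_re; apply: smooth_on_derivablei; exact: smooth_on1.
- by apply: is_partial1_re; apply: smooth_on_derivable1; exact: smooth_oni.
- by apply: continuous_onX_re; apply: smooth_on_continuous; apply/smooth_oni/smooth_on1.
- by apply: continuous_onX_re; apply: smooth_on_continuous; apply/smooth_on1/smooth_oni.
Qed.

Lemma smooth_mixed_im f p : smooth_on D f -> S p -> im (di (d1 f)) p = im (d1 (di f)) p.
Proof.
move=> sf; apply: (@mixed_partials R S (im f) (im (d1 f)) (im (di f))).
- exact: oS.
- by apply: is_partial1_im; exact: smooth_on_derivable1.
- by apply: is_partial2_im; exact: smooth_on_derivablei.
- by apply: is_partial2_im; apply: smooth_on_derivablei; exact: smooth_on1.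
- by apply: is_partial1_im; apply: smooth_on_derivable1; exact: smooth_oni.
- by apply: continuous_onX_im; apply: smooth_on_continuous; apply/smooth_oni/smooth_on1.
- by apply: continuous_onX_im; apply: smooth_on_continuous; apply/smooth_on1/smooth_oni.
Qed.

Let partial1_re f : smooth_on D f -> is_partial1 S (re f) (re (d1 f)).
Proof. by move=> sf; apply: is_partial1_re; exact: smooth_on_derivable1. Qed.
Let partial1_im f : smooth_on D f -> is_partial1 S (im f) (im (d1 f)).
Proof. by move=> sf; apply: is_partial1_im; exact: smooth_on_derivable1. Qed.
Let partial2_re f : smooth_on D f -> is_partial2 S (re f) (re (di f)).
Proof. by move=> sf; apply: is_partial2_re; exact: smooth_on_derivablei. Qed.
Let partial2_im f : smooth_on D f -> is_partial2 S (im f) (im (di f)).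
Proof. by move=> sf; apply: is_partial2_im; exact: smooth_on_derivablei. Qed.
Let cont_re f : smooth_on D f -> continuous_onX S (re f).
Proof. by move=> sf; apply: continuous_onX_re; exact: smooth_on_continuous. Qed.
Let cont_im f : smooth_on D f -> continuous_onX S (im f).
Proof. by move=> sf; apply: continuous_onX_im; exact: smooth_on_continuous. Qed.

(** [dbar] commutes with differentiation by the symmetry of mixed partials; likewise in the next
    three lemmas. *)
Lemma partial1_re_dbar2 f : smooth_on D f -> is_partial1 S (re_dbar2 f) (re_dbar2 (d1 f)).
Proof.
move=> sf p Sp; have s1 := smooth_on1 sf; have si := smooth_oni sf.
rewrite /re_dbar2 (smooth_mixed_im sf)//.
by apply: is_deriveB_fct; [exact: partial1_re|exact: partial1_im].
Qed.

Lemma partial1_im_dbar2 f : smooth_on D f -> is_partial1 S (im_dbar2 f) (im_dbar2 (d1 f)).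
Proof.
move=> sf p Sp; have s1 := smooth_on1 sf; have si := smooth_oni sf.
rewrite /im_dbar2 (smooth_mixed_re sf)//.
by apply: is_deriveD_fct; [exact: partial1_im|exact: partial1_re].
Qed.

Lemma partial2_re_dbar2 f : smooth_on D f -> is_partial2 S (re_dbar2 f) (re_dbar2 (di f)).
Proof.
move=> sf p Sp; have s1 := smooth_on1 sf; have si := smooth_oni sf.
rewrite /re_dbar2 -(smooth_mixed_re sf)//.
by apply: is_deriveB_fct; [exact: partial2_re|exact: partial2_im].
Qed.

Lemma partial2_im_dbar2 f : smooth_on D f -> is_partial2 S (im_dbar2 f) (im_dbar2 (di f)).
Proof.
move=> sf p Sp; have s1 := smooth_on1 sf; have si := smooth_oni sf.
rewrite /im_dbar2 -(smooth_mixed_im sf)//.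
by apply: is_deriveD_fct; [exact: partial2_im|exact: partial2_re].
Qed.

Lemma continuous_re_dbar2 f : smooth_on D f -> continuous_onX S (re_dbar2 f).
Proof.
move=> sf; apply: continuous_onXB.
  by apply: cont_re; exact: smooth_on1.
by apply: cont_im; exact: smooth_oni.
Qed.

Lemma continuous_im_dbar2 f : smooth_on D f -> continuous_onX S (im_dbar2 f).
Proof.
move=> sf; apply: continuous_onXD.
  by apply: cont_im; exact: smooth_on1.
by apply: cont_re; exact: smooth_oni.
Qed.

(** Induction on the order for all flat functions at once: the first derivatives are flat again, and
    integrating their bounds gains one order. *)
Lemma dbar2_flat_bigO k f : smooth_on D f -> dbar2_flat f z0 ->
  bigO_at z0 k (re_dbar2 f) /\ bigO_at z0 k (im_dbar2 f).
Proof.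
elim: k f => [|k ih] f sf ff.
  by split; apply: bigO_at0; [exact: continuous_re_dbar2|exact: continuous_im_dbar2].
have [r1 i1] := ih _ (smooth_on1 sf) (fun w => ff (true :: w)).
have [r2 i2] := ih _ (smooth_oni sf) (fun w => ff (false :: w)).
have [fr fi] := ff [::].
split.
  apply: (@bigO_at_primitive _ _ _ S) r1 r2 => //; [exact: partial1_re_dbar2|exact: partial2_re_dbar2].
by apply: (@bigO_at_primitive _ _ _ S) i1 i2 => //; [exact: partial1_im_dbar2|exact: partial2_im_dbar2].
Qed.

Definition monomial k : C -> C := fun z => (z - (z0.1 +i* z0.2)%C) ^+ k.

Let ReM (z w : C) : complex.Re (z * w) =
  complex.Re z * complex.Re w - complex.Im z * complex.Im w.
Proof. by case: z; case: w. Qed.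

Let ImM (z w : C) : complex.Im (z * w) =
  complex.Re z * complex.Im w + complex.Im z * complex.Re w.
Proof. by case: z; case: w. Qed.

Lemma re_monomialS k p : re (monomial k.+1) p =
  (p.1 - z0.1) * re (monomial k) p - (p.2 - z0.2) * im (monomial k) p.
Proof. by rewrite /re /monomial exprS ReM. Qed.

Lemma im_monomialS k p : im (monomial k.+1) p =
  (p.1 - z0.1) * im (monomial k) p + (p.2 - z0.2) * re (monomial k) p.
Proof. by rewrite /im /monomial exprS ImM. Qed.

Lemma partial_monomial k A :
  [/\ is_partial1 A (re (monomial k.+1)) (fun p => k.+1%:R * re (monomial k) p),
      is_partial1 A (im (monomial k.+1)) (fun p => k.+1%:R * im (monomial k) p),
      is_partial2 A (re (monomial k.+1)) (fun p => - (k.+1%:R * im (monomial k) p)) &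
      is_partial2 A (im (monomial k.+1)) (fun p => k.+1%:R * re (monomial k) p)].
Proof.
have dB (a x : R) : is_derive x 1 (fun t => t - a) (1 - 0) by exact: is_deriveB_fct.
have dc (a x : R) : is_derive x 1 (fun=> a) 0 by exact: is_derive_cst.
have re0 p : re (monomial 0) p = 1 by rewrite /re /monomial expr0.
have im0 p : im (monomial 0) p = 0 by rewrite /im /monomial expr0.
elim: k => [|k [h1 h2 h3 h4]].
  split; move=> [x y] _ /=.
  - under eq_fun do rewrite re_monomialS re0 im0 /= mulr0 subr0 mulr1.
    by apply: is_derive_eq (dB z0.1 x) _; rewrite re0; ring.
  - under eq_fun do rewrite im_monomialS re0 im0 /= mulr0 add0r mulr1.
    by apply: is_derive_eq (dc _ x) _; rewrite im0; ring.
  - under eq_fun do rewrite re_monomialS re0 im0 /= mulr0 subr0 mulr1.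
    by apply: is_derive_eq (dc _ y) _; rewrite im0; ring.
  - under eq_fun do rewrite im_monomialS re0 im0 /= mulr0 add0r mulr1.
    by apply: is_derive_eq (dB z0.2 y) _; rewrite re0; ring.
split; move=> [x y] Ap /=.
- under eq_fun do rewrite re_monomialS /=.
  have e1 := is_deriveM_fct (dB z0.1 x) (h1 _ Ap).
  have e2 := is_deriveM_fct (dc (y - z0.2) x) (h2 _ Ap).
  apply: is_derive_eq (is_deriveB_fct e1 e2) _ => /=.
  by rewrite (re_monomialS k) -[k.+2%:R]natr1/=; ring.
- under eq_fun do rewrite im_monomialS /=.
  have e1 := is_deriveM_fct (dB z0.1 x) (h2 _ Ap).
  have e2 := is_deriveM_fct (dc (y - z0.2) x) (h1 _ Ap).
  apply: is_derive_eq (is_deriveD_fct e1 e2) _ => /=.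
  by rewrite (im_monomialS k) -[k.+2%:R]natr1/=; ring.
- under eq_fun do rewrite re_monomialS /=.
  have e1 := is_deriveM_fct (dc (x - z0.1) y) (h3 _ Ap).
  have e2 := is_deriveM_fct (dB z0.2 y) (h4 _ Ap).
  apply: is_derive_eq (is_deriveB_fct e1 e2) _ => /=.
  by rewrite (im_monomialS k) -[k.+2%:R]natr1/=; ring.
- under eq_fun do rewrite im_monomialS /=.
  have e1 := is_deriveM_fct (dc (x - z0.1) y) (h4 _ Ap).
  have e2 := is_deriveM_fct (dB z0.2 y) (h3 _ Ap).
  apply: is_derive_eq (is_deriveD_fct e1 e2) _ => /=.
  by rewrite (re_monomialS k) -[k.+2%:R]natr1/=; ring.
Qed.

(** Induction on [k], passing to the [x]-derivative. Only pure [x]-derivatives are prescribed,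
    because [di f] equals [i d1 f] up to a multiple of [dbar f], which flatness makes as small as
    required. The leading term is [(a + i b) (z - z0)^k] in real form. *)
Lemma taylor_leading_term k f (a b : R) : smooth_on D f -> dbar2_flat f z0 ->
  (forall j, (j < k)%N -> iter j (real_deriv 1) f (z0.1 +i* z0.2)%C = 0) ->
  re (iter k (real_deriv 1) f) z0 = k`!%:R * a ->
  im (iter k (real_deriv 1) f) z0 = k`!%:R * b ->
  bigO_at z0 k.+1 (fun p => re f p - (a * re (monomial k) p - b * im (monomial k) p)) /\
  bigO_at z0 k.+1 (fun p => im f p - (a * im (monomial k) p + b * re (monomial k) p)).
Proof.
have re0 p : re (monomial 0) p = 1 by rewrite /re /monomial expr0.
have im0 p : im (monomial 0) p = 0 by rewrite /im /monomial expr0.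
elim: k f a b => [|k ih] f a b sf ff f0 fa fb.
  have := smooth_on1 sf; have := smooth_oni sf => si s1.
  rewrite fact0 !mul1r in fa fb.
  split.
    under eq_fun do rewrite re0 im0 mulr0 mulr1 subr0.
    apply: (@bigO_at_primitive _ _ _ S _ (re (d1 f)) (re (di f))) => //.
    - by move=> p Sp; apply: is_derive_eq (is_deriveB_fct (partial1_re sf Sp) (is_derive_cst a p.1 1)) _; rewrite subr0.
    - by move=> p Sp; apply: is_derive_eq (is_deriveB_fct (partial2_re sf Sp) (is_derive_cst a p.2 1)) _; rewrite subr0.
    - by rewrite -fa subrr.
    - by apply: bigO_at0; exact: cont_re.
    - by apply: bigO_at0; exact: cont_re.
  under eq_fun do rewrite re0 im0 mulr0 mulr1 add0r.
  apply: (@bigO_at_primitive _ _ _ S _ (im (d1 f)) (im (di f))) => //.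
  - by move=> p Sp; apply: is_derive_eq (is_deriveB_fct (partial1_im sf Sp) (is_derive_cst b p.1 1)) _; rewrite subr0.
  - by move=> p Sp; apply: is_derive_eq (is_deriveB_fct (partial2_im sf Sp) (is_derive_cst b p.2 1)) _; rewrite subr0.
  - by rewrite -fb subrr.
  - by apply: bigO_at0; exact: cont_im.
  - by apply: bigO_at0; exact: cont_im.
have [hr hi] := dbar2_flat_bigO k.+1 sf ff.
have [|||H1 H2] := ih (d1 f) (k.+1%:R * a) (k.+1%:R * b) (smooth_on1 sf) (fun w => ff (true :: w)).
- by move=> j jk; rewrite -iterSr; exact: f0.
- by rewrite -iterSr fa factS natrM mulrA [_ * k`!%:R]mulrC.
- by rewrite -iterSr fb factS natrM mulrA [_ * k`!%:R]mulrC.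
have [m1 m2 m3 m4] := partial_monomial k S.
have fz : f (z0.1 +i* z0.2)%C = 0 by exact: (f0 0%N).
have mz : re (monomial k.+1) z0 = 0 /\ im (monomial k.+1) z0 = 0.
  by rewrite re_monomialS im_monomialS !subrr !mul0r subr0 addr0.
split.
- apply: (@bigO_at_primitive _ _ _ S _
    (fun p => re (d1 f) p - (k.+1%:R * a * re (monomial k) p - k.+1%:R * b * im (monomial k) p))
    (fun p => im_dbar2 f p - (im (d1 f) p - (k.+1%:R * a * im (monomial k) p + k.+1%:R * b * re (monomial k) p)))) => //.
  + move=> p Sp; apply: is_derive_eq (is_deriveB_fct (partial1_re sf Sp)
      (is_deriveB_fct (is_deriveZ_fct a (m1 p Sp)) (is_deriveZ_fct b (m2 p Sp)))) _.
    by ring.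
  + move=> p Sp; apply: is_derive_eq (is_deriveB_fct (partial2_re sf Sp)
      (is_deriveB_fct (is_deriveZ_fct a (m3 p Sp)) (is_deriveZ_fct b (m4 p Sp)))) _.
    by rewrite /im_dbar2; ring.
  + by rewrite mz.1 mz.2 /re fz/=; ring.
  + exact: bigO_atB.
- apply: (@bigO_at_primitive _ _ _ S _
    (fun p => im (d1 f) p - (k.+1%:R * a * im (monomial k) p + k.+1%:R * b * re (monomial k) p))
    (fun p => (re (d1 f) p - (k.+1%:R * a * re (monomial k) p - k.+1%:R * b * im (monomial k) p)) - re_dbar2 f p)) => //.
  + move=> p Sp; apply: is_derive_eq (is_deriveB_fct (partial1_im sf Sp)
      (is_deriveD_fct (is_deriveZ_fct a (m2 p Sp)) (is_deriveZ_fct b (m1 p Sp)))) _.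
    by ring.
  + move=> p Sp; apply: is_derive_eq (is_deriveB_fct (partial2_im sf Sp)
      (is_deriveD_fct (is_deriveZ_fct a (m4 p Sp)) (is_deriveZ_fct b (m3 p Sp)))) _.
    by rewrite /re_dbar2; ring.
  + by rewrite mz.1 mz.2 /im fz/=; ring.
  + exact: bigO_atB.
Qed.

End TaylorExpansion.

(** * Vanishing on an open set and at its limit points *)

Section ZeroSets.
Variable R : realType.
Local Notation C := (Cplane R).
Implicit Types (f : C -> C) (p : R * R) (S A : set (R * R)) (F G : R * R -> R).

Definition adherent A p := forall e : R, 0 < e ->
  exists q, [/\ A q, `|q.1 - p.1| < e & `|q.2 - p.2| < e].

Lemma partial1_eq0 S A F G : open A -> A `<=` S -> is_partial1 S F G ->
  (forall p, A p -> F p = 0) -> forall p, A p -> G p = 0.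
Proof.
move=> /open_prodP oA AS dF F0 [x y] Ap; have [e e0 eA] := oA _ Ap.
have dFx := dF _ (AS _ Ap); have <- : 'D_1 (fun t => F (t, y)) x = G (x, y).
  by rewrite derive_val.
rewrite (_ : 0 = 'D_1 (cst 0 : R -> R) x); last by rewrite derive_cst.
apply: near_eq_derive.
apply/nbhs_ballP; exists e => //= t; rewrite /ball/= distrC => xt.
by rewrite F0//; apply: eA; rewrite //= subrr normr0.
Qed.

Lemma partial2_eq0 S A F G : open A -> A `<=` S -> is_partial2 S F G ->
  (forall p, A p -> F p = 0) -> forall p, A p -> G p = 0.
Proof.
move=> /open_prodP oA AS dF F0 [x y] Ap; have [e e0 eA] := oA _ Ap.
have dFx := dF _ (AS _ Ap); have <- : 'D_1 (fun t => F (x, t)) y = G (x, y).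
  by rewrite derive_val.
rewrite (_ : 0 = 'D_1 (cst 0 : R -> R) y); last by rewrite derive_cst.
apply: near_eq_derive.
apply/nbhs_ballP; exists e => //= t; rewrite /ball/= distrC => yt.
by rewrite F0//; apply: eA; rewrite //= subrr normr0.
Qed.

Lemma adherent_eq0 S A F p : continuous_onX S F -> S p -> adherent A p ->
  (forall q, A q -> F q = 0) -> F p = 0.
Proof.
move=> cF Sp ap F0; apply/eqP; apply: contraT => Fp.
have : nbhs p (fun q => F q != 0) by exact: (cvgr_neq0 _ (cF p Sp) Fp).
rewrite -nbhs_ballE => -[e /= e0 he].
have [q [Aq q1 q2]] := ap _ e0.
suff : F q != 0 by rewrite F0// eqxx.
by apply: he; split; rewrite /ball/= distrC.
Qed.

Variable D : set C.
Hypothesis oD : open D.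
Local Notation S := (plane_set D).
Local Notation d1 f := (real_deriv 1 f).
Local Notation di f := (real_deriv 'i%C f).

Lemma smooth_eq0_deriv f A : open A -> A `<=` S -> smooth_on D f ->
  (forall p, A p -> re f p = 0 /\ im f p = 0) ->
  forall w p, A p -> re (iter_deriv w f) p = 0 /\ im (iter_deriv w f) p = 0.
Proof.
move=> oA AS sf f0 w; elim: w f sf f0 => [//|b w ih] f sf f0 p Ap.
have r0 q : A q -> re f q = 0 by move=> /f0[].
have i0 q : A q -> im f q = 0 by move=> /f0[].
apply: ih Ap; case: b.
- exact: smooth_on1.
- exact: smooth_oni.
- move=> q Aq; split.
    exact: partial1_eq0 oA AS (is_partial1_re (smooth_on_derivable1 sf)) r0 q Aq.
  exact: partial1_eq0 oA AS (is_partial1_im (smooth_on_derivable1 sf)) i0 q Aq.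
- move=> q Aq; split.
    exact: partial2_eq0 oA AS (is_partial2_re (smooth_on_derivablei sf)) r0 q Aq.
  exact: partial2_eq0 oA AS (is_partial2_im (smooth_on_derivablei sf)) i0 q Aq.
Qed.

Lemma dbar2_eq0_deriv f A : open A -> A `<=` S -> smooth_on D f ->
  (forall p, A p -> dbar2_eq0 f p) ->
  forall w p, A p -> dbar2_eq0 (iter_deriv w f) p.
Proof.
move=> oA AS sf f0 w; elim: w f sf f0 => [//|b w ih] f sf f0 p Ap.
have r0 q : A q -> re_dbar2 f q = 0 by move=> /f0[].
have i0 q : A q -> im_dbar2 f q = 0 by move=> /f0[].
apply: ih Ap; case: b.
- exact: smooth_on1.
- exact: smooth_oni.
- move=> q Aq; split.
    exact: partial1_eq0 oA AS (partial1_re_dbar2 oD sf) r0 q Aq.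
  exact: partial1_eq0 oA AS (partial1_im_dbar2 oD sf) i0 q Aq.
- move=> q Aq; split.
    exact: partial2_eq0 oA AS (partial2_re_dbar2 oD sf) r0 q Aq.
  exact: partial2_eq0 oA AS (partial2_im_dbar2 oD sf) i0 q Aq.
Qed.

Lemma smooth_iter_deriv f w : smooth_on D f -> smooth_on D (iter_deriv w f).
Proof.
elim: w f => [//|[] w ih] f sf; apply: ih; [exact: smooth_on1|exact: smooth_oni].
Qed.

Lemma dbar2_flat_adherent f A p : open A -> A `<=` S -> smooth_on D f ->
  (forall q, A q -> dbar2_eq0 f q) -> S p -> adherent A p -> dbar2_flat f p.
Proof.
move=> oA AS sf f0 Sp ap w; have sw := smooth_iter_deriv w sf.
have H := dbar2_eq0_deriv oA AS sf f0 w.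
split.
  by apply: (adherent_eq0 (continuous_re_dbar2 sw) Sp ap) => q /H[].
by apply: (adherent_eq0 (continuous_im_dbar2 sw) Sp ap) => q /H[].
Qed.

Lemma iter_derivE k f : iter k (real_deriv 1) f = iter_deriv (nseq k true) f.
Proof. by elim: k f => [//|k ih] f; rewrite iterSr ih. Qed.

Lemma smooth_eq0_adherent f A p : open A -> A `<=` S -> smooth_on D f ->
  (forall q, A q -> re f q = 0 /\ im f q = 0) -> S p -> adherent A p ->
  forall k, re (iter k (real_deriv 1) f) p = 0 /\ im (iter k (real_deriv 1) f) p = 0.
Proof.
move=> oA AS sf f0 Sp ap k; rewrite iter_derivE; set w := nseq _ _.
have sw := smooth_iter_deriv w sf.
have H := smooth_eq0_deriv oA AS sf f0 w.
split.
  by apply: (adherent_eq0 (continuous_onX_re (smooth_on_continuous sw)) Sp ap) => q /H[].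
by apply: (adherent_eq0 (continuous_onX_im (smooth_on_continuous sw)) Sp ap) => q /H[].
Qed.

End ZeroSets.

(** * The Cauchy-Riemann equations from complex differentiability *)

Section CauchyRiemann.
Variable R : realType.
Local Notation C := (Cplane R).
Implicit Types (u f : C -> C) (Omega : set C) (z v : C).

Let ReB (z w : C) : complex.Re (z - w) = complex.Re z - complex.Re w.
Proof. by case: z; case: w. Qed.
Let ImB (z w : C) : complex.Im (z - w) = complex.Im z - complex.Im w.
Proof. by case: z; case: w. Qed.
Let ReZ (t : R) (z : C) : complex.Re ((t%:C)%C * z) = t * complex.Re z.
Proof. by case: z => a b /=; rewrite mul0r subr0. Qed.
Let ImZ (t : R) (z : C) : complex.Im ((t%:C)%C * z) = t * complex.Im z.
Proof. by case: z => a b /=; rewrite mul0r addr0. Qed.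

(** A single complex witness [w] controls the difference quotients of the real and imaginary parts
    at once. The shape [t + 0] is that of the quotient defining [derive1] at [0]. *)
Lemma holomorphic_difference Omega u f z v (e : R) : open Omega -> Omega z ->
  derivable u z 1 -> (forall w, Omega w -> f w = u w) -> cabs v = 1 -> 0 < e ->
  \forall t \near (0 : R)^', exists2 w : C, cabs (w - 'D_1 u z * v) < e &
    f (z + ((t + 0)%:C)%C * v) - f (z + (0%:C)%C * v) = (t%:C)%C * w.
Proof.
move=> oO Oz du fu v1 e0; set L := 'D_1 u z.
have cv : (fun h : C => h^-1 *: ((u \o shift z) (h *: 1) - u z)) @ 0^' --> L by exact: du.
have eC : 0 < (e%:C)%C :> C by rewrite (ltcR 0).
have /cvgrPdist_lt/(_ _ eC) := cv.
rewrite /= => /nbhs_planeP[d d0 hd].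
have /nbhs_planeP[d' d'0 hd'] : nbhs z Omega by apply: open_nbhs_nbhs.
have v0 : v != 0.
  by apply/eqP => v0; move: v1; rewrite v0 /cabs Normc.normc0 => /eqP; rewrite eq_sym oner_eq0.
have vR : `|complex.Re v| <= 1 by rewrite -v1 normr_Re_le.
have vI : `|complex.Im v| <= 1 by rewrite -v1 normr_Im_le.
have m0 : 0 < Num.min d d' by rewrite lt_min d0.
exists (Num.min d d'); first exact: m0.
move=> t; rewrite /ball /ball_ /= sub0r normrN lt_min => /andP[td td'] t0.
rewrite addr0 mul0r addr0.
set h := (t%:C)%C * v.
have tn (x : R) : `|x| <= 1 -> `|t * x| <= `|t|.
  by move=> x1; rewrite normrM ler_piMr.
have h0 : h != 0 by rewrite mulf_neq0// (inj_eq (@complexI R) _ 0).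
have hR : `|complex.Re h| <= `|t| by rewrite ReZ tn.
have hI : `|complex.Im h| <= `|t| by rewrite ImZ tn.
have Ozh : Omega (z + h).
  by apply: hd'; rewrite [z + h]addrC -?ReB -?ImB addrK; apply: le_lt_trans td'.
have := hd h; rewrite !subr0 => /(_ (le_lt_trans hR td) (le_lt_trans hI td) h0).
rewrite !fu// [h *: 1]mulr1 [h + z]addrC => H.
exists (h^-1 * (u (z + h) - u z) * v).
  rewrite -mulrBl cabsM v1 mulr1 -(ltcR _ e).
  by move: H; rewrite distrC.
by rewrite [_ * v]mulrC [RHS]mulrA -/h mulrA divff// mul1r.
Qed.

Lemma holomorphic_real_deriv Omega u f z v : open Omega -> Omega z ->
  derivable u z 1 -> (forall w, Omega w -> f w = u w) -> cabs v = 1 ->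
  real_deriv v f z = 'D_1 u z * v.
Proof.
move=> oO Oz du fu v1.
have H := @holomorphic_difference Omega u f z v _ oO Oz du fu v1.
apply/eqP; rewrite eq_complex/=; apply/andP; split; apply/eqP.
  apply: cvg_lim => //; apply/cvgrPdist_lt => e /H; apply: filterS2 (nbhs_dnbhs_neq 0) => t t0.
  move=> [w we wE].
  rewrite -ReB wE ReZ /GRing.scale/= mulrA mulVf// mul1r distrC -ReB.
  by apply: le_lt_trans (normr_Re_le _) we.
apply: cvg_lim => //; apply/cvgrPdist_lt => e /H; apply: filterS2 (nbhs_dnbhs_neq 0) => t t0.
move=> [w we wE].
rewrite -ImB wE ImZ /GRing.scale/= mulrA mulVf// mul1r distrC -ImB.
by apply: le_lt_trans (normr_Im_le _) we.
Qed.

Lemma holomorphic_dbar2_eq0 Omega u f : open Omega -> holomorphic_on Omega u ->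
  (forall w, Omega w -> f w = u w) -> forall p, plane_set Omega p -> dbar2_eq0 f p.
Proof.
move=> oO hu fu p Op.
have E v := @holomorphic_real_deriv Omega u f _ v oO Op (hu _ Op) fu.
rewrite /dbar2_eq0 /re_dbar2 /im_dbar2 /re /im !E.
- by case: ('D_1 u _) => a b /=; split; ring.
- by rewrite /cabs/= expr0n/= add0r expr1n sqrtr1.
- by rewrite /cabs Normc.normc1.
Qed.

End CauchyRiemann.

(** * Unique continuation at a point where all derivatives vanish *)

Section LocalUniqueContinuation.
Variable R : realType.
Local Notation C := (Cplane R).
Local Notation mu := (lebesgue_plane R).
Implicit Types (f : C -> C) (F : R * R -> R).

(** A bound near [z0] becomes one on the whole square: at sup-distance at least [e], [den] is at
    least [e^2], and a bound [M] for [F] by compactness is absorbed in the constant. *)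
Lemma bigO_at_sqr_le (z0 : R * R) (rho : R) (S : set (R * R)) m F : open S -> square z0 rho `<=` S ->
  continuous_onX S F -> bigO_at z0 m F ->
  exists B, forall p, square z0 rho p -> F p ^+ 2 <= B * den z0 0 p ^+ m.
Proof.
move=> oS KS cF [B0 [e [e0 HB]]].
have [M M0 HM] := continuous_rect_bounded KS cF.
have e2 : 0 < (e ^+ 2) ^+ m by rewrite !exprn_gt0.
exists (B0 ^+ 2 + M ^+ 2 / (e ^+ 2) ^+ m) => p Kp.
pose r := Num.max `|p.1 - z0.1| `|p.2 - z0.2|.
have r0 : 0 <= r by rewrite le_max normr_ge0.
have rden : r ^+ 2 <= den z0 0 p.
  rewrite /den addr0 /r maxEle; case: ifP => _; rewrite real_normK ?num_real//.
    by rewrite lerDr sqr_ge0.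
  by rewrite lerDl sqr_ge0.
have den0 : 0 <= den z0 0 p by apply: le_trans rden; exact: sqr_ge0.
have C1 : 0 <= B0 ^+ 2 * den z0 0 p ^+ m by rewrite mulr_ge0 ?sqr_ge0 ?exprn_ge0.
have C2 : 0 <= M ^+ 2 / (e ^+ 2) ^+ m * den z0 0 p ^+ m.
  by apply: mulr_ge0; [apply: divr_ge0; [exact: sqr_ge0|exact: ltW]|exact: exprn_ge0].
have p1 : `|p.1 - z0.1| <= r by rewrite le_max lexx.
have p2 : `|p.2 - z0.2| <= r by rewrite le_max lexx orbT.
rewrite mulrDl; have [re|er] := ltP r e.
  apply: (@le_trans _ _ (B0 ^+ 2 * den z0 0 p ^+ m)); last by rewrite lerDl.
  have : `|F p| <= B0 * r ^+ m by apply: HB => //; rewrite r0.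
  move=> /sqr_le_norm/le_trans; apply; rewrite exprMn -exprM mulnC exprM.
  by apply: ler_wpM2l; [exact: sqr_ge0|apply: lerXn2r; rewrite ?nnegrE ?sqr_ge0].
apply: (@le_trans _ _ (M ^+ 2 / (e ^+ 2) ^+ m * den z0 0 p ^+ m)); last by rewrite lerDr.
apply: (@le_trans _ _ (M ^+ 2)); first exact: sqr_le_norm (HM _ Kp).
rewrite mulrAC -mulrA; apply: ler_peMr; first exact: sqr_ge0.
rewrite ler_pdivlMr// mul1r; apply: lerXn2r; rewrite ?nnegrE ?sqr_ge0//.
by apply: le_trans rden; apply: lerXn2r => //; rewrite nnegrE// ltW.
Qed.

Variables (D : set C) (f : C -> C) (z0 : R * R).
Hypotheses (oD : open D) (sf : smooth_on D f).
Local Notation S := (plane_set D).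
Hypotheses (Sz0 : S z0) (flat_dbar : dbar2_flat f z0).
Hypothesis flat_f : forall k, re (iter k (real_deriv 1) f) z0 = 0 /\
  im (iter k (real_deriv 1) f) z0 = 0.

(** Taylor expansion with leading coefficient [0]; order [0] is mere continuity. *)
Lemma flat_bigO k : bigO_at z0 k (re f) /\ bigO_at z0 k (im f).
Proof.
have s0 : bigO_at z0 0 (re f) /\ bigO_at z0 0 (im f).
  split; apply: bigO_at0.
    exact: (continuous_onX_re (smooth_on_continuous sf)).
  exact: (continuous_onX_im (smooth_on_continuous sf)).
case: k => [//|k].
have [|||h1 h2] := @taylor_leading_term R D z0 oD Sz0 k f 0 0 sf flat_dbar.
- move=> j _; have [a b] := flat_f j; apply/eqP; rewrite eq_complex.
  by apply/andP; split; apply/eqP.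
- by rewrite mulr0; have [] := flat_f k.
- by rewrite mulr0; have [] := flat_f k.
move: h1 h2; under eq_fun do rewrite !mul0r subrr subr0.
by move=> h1; under eq_fun do rewrite !mul0r addr0 subr0.
Qed.

Lemma unique_continuation_at (e : R) : 0 < e ->
  (forall rho, 0 < rho < e -> mu.-integrable (square z0 rho) (EFin \o
    (fun p => (re_dbar2 f p ^+ 2 + im_dbar2 f p ^+ 2) / (re f p ^+ 2 + im f p ^+ 2)))) ->
  exists2 r, 0 < r & forall q, `|q.1 - z0.1| < r -> `|q.2 - z0.2| < r ->
    re f q = 0 /\ im f q = 0.
Proof.
move=> e0 inth.
have oS : open S by exact: open_plane_set.
have /open_prodP/(_ _ Sz0)[e1 e10 eS] := oS.
(* The bound [1 / 4] secures [12 rho^2 <= 1]. *)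
pose rho := Num.min (Num.min (e / 2) (e1 / 2)) (1 / 4).
have rho0 : 0 < rho by rewrite !lt_min !divr_gt0.
have rhoe : rho < e by apply: (@le_lt_trans _ _ (e / 2)); [rewrite !ge_min lexx|lra].
have rhoe1 : rho < e1.
  by apply: (@le_lt_trans _ _ (e1 / 2)); [rewrite !ge_min lexx orbT|lra].
have rho4 : rho <= 1 / 4 by rewrite ge_min lexx orbT.
have rho1 : 12 * rho ^+ 2 <= 1 by nra.
have KS : square z0 rho `<=` S.
  by move=> q /squareE[q1 q2]; apply: eS; [apply: le_lt_trans q1 _|apply: le_lt_trans q2 _].
have s1 := smooth_on1 sf; have si := smooth_oni sf.
have cr f' : smooth_on D f' -> continuous_onX S (re f').
  by move=> s'; apply: continuous_onX_re; exact: smooth_on_continuous.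
have ci f' : smooth_on D f' -> continuous_onX S (im f').
  by move=> s'; apply: continuous_onX_im; exact: smooth_on_continuous.
have p1r f' : smooth_on D f' -> is_partial1 S (re f') (re (real_deriv 1 f')).
  by move=> s'; apply: is_partial1_re; exact: smooth_on_derivable1.
have p1i f' : smooth_on D f' -> is_partial1 S (im f') (im (real_deriv 1 f')).
  by move=> s'; apply: is_partial1_im; exact: smooth_on_derivable1.
have p2r f' : smooth_on D f' -> is_partial2 S (re f') (re (real_deriv 'i%C f')).
  by move=> s'; apply: is_partial2_re; exact: smooth_on_derivablei.
have p2i f' : smooth_on D f' -> is_partial2 S (im f') (im (real_deriv 'i%C f')).
  by move=> s'; apply: is_partial2_im; exact: smooth_on_derivablei.
have H := @unique_continuation_square R S z0 rho rho0 rho1 oS KS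
  (re f) (re (real_deriv 1 f)) (re (real_deriv 'i%C f)) (re (real_deriv 'i%C (real_deriv 1 f)))
  (im f) (im (real_deriv 1 f)) (im (real_deriv 'i%C f)) (im (real_deriv 'i%C (real_deriv 1 f)))
  (p1r _ sf) (p2r _ sf) (p2r _ s1).
exists (rho / 4); first by rewrite divr_gt0.
apply: H.
- move=> p Sp; rewrite (smooth_mixed_re oD sf Sp); exact: p1r.
- exact: p1i.
- exact: p2i.
- exact: p2i.
- move=> p Sp; rewrite (smooth_mixed_im oD sf Sp); exact: p1i.
- exact: cr.
- exact: cr.
- exact: cr.
- by apply: cr; exact: smooth_oni.
- exact: ci.
- exact: ci.
- exact: ci.
- by apply: ci; exact: smooth_oni.
- have mK : measurable (square z0 rho : set (plane R)) by exact: measurable_rect.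
  have ic : mu.-integrable (square z0 rho) (EFin \o cst (8 / rho ^+ 2)).
    exact: (continuous_rect_integrable openT (@subsetT _ _) (@continuous_onXc R setT _)).
  have ih := inth rho; rewrite rho0 rhoe in ih.
  have := integrableD mK (ih isT) ic.
  apply: eq_integrable => // p _ /=.
  by rewrite /re_dbar2 /im_dbar2 (addrC (im (real_deriv 1 f) p)).
- move=> m; have [hr hi] := flat_bigO m.
  have [B1 HB1] := bigO_at_sqr_le oS KS (cr _ sf) hr.
  have [B2 HB2] := bigO_at_sqr_le oS KS (ci _ sf) hi.
  exists (B1 + B2) => p Kp; rewrite mulrDl; exact: lerD (HB1 _ Kp) (HB2 _ Kp).
- move=> m; have [hr hi] := dbar2_flat_bigO oD Sz0 m sf flat_dbar.
  have [B1 HB1] := bigO_at_sqr_le oS KS (continuous_re_dbar2 sf) hr.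
  have [B2 HB2] := bigO_at_sqr_le oS KS (continuous_im_dbar2 sf) hi.
  exists (B1 + B2) => p Kp; rewrite mulrDl (addrC (re (real_deriv _ f) p) (im (real_deriv 1 f) p)); exact: lerD (HB1 _ Kp) (HB2 _ Kp).
Qed.

End LocalUniqueContinuation.

(** * Bounds for [f] and [dbar f] at a zero of finite order *)

Section FiniteOrder.
Variable R : realType.
Local Notation C := (Cplane R).
Implicit Types (f : C -> C) (p : R * R).

Local Notation point p := (p.1 +i* p.2 : C)%C.

Definition sup_dist (z0 p : R * R) : R := Num.max `|p.1 - z0.1| `|p.2 - z0.2|.

Lemma sup_distP z0 p r : sup_dist z0 p <= r <-> `|p.1 - z0.1| <= r /\ `|p.2 - z0.2| <= r.
Proof. by rewrite /sup_dist ge_max; split => [/andP[]|[-> ->]]. Qed.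

Lemma sup_dist_ge0 z0 p : 0 <= sup_dist z0 p.
Proof. by rewrite le_max normr_ge0. Qed.

Lemma cabs_dbar f p : cabs (dbar f (point p)) =
  2^-1 * cabs (re_dbar2 f p +i* im_dbar2 f p : C)%C.
Proof.
rewrite /dbar cabsM; congr (_ * cabs _).
  by rewrite /cabs Normc.normcV normcMn Normc.normc1.
rewrite /re_dbar2 /im_dbar2 /re /im.
case: (real_deriv 1 f _) => a b; case: (real_deriv 'i%C f _) => c d /=.
by apply/eqP; rewrite eq_complex/=; apply/andP; split; apply/eqP; ring.
Qed.

(** Division by [0] yields [0], so the explicit convention agrees with plain division. *)
Lemma dbar_quotientE f z : dbar_quotient f z = cabs (dbar f z) / cabs (f z).
Proof.
rewrite /dbar_quotient; case: eqP => // ->.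
by rewrite [cabs 0]Normc.normc0 invr0 mulr0.
Qed.

Lemma sqr_dbar_quotient f p : 4 * dbar_quotient f (point p) ^+ 2 =
  (re_dbar2 f p ^+ 2 + im_dbar2 f p ^+ 2) / (re f p ^+ 2 + im f p ^+ 2).
Proof.
rewrite dbar_quotientE cabs_dbar expr_div_n exprMn !sqr_cabs -/(re f p) -/(im f p) /=.
by rewrite mulrA; congr (_ / _); field.
Qed.

Variables (D : set C) (f : C -> C) (z0 : R * R).
Hypotheses (oD : open D) (sf : smooth_on D f) (Dz0 : D (point z0)).
Hypothesis flat_dbar : dbar2_flat f z0.

Lemma dbar_le_bigO k : exists B e : R, [/\ 0 <= B, 0 < e & forall p, sup_dist z0 p < e ->
  cabs (dbar f (point p)) <= B * sup_dist z0 p ^+ k].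
Proof.
have [[B1 [e1 [e10 H1]]] [B2 [e2 [e20 H2]]]] := dbar2_flat_bigO oD Dz0 k sf flat_dbar.
exists (`|B1| + `|B2|), (Num.min e1 e2); split => [||p]; first by rewrite addr_ge0.
  by rewrite lt_min e10.
set r := sup_dist z0 p; rewrite lt_min => /andP[re1 re2].
have r0 : 0 <= r by exact: sup_dist_ge0.
have /sup_distP[p1 p2] : sup_dist z0 p <= r by [].
rewrite cabs_dbar; set w : C := (_ +i* _)%C.
have := cabs_le w; rewrite [complex.Re w]/= [complex.Im w]/=; have := cabs_ge0 w.
move: (cabs w) => c c0.
have rk : 0 <= r ^+ k by exact: exprn_ge0.
have : `|re_dbar2 f p| <= B1 * r ^+ k by apply: H1; rewrite // r0.
have : `|im_dbar2 f p| <= B2 * r ^+ k by apply: H2; rewrite // r0.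
have := ler_wpM2r rk (ler_norm B1); have := ler_wpM2r rk (ler_norm B2).
move=> h1 h2 h3 h4 h5; rewrite mulrDl.
by apply: (@le_trans _ _ c); [rewrite mulrC ler_pdivrMr//; lra|lra].
Qed.

(** The leading term has modulus at least [|a + i b| r^k], since the modulus of [z - z0] is at least
    its sup-distance [r]; the radius is such that the remainder of order [k + 1] takes away at most
    half of it. *)
Lemma finite_order_ge k : (forall j, (j < k)%N -> iter j (real_deriv 1) f (point z0) = 0) ->
  iter k (real_deriv 1) f (point z0) != 0 ->
  exists c e : R, [/\ 0 < c, 0 < e & forall p, sup_dist z0 p < e ->
    c * sup_dist z0 p ^+ k <= cabs (f (point p))].
Proof.
move=> f0 fk; set w := iter k _ f (point z0) in fk.
have k0 : k`!%:R != 0 :> R by rewrite pnatr_eq0 -lt0n fact_gt0.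
pose a := complex.Re w / k`!%:R; pose b := complex.Im w / k`!%:R.
have [||[C1 [e1 [e10 H1]]] [C2 [e2 [e20 H2]]]] := @taylor_leading_term R D z0 oD Dz0 k f a b sf flat_dbar f0.
- by rewrite /a mulrC divfK.
- by rewrite /b mulrC divfK.
pose ab : C := (a +i* b)%C.
have ab0 : 0 < cabs ab.
  apply: cabs_gt0; apply: contra fk; rewrite /ab !eq_complex /= /a /b.
  by rewrite !mulf_eq0 invr_eq0 (negbTE k0) !orbF.
(* The [1] keeps the divisor positive when both constants are [0]. *)
pose E := `|C1| + `|C2| + 1; have E0 : 0 < E by rewrite ltr_wpDl// addr_ge0.
exists (cabs ab / 2), (Num.min (Num.min e1 e2) (cabs ab / 2 / E)); split.
- by rewrite divr_gt0.
- by rewrite !lt_min e10 e20 !divr_gt0.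
move=> p; set r := sup_dist z0 p; rewrite !lt_min => /andP[/andP[re1 re2] rE].
have r0 : 0 <= r by exact: sup_dist_ge0.
have /sup_distP[p1 p2] : sup_dist z0 p <= r by [].
have rk : 0 <= r ^+ k by exact: exprn_ge0.
have rk1 : 0 <= r ^+ k.+1 by exact: exprn_ge0.
pose T : C := ab * monomial z0 k (point p).
have TE : T = ((a * re (monomial z0 k) p - b * im (monomial z0 k) p) +i*
    (a * im (monomial z0 k) p + b * re (monomial z0 k) p))%C.
  by rewrite /T /re /im /ab; case: (monomial z0 k _).
have cT : cabs ab * r ^+ k <= cabs T.
  rewrite /T cabsM /monomial cabsX; apply: ler_wpM2l; first exact: cabs_ge0.
  apply: lerXn2r; rewrite ?nnegrE ?cabs_ge0//.
  have zE : point p - point z0 = ((p.1 - z0.1) +i* (p.2 - z0.2))%C by [].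
  rewrite zE /r /sup_dist ge_max; apply/andP; split.
    exact: (normr_Re_le ((p.1 - z0.1) +i* (p.2 - z0.2) : C)%C).
  exact: (normr_Im_le ((p.1 - z0.1) +i* (p.2 - z0.2) : C)%C).
have dT : cabs (T - f (point p)) <= (`|C1| + `|C2|) * r ^+ k.+1.
  apply: le_trans (cabs_le _) _; rewrite mulrDl TE.
  have := H1 r p; rewrite r0 re1 => /(_ isT p1 p2) h1.
  have := H2 r p; rewrite r0 re2 => /(_ isT p1 p2) h2.
  have h3 := ler_wpM2r rk1 (ler_norm C1); have h4 := ler_wpM2r rk1 (ler_norm C2).
  apply: lerD.
    apply: le_trans h3; apply: le_trans h1; rewrite distrC /re.
    by case: (f (point p)).
  apply: le_trans h4; apply: le_trans h2; rewrite distrC /im.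
  by case: (f (point p)).
have tri : cabs T <= cabs (T - f (point p)) + cabs (f (point p)).
  by rewrite -{1}[T](subrK (f (point p))); exact: cabsD.
have : (`|C1| + `|C2|) * r ^+ k.+1 <= cabs ab / 2 * r ^+ k.
  rewrite exprS mulrA; apply: ler_wpM2r => //.
  move: rE; rewrite ltr_pdivlMr// => /ltW; apply: le_trans.
  by rewrite mulrC; apply: ler_wpM2l; rewrite // lerDl.
by lra.
Qed.

End FiniteOrder.

(** * Measurability and integrability of the quotient *)

Section DbarQuotientLp.
Variable R : realType.
Local Notation C := (Cplane R).
Local Notation plane := (plane R).
Local Notation mu := (lebesgue_plane R).
Implicit Types (f : C -> C) (p : R * R) (D U V : set C).

Local Notation point p := (p.1 +i* p.2 : C)%C.

Lemma continuous_onX_sqrt (S : set (R * R)) (F : R * R -> R) : continuous_onX S F ->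
  continuous_onX S (fun p => Num.sqrt (F p)).
Proof.
move=> cF p Sp; apply: (@continuous_comp _ _ _ F Num.sqrt); first exact: cF.
exact: sqrt_continuous.
Qed.

Lemma continuous_onX_cabs D f : smooth_on D f ->
  continuous_onX (plane_set D) (fun p => cabs (f (point p))).
Proof.
move=> sf; rewrite (_ : (fun p => _) = fun p => Num.sqrt (re f p ^+ 2 + im f p ^+ 2)).
  apply: continuous_onX_sqrt; apply: continuous_onXD; apply: continuous_onXX.
    exact: (continuous_onX_re (smooth_on_continuous sf)).
  exact: (continuous_onX_im (smooth_on_continuous sf)).
by apply/funext => p; rewrite /re /im; case: (f _).
Qed.

Lemma continuous_onX_cabs_dbar D f : smooth_on D f ->
  continuous_onX (plane_set D) (fun p => cabs (dbar f (point p))).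
Proof.
move=> sf; under eq_fun do rewrite cabs_dbar; apply: continuous_onXM.
  exact: continuous_onXc.
apply: continuous_onX_sqrt; apply: continuous_onXD; apply: continuous_onXX.
  exact: continuous_re_dbar2.
exact: continuous_im_dbar2.
Qed.

Local Notation quotient f := (dbar_quotient f \o @plane_point R).

(** The quotient is continuous on the open part of [U] where [f] is nonzero and is [0] on the rest,
    so extending it by [0] from that part gives the same function. *)
Lemma measurable_dbar_quotient D U f : open D -> open U -> U `<=` D -> smooth_on D f ->
  measurable_fun [set: plane] (quotient f \_ (@plane_point R @^-1` U)).
Proof.
move=> oD oU UD sf; pose S := plane_set U.
pose F p := cabs (f (point p)).
have sub (G : R * R -> R) : continuous_onX (plane_set D) G -> continuous_onX S G.
  by move=> cG p Sp; apply: cG; exact: UD.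
have cF := sub _ (continuous_onX_cabs sf).
have oO : open (S `&` [set p | F p != 0]) by apply: open_neq0 => //; exact: open_plane_set.
set O := S `&` _ in oO.
have mO : measurable_fun (O : set plane) (quotient f).
  apply: measurable_continuous_openX => // p [Sp Fp].
  rewrite (_ : _ \o _ = fun p => cabs (dbar f (point p)) * (F p)^-1); last first.
    by apply/funext => q /=; rewrite dbar_quotientE.
  apply: cvgM; first exact: (sub _ (continuous_onX_cabs_dbar sf) p Sp).
  by apply: cvgV => //; exact: cF.
have /(measurable_restrictT _ (measurable_openX oO)) := mO.
rewrite (_ : _ \_ O = quotient f \_ (@plane_point R @^-1` U))//.
apply/funext => p; rewrite !patchE.
case: ifPn => pO; case: ifPn => pS //.
  have [Sp _] : O p by exact: set_mem.
  by move: pS; rewrite mem_set.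
have Sp : S p by move: pS; rewrite inE.
have : F p = 0.
  by apply/eqP; apply: contraNT pO => Fp; rewrite inE.
by rewrite /F /= dbar_quotientE => ->; rewrite invr0 mulr0.
Qed.

Definition box (z0 : R * R) (e : R) : set C :=
  [set z | `|complex.Re z - z0.1| < e /\ `|complex.Im z - z0.2| < e].

Lemma open_nbhs_box z0 e : 0 < e -> open_nbhs (point z0 : C) (box z0 e).
Proof.
move=> e0; split; last by rewrite /box/= !subrr normr0.
rewrite openE => z [z1 z2]; apply/nbhs_planeP.
exists (Num.min (e - `|complex.Re z - z0.1|) (e - `|complex.Im z - z0.2|)).
  by rewrite lt_min !subr_gt0 z1.
move=> w; rewrite !lt_min => /andP[w1 _] /andP[_ w2]; split.
  by have := ler_distD (complex.Re z) (complex.Re w) z0.1; lra.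
by have := ler_distD (complex.Im z) (complex.Im w) z0.2; lra.
Qed.

Lemma nbhs_box z0 (A : set C) : nbhs (point z0 : C) A -> exists2 e : R, 0 < e & box z0 e `<=` A.
Proof. by move=> /nbhs_planeP[e e0 eA]; exists e => // z [z1 z2]; exact: eA. Qed.

Lemma box_square z0 e p : plane_set (box z0 e) p -> square z0 e p.
Proof. by move=> [p1 p2]; apply/squareE; split; exact: ltW. Qed.

Lemma bounded_in_Lpoo z0 e D f (B : R) : 0 < e -> open D -> smooth_on D f ->
  box z0 e `<=` D ->
  (forall p, plane_set (box z0 e) p -> dbar_quotient f (point p) <= B) ->
  in_Lp +oo (box z0 e) (dbar_quotient f).
Proof.
move=> e0 oD sf bD qB; have [ob _] := open_nbhs_box z0 e0.
rewrite /in_Lp inE; apply/andP; split; rewrite inE/=.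
  exact: measurable_dbar_quotient bD sf.
rewrite /finite_norm unlock; case: ifPn => // _.
apply: (@le_lt_trans _ _ (Num.max 0 B)%:E); last exact: ltry.
apply/ess_supP; apply: nearW => p /=; rewrite lee_fin patchE.
case: ifPn => [|_]; last by rewrite normr0 le_max lexx.
rewrite inE => /qB; rewrite ger0_norm; last first.
  by rewrite /= dbar_quotientE divr_ge0 ?cabs_ge0.
by rewrite le_max => ->; rewrite orbT.
Qed.

(** [U] may have infinite measure, so a box inside it is taken; there a bounded function is square
    integrable. *)
Lemma in_Lpoo_in_Lp2 U z0 f : open_nbhs (point z0 : C) U ->
  in_Lp +oo U (dbar_quotient f) ->
  exists V, [/\ open_nbhs (point z0 : C) V, V `<=` U & in_Lp 2%:E V (dbar_quotient f)].
Proof.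
move=> oU; have [e e0 eU] := nbhs_box (open_nbhs_nbhs oU).
rewrite /in_Lp inE => /andP[]; rewrite !inE/= => mQ.
pose B := plane_set (box z0 e).
have [ob zb] := open_nbhs_box z0 e0.
have mB : measurable (B : set plane) by apply: measurable_openX; exact: open_plane_set.
set Q := _ \_ _ in mQ *; rewrite /finite_norm => Qoo.
exists (box z0 e); split; [exact: open_nbhs_box|by []|].
have QB : quotient f \_ (@plane_point R @^-1` box z0 e) = Q \_ B.
  apply/funext => p; rewrite /Q !patchE; case: ifPn => // pB.
  by rewrite ifT// inE; apply: eU; move: pB; rewrite inE.
rewrite QB inE; apply/andP; split; rewrite inE/=.
  by apply/(measurable_restrictT _ mB); exact: measurable_funS mQ.
(* The norm at exponent [+oo] is an essential supremum only under a test that the total measure is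
   positive. *)
have muT : (0 < mu setT)%E.
  apply: (@lt_le_trans _ _ (mu (rect 0 1 0 1))); last first.
    by apply: le_measure; rewrite ?inE//; exact: measurable_rect.
  by rewrite lebesgue_plane_rect// lte_fin; lra.
have [b b0 Qb] : exists2 b : R, 0 <= b & \forall p \ae mu, (`|Q p| <= b)%R.
  move: Qoo; rewrite unlock muT.
  have := ess_sup_ge mu (abse \o (EFin \o Q)).
  set s := ess_sup _ _ => Qs sy.
  exists `|fine s| => //; apply: filterS Qs => p /=.
  move: sy; case: s => [r| |] //=.
  by rewrite lee_fin => _ /le_trans; apply; exact: ler_norm.
rewrite /finite_norm unlock poweR_lty//.
have mK := measurable_rect (z0.1 - e) (z0.1 + e) (z0.2 - e) (z0.2 + e).
apply: (@le_lt_trans _ _ (\int[mu]_p ((cst (b ^+ 2)%:E) \_ (square z0 e)) p)%E); last first.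
  rewrite -integral_mkcond integral_cst//.
  by rewrite lte_mul_pinfty ?lee_fin ?sqr_ge0//; exact: lebesgue_plane_rect_fin.
have mQB : measurable_fun [set: plane] (Q \_ B).
  by apply/(measurable_restrictT _ mB); exact: measurable_funS mQ.
apply: ae_ge0_le_integral => //.
- by move=> p _; exact: poweR_ge0.
- apply/measurable_EFinP.
  apply/(@measurableT_comp _ _ _ _ _ _ (fun x : R => x `^ 2)%R) => //.
  exact/measurableT_comp.
- by move=> p _; rewrite patchE; case: ifPn => // _; rewrite lee_fin sqr_ge0.
- apply/(measurable_restrictT _ mK); exact: measurable_cst.
apply: filterS Qb => p Qp _ /=.
rewrite !patchE; case: ifPn => pB.
  rewrite ifT; last by rewrite inE; apply: box_square; move: pB; rewrite inE.
  by rewrite lee_fin powR_mulrn// lerXn2r// nnegrE.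
rewrite normr0 powR0 ?pnatr_eq0//; case: ifPn => // _.
by rewrite lee_fin sqr_ge0.
Qed.

Lemma in_Lp2_integrable U z0 f : open_nbhs (point z0 : C) U ->
  in_Lp 2%:E U (dbar_quotient f) -> exists2 e : R, 0 < e & forall rho, 0 < rho < e ->
  mu.-integrable (square z0 rho) (EFin \o
    (fun p => (re_dbar2 f p ^+ 2 + im_dbar2 f p ^+ 2) / (re f p ^+ 2 + im f p ^+ 2))).
Proof.
move=> oU /Lfun2_integrable_sqr iQ; have [e e0 eU] := nbhs_box (open_nbhs_nbhs oU).
exists e => // rho /andP[rho0 rhoe].
have mK := measurable_rect (z0.1 - rho) (z0.1 + rho) (z0.2 - rho) (z0.2 + rho).
have iK := integrableS measurableT mK (@subsetT _ _) iQ.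
(* The factor [4] turns [|dbar f|^2] into the square of the modulus of [2 dbar f]. *)
have := integrableZl mK 4 iK.
apply: eq_integrable => //= p; rewrite inE => /squareE[p1 p2].
rewrite -sqr_dbar_quotient -EFinM patchE ifT// inE; apply: eU.
by split; [apply: le_lt_trans p1 _|apply: le_lt_trans p2 _].
Qed.

End DbarQuotientLp.

(** * Vanishing to infinite order in the [L^2] sense *)

Section VanishingOrder.
Variable R : realType.
Local Notation C := (Cplane R).
Local Notation plane := (plane R).
Local Notation mu := (lebesgue_plane R).
Local Notation point p := (p.1 +i* p.2 : C)%C.

Variables (D : set C) (f : C -> C) (z0 : R * R).
Hypotheses (oD : open D) (sf : smooth_on D f) (Dz0 : D (point z0)).

Let disc (r : R) : set plane := [set p | (cabs (plane_point p - point z0) < r)%R].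
Let sqf (p : plane) : \bar R := ((cabs (f (plane_point p)) ^+ 2)%R)%:E.

Let disc_square r : disc r `<=` square z0 r.
Proof.
move=> p pr; apply/squareE; split; apply/ltW; apply: le_lt_trans pr.
  exact: (normr_Re_le (plane_point p - point z0)).
exact: (normr_Im_le (plane_point p - point z0)).
Qed.

Let measurable_disc r : measurable (disc r).
Proof.
pose F (p : R * R) := Num.sqrt ((p.1 - z0.1) ^+ 2 + (p.2 - z0.2) ^+ 2).
have cF : continuous_onX setT F.
  apply: continuous_onX_sqrt; apply: continuous_onXD; apply: continuous_onXX.
    by apply: continuous_onXB; [exact: continuous_onX_fst|exact: continuous_onXc].
  by apply: continuous_onXB; [exact: continuous_onX_snd|exact: continuous_onXc].
have mF := measurable_continuous_openX openT cF.
rewrite (_ : disc r = setT `&` F @^-1` `]-oo, r[); last first.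
  by apply/seteqP; split => p; rewrite setTI/= in_itv.
by apply: mF => //; exact: measurable_itv.
Qed.

Let measurable_sqf (A : set plane) : measurable A -> A `<=` plane_set D -> measurable_fun A sqf.
Proof.
move=> mA AD; apply/measurable_EFinP.
have oS : open (plane_set D) by exact: open_plane_set.
apply: (measurable_funS (measurable_openX oS) AD).
apply: measurable_continuous_openX => //.
by apply: continuous_onXX; exact: continuous_onX_cabs.
Qed.

Let sqf_ge0 p : (0 <= sqf p)%E.
Proof. by rewrite lee_fin sqr_ge0. Qed.

(** Order [m] bounds [|f|^2] by a multiple of [r^(2 m)] on a disc of area at most [4 r^2]; after
    division by [r^m] this is still [O(r)]. *)
Lemma flat_vanishes : (forall k, bigO_at z0 k (re f) /\ bigO_at z0 k (im f)) ->
  vanishes_to_infinite_order f (point z0).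
Proof.
move=> ff m; have [[C1 [e1 [e10 H1]]] [C2 [e2 [e20 H2]]]] := ff m.
have [e3 e30 e3D] : exists2 e : R, 0 < e & box z0 e `<=` D.
  by apply: nbhs_box; apply: open_nbhs_nbhs.
pose A := C1 ^+ 2 + C2 ^+ 2.
have A0 : 0 <= A by rewrite addr_ge0 ?sqr_ge0.
apply: (@squeeze_cvge _ _ _ _ (cst 0%E) _ (fun r : R => (4 * A * r)%:E)).
- near=> r; apply/andP.
  have r0 : 0 < r by near: r; exact: nbhs_right_gt.
  have r1 : r < 1 by near: r; exact: nbhs_right_lt.
  have re1 : r < e1 by near: r; exact: nbhs_right_lt.
  have re2 : r < e2 by near: r; exact: nbhs_right_lt.
  have re3 : r < e3 by near: r; exact: nbhs_right_lt.
  have rm : 0 < r ^+ m by rewrite exprn_gt0.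
  have rm1 : r ^+ m <= 1 by rewrite exprn_ile1// ltW.
  split.
    by apply: mule_ge0; [rewrite lee_fin invr_ge0 ltW|by apply: integral_ge0 => p _; exact: sqf_ge0].
  have dD : disc r `<=` plane_set D.
    move=> p /disc_square/squareE[p1 p2]; apply: e3D.
    by split; [apply: le_lt_trans p1 _|apply: le_lt_trans p2 _].
  have K0 : 0 <= A * (r ^+ m) ^+ 2 by rewrite mulr_ge0// sqr_ge0.
  have I1 : (\int[mu]_(p in disc r) sqf p <= (A * (r ^+ m) ^+ 2 * (4 * r ^+ 2))%:E)%E.
    apply: (@le_trans _ _ (\int[mu]_(p in disc r) (A * (r ^+ m) ^+ 2)%:E)%E).
      apply: ge0_le_integral => //.
        exact: (measurable_sqf (measurable_disc r) dD).
      move=> p /disc_square/squareE[p1 p2]; rewrite lee_fin sqr_cabs /A mulrDl -!exprMn.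
      by apply: lerD; apply: sqr_le_norm; [apply: H1|apply: H2]; rewrite // ltW.
    rewrite integral_cst// [leRHS]EFinM; apply: lee_wpmul2l; first by rewrite lee_fin.
    have -> : (4 * r ^+ 2)%:E = mu (square z0 r).
      rewrite lebesgue_plane_rect; [by congr (_%:E); ring|by lra|by lra].
    by apply: le_measure; rewrite ?inE; [|exact: measurable_rect|exact: disc_square].
  apply: (@le_trans _ _ ((r ^- m)%:E * (A * (r ^+ m) ^+ 2 * (4 * r ^+ 2))%:E)%E).
    by apply: lee_wpmul2l; rewrite // lee_fin invr_ge0 ltW.
  rewrite -EFinM lee_fin.
  have -> : r ^- m * (A * (r ^+ m) ^+ 2 * (4 * r ^+ 2)) = 4 * A * r * (r ^+ m * r).
    have : r ^+ m != 0 by rewrite gt_eqF.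
    by move=> rn; field.
  apply: ler_piMr; first by rewrite !mulr_ge0// ltW.
  by apply: mulr_ile1 => //; exact: ltW.
- exact: cvg_cst.
- have : (fun r : R => 4 * A * r) @ (0 : R)^'+ --> 4 * A * 0.
    by apply: cvg_at_right_filter; apply: cvgM; [exact: cvg_cst|exact: cvg_id].
  by rewrite mulr0 => h; apply: cvg_EFin => //; near=> r.
Unshelve. all: by end_near. Qed.

Lemma finite_order_not_vanishes k (c e : R) : 0 < c -> 0 < e ->
  (forall p, sup_dist z0 p < e -> c * sup_dist z0 p ^+ k <= cabs (f (point p))) ->
  ~ vanishes_to_infinite_order f (point z0).
Proof.
(* [|f|^2] is of size at least [r^(2 k)] on a part of the disc of area comparable to [r^2], so
   [2 k + 2] is the exponent at which the limit cannot be [0]. *)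
move=> c0 e0 fge /(_ (k * 2 + 2)%N) H.
have [e3 e30 e3D] : exists2 e : R, 0 < e & box z0 e `<=` D.
  by apply: nbhs_box; apply: open_nbhs_nbhs.
(* The lower bound for [|f|^2] at sup-distance at least [r / 4], times the area [r^2 / 16] of the
   square [Q] below, with the powers of [r] removed. *)
pose K := (c * (1 / 4) ^+ k) ^+ 2 / 16.
have K0 : 0 < K by rewrite divr_gt0// exprn_gt0// mulr_gt0// exprn_gt0.
have : \forall r \near (0 : R)^'+, False.
  move/fine_cvgP : H => [Hfin /cvgr0Pnorm_lt/(_ _ K0) Hlt].
  near=> r.
  have r0 : 0 < r by near: r; exact: nbhs_right_gt.
  have re : r < e by near: r; exact: nbhs_right_lt.
  have re3 : r < e3 by near: r; exact: nbhs_right_lt.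
  have hfin : ((r ^- (k * 2 + 2))%:E * \int[mu]_(p in disc r) sqf p)%E \is a fin_num.
    by near: r.
  have hlt : `|fine ((r ^- (k * 2 + 2))%:E * \int[mu]_(p in disc r) sqf p)%E| < K.
    by near: r.
  have rk : 0 < r ^+ (k * 2 + 2) by rewrite exprn_gt0.
  have dD : disc r `<=` plane_set D.
    move=> p /disc_square/squareE[p1 p2]; apply: e3D.
    by split; [apply: le_lt_trans p1 _|apply: le_lt_trans p2 _].
  (* [Q] lies in the disc, as [r / 2 + r / 4 < r], and keeps its first coordinate at least [r / 4]
     away from that of [z0]. *)
  set Q := rect (z0.1 + r / 4) (z0.1 + r / 2) z0.2 (z0.2 + r / 4).
  have mQ : measurable (Q : set plane) by exact: measurable_rect.
  have Qd : Q `<=` disc r.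
    move=> p /rectE[/andP[? ?] /andP[? ?]]; rewrite /disc /mkset.
    apply: (le_lt_trans (cabs_le _)) => /=.
    by rewrite !ger0_norm; lra.
  have I1 : ((K * r ^+ (k * 2 + 2))%:E <= \int[mu]_(p in disc r) sqf p)%E.
    apply: (@le_trans _ _ (\int[mu]_(p in Q) sqf p)%E); last first.
      by apply: ge0_subset_integral => //; exact: (measurable_sqf (measurable_disc r) dD).
    have -> : (K * r ^+ (k * 2 + 2))%:E = (\int[mu]_(p in Q) ((c * (r / 4) ^+ k) ^+ 2)%:E)%E.
      rewrite integral_cst// lebesgue_plane_rect; [|by lra|by lra].
      rewrite -EFinM; congr (_%:E); rewrite /K exprD exprM.
      have -> : (r / 4) ^+ k = (1 / 4) ^+ k * r ^+ k by rewrite -exprMn mulrC mul1r.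
      by field.
    apply: ge0_le_integral => //.
    - by move=> p _; rewrite lee_fin sqr_ge0.
    - exact: (measurable_sqf mQ (subset_trans Qd dD)).
    move=> p Qp; rewrite lee_fin.
    have pr : sup_dist z0 p <= r by apply/sup_distP; apply/squareE/disc_square/Qd.
    have r4 : 0 <= r / 4 by rewrite divr_ge0// ltW.
    have rp : r / 4 <= sup_dist z0 p.
      rewrite /sup_dist le_max; apply/orP; left.
      by move/rectE : Qp => [/andP[? ?] _]; rewrite ger0_norm; lra.
    apply: lerXn2r; rewrite ?nnegrE ?cabs_ge0//.
      by rewrite mulr_ge0 ?(ltW c0)// exprn_ge0.
    apply: le_trans (fge p (le_lt_trans pr re)).
    by rewrite ler_pM2l//; apply: lerXn2r; rewrite // nnegrE sup_dist_ge0.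
  move: hlt; rewrite ltNge; apply/negP; rewrite negbK.
  apply: le_trans (ler_norm _); rewrite -lee_fin fineK//.
  apply: (@le_trans _ _ ((r ^- (k * 2 + 2))%:E * (K * r ^+ (k * 2 + 2))%:E)%E).
    by rewrite -EFinM lee_fin mulrCA mulVf ?mulr1// gt_eqF.
  by apply: lee_wpmul2l => //; rewrite lee_fin invr_ge0 ltW.
move/filter_ex => [_ []].
Unshelve. all: by end_near. Qed.

End VanishingOrder.

(** * The identity theorem on a connected open set *)

Section IdentityTheorem.
Variable R : realType.
Local Notation C := (Cplane R).
Local Notation mu := (lebesgue_plane R).
Local Notation point p := (p.1 +i* p.2 : C)%C.

Lemma re_im_eq0 (f : C -> C) (p : R * R) : f (point p) = 0 <-> re f p = 0 /\ im f p = 0.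
Proof.
rewrite /re /im; split => [->//|[a b]].
by apply/eqP; rewrite eq_complex; apply/andP; split; apply/eqP.
Qed.

Lemma closure_adherent (A : set C) (p : R * R) : closure A (point p) ->
  adherent (plane_set A) p.
Proof.
move=> cA e e0; have /open_nbhs_nbhs/cA[[x y] [Ap [/= p1 p2]]] := open_nbhs_box p e0.
by exists (x, y).
Qed.

Variables (D Omega : set C) (f : C -> C).
Hypotheses (oD : open D) (oO : open Omega) (OD : Omega `<=` D).
Hypotheses (sf : smooth_on D f) (hol : forall p, plane_set Omega p -> dbar2_eq0 f p).

(** All derivatives of [f] vanish at [p] by continuity from [A], and near [p] the quotient is
    identically [0], so its integrability is trivial and unique continuation applies. *)
Lemma holomorphic_eq0_adherent (A : set C) (p : R * R) : open A -> A `<=` Omega ->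
  (forall z, A z -> f z = 0) -> Omega (point p) -> closure A (point p) ->
  nbhs (point p : C) [set z | f z = 0].
Proof.
move=> oA AO f0 Op cA.
have oOp : open (plane_set Omega) by exact: open_plane_set.
have ODp : plane_set Omega `<=` plane_set D by move=> q; exact: OD.
have oAp : open (plane_set A) by exact: open_plane_set.
have ADp : plane_set A `<=` plane_set D by move=> q /AO/OD.
have flat_dbar : dbar2_flat f p.
  apply: (dbar2_flat_adherent oD oOp ODp sf hol (ODp _ Op)) => e e0.
  by exists p; split; rewrite // subrr normr0.
have flat_f := smooth_eq0_adherent oAp ADp sf
  (fun q Aq => (re_im_eq0 f q).1 (f0 _ Aq)) (ODp _ Op) (closure_adherent cA).
have [e e0 eO] := nbhs_box (open_nbhs_nbhs (conj oO Op)).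
have [|r r0 hr] := unique_continuation_at oD sf (ODp _ Op) flat_dbar flat_f e0.
  move=> rho /andP[rho0 rhoe].
  have := continuous_rect_integrable openT (@subsetT _ (square p rho)) (@continuous_onXc R setT 0).
  apply: eq_integrable => /=; first exact: measurable_rect.
  move=> q; rewrite inE => /squareE[q1 q2].
  have /hol[-> ->] : plane_set Omega q.
    by apply: eO; split; [apply: le_lt_trans q1 _|apply: le_lt_trans q2 _].
  by rewrite expr0n/= addr0 mul0r.
have [ob zb] := open_nbhs_box p r0.
apply: (filterS _ (open_nbhs_nbhs (conj ob zb))) => -[x y] [/= z1 z2].
exact: (re_im_eq0 f (x, y)).2 (hr (x, y) z1 z2).
Qed.

(** The part of [Omega] in the interior of the zero set is open and nonempty; by
    [holomorphic_eq0_adherent] it is also closed in [Omega]. *)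
Lemma holomorphic_identity : connected Omega ->
  (exists2 z, Omega z & nbhs z [set w | f w = 0]) ->
  forall z, Omega z -> f z = 0.
Proof.
move=> cO [z1 Oz1 nz1].
pose V := [set w | f w = 0]; pose Z := Omega `&` interior V.
have oI : open (interior V) by exact: open_interior.
have oZ : open Z by exact: openI.
have ZE : Z = Omega.
  apply: cO.
  - by exists z1.
  - by exists (interior V).
  - exists (closure Z); first exact: closed_closure.
    apply/seteqP; split => [z Zz|z [Oz cz]].
      by split; [case: Zz|exact: subset_closure].
    split; first exact: Oz.
    case: z Oz cz => x y Oz cz.
    apply: (@holomorphic_eq0_adherent Z (x, y)).
    - exact: oZ.
    - by move=> w [].
    - by move=> w [_ /interior_subset].
    - exact: Oz.
    - exact: cz.
by move=> z; rewrite -ZE => -[_ /interior_subset].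
Qed.

End IdentityTheorem.

Theorem corollary5p4 (R : realType) (Omega : set (Cplane R)) (z0 : Cplane R)
    (u : Cplane R -> Cplane R) (N : set (Cplane R)) (ue : Cplane R -> Cplane R) :
  open Omega -> connected Omega ->
  (closure Omega `\` interior Omega) z0 ->
  holomorphic_on Omega u ->
  ~ (exists c : Cplane R, forall z, Omega z -> u z = c) ->
  smooth_extension_across Omega u z0 N ue ->
  ue z0 = 0 ->
  (vanishes_to_infinite_order ue z0 <->
     notin_Lp_near +oo N z0 (dbar_quotient ue)) /\
  (notin_Lp_near +oo N z0 (dbar_quotient ue) <->
     notin_Lp_near 2%:E N z0 (dbar_quotient ue)).
Proof.
move=> oO cO [clz0 _] hu nc [[oN Nz0] sf ueu] uez0.
pose D := Omega `|` N; have oD : open D by exact: openU.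
have OD : Omega `<=` D by left.
have ND : N `<=` D by right.
case: z0 => x0 y0 in clz0 Nz0 uez0 *; pose p0 : R * R := (x0, y0).
have Dp0 : plane_set D p0 by exact: ND.
have hol := holomorphic_dbar2_eq0 oO hu ueu.
have flat_dbar : dbar2_flat ue p0.
  apply: (dbar2_flat_adherent oD (open_plane_set oO) _ sf hol Dp0).
    by move=> q; exact: OD.
  exact: (@closure_adherent R Omega p0).
(* This is the implication from (3) to (2), valid in both cases below. *)
have Loo_L2 : notin_Lp_near 2%:E N (x0 +i* y0)%C (dbar_quotient ue) ->
    notin_Lp_near +oo N (x0 +i* y0)%C (dbar_quotient ue).
  move=> n2 U oU UN iU; have [V [oV VU iV]] := @in_Lpoo_in_Lp2 R U p0 ue oU iU.
  exact: n2 V oV (subset_trans VU UN) iV.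
have [fl|] := pselect (forall k, iter k (real_deriv 1) ue (x0 +i* y0)%C = 0).
  have flat_f k := (re_im_eq0 (iter k (real_deriv 1) ue) p0).1 (fl k).
  have v1 := flat_vanishes oD sf Dp0 (flat_bigO oD sf Dp0 flat_dbar flat_f).
  have n2 : notin_Lp_near 2%:E N (x0 +i* y0)%C (dbar_quotient ue).
    move=> U oU UN iU; apply: nc; exists 0 => z Oz; rewrite -ueu//.
    have [e e0 he] := @in_Lp2_integrable R U p0 ue oU iU.
    have [r r0 hr] := unique_continuation_at oD sf Dp0 flat_dbar flat_f e0 he.
    apply: (holomorphic_identity oD oO OD sf hol cO) Oz.
    have ob := open_nbhs_box p0 r0.
    (* As a boundary point, [z0] is a limit of points of [Omega], so the box on which [ue] vanishes
       contains one; the identity theorem starts there and contradicts nonconstancy. *)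
    have [w [Ow bw]] := clz0 _ (open_nbhs_nbhs ob).
    exists w => //; apply: (filterS _ (open_nbhs_nbhs (conj ob.1 bw))) => -[x y] [/= z1 z2].
    exact: (re_im_eq0 ue (x, y)).2 (hr (x, y) z1 z2).
  have noo := Loo_L2 n2; by split; split.
move=> /existsNP[k0 /eqP fk0].
have [k fk kmin] := ex_minnP (ex_intro (fun k => iter k (real_deriv 1) ue (x0 +i* y0)%C != 0) k0 fk0).
have fj j : (j < k)%N -> iter j (real_deriv 1) ue (x0 +i* y0)%C = 0.
  move=> jk; apply/eqP; apply: contraLR jk; rewrite -leqNgt; exact: kmin.
have [c [e1 [c0 e10 hc]]] := finite_order_ge oD sf Dp0 flat_dbar fj fk.
have [B [e2 [B0 e20 hB]]] := dbar_le_bigO oD sf Dp0 flat_dbar k.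
have nv := finite_order_not_vanishes oD sf Dp0 c0 e10 hc.
have noo : ~ notin_Lp_near +oo N (x0 +i* y0)%C (dbar_quotient ue).
  have [e3 e30 e3N] := @nbhs_box R p0 N (open_nbhs_nbhs (conj oN Nz0)).
  pose e := Num.min (Num.min e1 e2) e3.
  have e0 : 0 < e by rewrite !lt_min e10 e20.
  have bN : box p0 e `<=` N.
    by move=> z [z1 z2]; apply: e3N; move: z1 z2; rewrite !lt_min => /andP[_ z1] /andP[_ z2].
  move/(_ (box p0 e) (open_nbhs_box p0 e0) bN); apply.
  (* Numerator at most [B r^k], denominator at least [c r^k]: flatness of [dbar] is used only to the
     order [k] of the zero. *)
  apply: (@bounded_in_Lpoo R p0 e D ue (B / c) e0 oD sf (subset_trans bN ND)).
  move=> p [p1 p2]; have : sup_dist p0 p < e by rewrite /sup_dist gt_max p1.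
  rewrite !lt_min => /andP[/andP[/hc h1 /hB h2] _].
  rewrite dbar_quotientE; have [->|f0] := eqVneq (cabs (ue (p.1 +i* p.2)%C)) 0.
    by rewrite invr0 mulr0 divr_ge0// ltW.
  have f1 : 0 < cabs (ue (p.1 +i* p.2)%C) by rewrite lt_neqAle eq_sym f0 cabs_ge0.
  rewrite ler_pdivrMr//; apply: le_trans h2 _.
  by rewrite -mulrA ler_wpM2l// mulrC ler_pdivlMr// mulrC.
(* Here (1) and (2) both fail, and (3) fails with (2) by [Loo_L2]. *)
by split; split.
Qed.
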